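(* Let $k, l>1$ be distinct integers. Then there exists a Toeplitz word $x\in\{0,1\}^{\mathbb{Z}}$ such that the Toeplitz system $X_x$ is regular and: (i) for every continuous map $F:X_x\to\mathbb{C}$ and every $y\in X_x$, the limit $$\lim_{N\to\infty}\frac{1}{N}\sum_{1\le m\leq N}F(\sigma^{m^l}y)$$ exists; (ii) the limit $$\lim_{N\to\infty}\frac{1}{N}\sum_{1\le m\leq N}G(\sigma^{m^k}x)$$ does not exist for the continuous function $G:X_x\to\mathbb{C}$, $G(y)=(-1)^{y(0)}$. Moreover, if $l$ is odd and there is a prime $q$ with $q\mid k$ and $q\nmid l$, then $x$ can be chosen so that, in addition to $X_x$ being regular and satisfying (i) and (ii), for every $y\in X_x$ the orbit $(\sigma^{m^l}y)_{m\ge 1}$ is equidistributed in $X_x$ with respect to the unique $\sigma$-invariant probability measure on $X_x$.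
   Context: Let $\sigma$ be the left shift on $\{0,1\}^{\mathbb{Z}}$ (product topology), $(\sigma y)(i)=y(i+1)$. A word $x\in\{0,1\}^{\mathbb{Z}}$ is called a Toeplitz word if for every $a\in\mathbb{Z}$ there exists $\ell\in\mathbb{Z}^+$ such that $x(a)=x(a+j\ell)$ for all $j\in\mathbb{Z}$. The Toeplitz system $X_x$ is the orbit closure $\overline{\{\sigma^n x:n\in\mathbb{Z}\}}$ in $\{0,1\}^{\mathbb{Z}}$ with the action of $\sigma$; it is minimal. For $n\in\mathbb{Z}^+$ let $\mathrm{Per}_n(x)=\{a\in\mathbb{Z}: x(a)=x(a+jn)\text{ for all }j\in\mathbb{Z}\}$. Every Toeplitz word $x$ admits a sequence $(n_t)_{t\ge 0}$ of positive integers with $n_t\mid n_{t+1}$ and $\bigcup_{t\ge0}\mathrm{Per}_{n_t}(x)=\mathbb{Z}$. The system $X_x$ is called regular if, for such a sequence, the density of $\bigcup_{t=0}^M\mathrm{Per}_{n_t}(x)$ in $\mathbb{Z}$ converges to $1$ as $M\to\infty$. A regular Toeplitz system is strictly ergodic (minimal with a unique $\sigma$-invariant Borel probability measure). For the unique $\sigma$-invariant probability measure $\mu$ on $X_x$, an orbit $(\sigma^{a_m}y)_{m\ge1}$ is equidistributed with respect to $\mu$ if $\frac1N\sum_{m\le N}F(\sigma^{a_m}y)\to\int_{X_x}F\,d\mu$ as $N\to\infty$ for every continuous $F:X_x\to\mathbb{C}$. *)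

(* Defs.v *)
From HB Require Import structures.
From mathcomp Require Import all_boot all_order all_algebra.
From mathcomp Require Import all_classical all_reals all_analysis.
From mathcomp Require Import complex.

Set Implicit Arguments.
Unset Strict Implicit.
Unset Printing Implicit Defensive.

Import Order.TTheory GRing.Theory Num.Theory.
Import numFieldNormedType.Exports.

Local Open Scope classical_set_scope.
Local Open Scope ring_scope.
Local Open Scope complex_scope.

Definition word : Type := prod_topology (fun _ : int => bool).

HB.instance Definition _ := Pointed.on word.
HB.instance Definition _ := Nbhs.on word.
HB.instance Definition _ := Topological.on word.
HB.instance Definition _ := Uniform.on word.

(* [shiftz n] is the n-th power of the left shift [shiftz 1], for n in Z;
   see [shiftz0], [shiftzD] and [shiftz_iter]. *)
Definition shiftz (n : int) (y : word) : word := fun i : int => y (i + n).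

Lemma shiftz0 y : shiftz 0 y = y.
Proof. by apply/funext => i; rewrite /shiftz addr0. Qed.

Lemma shiftzD m n y : shiftz (m + n) y = shiftz m (shiftz n y).
Proof. by apply/funext => i; rewrite /shiftz addrA. Qed.

Lemma shiftz_iter (n : nat) y : shiftz n%:Z y = iter n (shiftz 1) y.
Proof.
by elim: n => [|n IHn]; rewrite ?shiftz0// iterS -IHn -shiftzD -PoszD add1n.
Qed.

Definition Per (n : nat) (x : word) : set int :=
  [set a | forall j : int, x a = x (a + j * n%:Z)].

Definition toeplitz (x : word) : Prop :=
  forall a : int, exists2 n : nat, (0 < n)%N & Per n x a.

Definition orbit_closure (x : word) : set word :=
  closure [set shiftz n x | n in [set: int]].

Definition has_density (R : realType) (A : set int) (d : R) : Prop :=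
  (\sum_(0 <= i < N.*2.+1) \1_A (i%:Z - N%:Z)) / N.*2.+1%:R
    @[N --> \oo] --> d.

(* The limit does not depend on the sequence n: for two admissible sequences
   n and m, every Per (n t) x is contained in some Per (m s) x. *)
Definition toeplitz_regular (R : realType) (x : word) : Prop :=
  exists n : nat -> nat,
    [/\ forall t, (0 < n t)%N,
        forall t, (n t %| n t.+1)%N,
        \bigcup_t Per (n t) x = [set: int] &
        exists d : nat -> R,
          (forall M, has_density (\bigcup_(t in `I_M.+1) Per (n t) x) (d M)) /\
          d @ \oo --> (1 : R)].

Definition average (R : realType) (F : word -> R[i]^o) (a : nat -> int)
    (y : word) (N : nat) : R[i]^o :=
  N%:R^-1 * \sum_(1 <= m < N.+1) F (shiftz (a m) y).

Definition sign0 (R : realType) (y : word) : R[i]^o := (-1) ^+ y 0.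

Lemma sign0_continuous (R : realType) : continuous (@sign0 R).
Proof.
move=> y; apply: (@continuous_comp _ _ _ (fun z : word => z 0)
  (fun b : bool => (-1) ^+ b : R[i]^o)).
  exact: (@proj_continuous _ (fun _ : int => bool) 0).
move=> A /nbhs_singleton A0.
by change (nbhs (y 0) ((fun b : bool => (-1) ^+ b : R[i]^o) @^-1` A));
  rewrite nbhs_principalE; exact/principal_filterP.
Qed.

Definition borel_word : Type := g_sigma_algebraType (@open word).

HB.instance Definition _ := Measurable.on borel_word.

(* A Borel probability measure on the closed set X is represented by a Borel
   probability measure on the full shift giving mass 1 to X. *)
Definition invariant_on (R : realType) (X : set word)
    (mu : probability borel_word R) : Prop :=
  mu X = 1%E /\
  forall A : set borel_word, measurable A -> mu (shiftz 1 @^-1` A) = mu A.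

(* Measures are compared on measurable sets only: a measure of the library is
   a function on all sets, unconstrained outside the sigma-algebra. *)
Definition unique_invariant_on (R : realType) (X : set word)
    (mu : probability borel_word R) : Prop :=
  invariant_on X mu /\
  forall nu : probability borel_word R, invariant_on X nu ->
    forall A : set borel_word, measurable A -> nu A = mu A.

Definition complex_integral (R : realType) (mu : probability borel_word R)
    (X : set word) (F : word -> R[i]^o) : R[i] :=
  Rintegral mu X (fun y => complex.Re (F y)) +i*
  Rintegral mu X (fun y => complex.Im (F y)).

Definition equidistributed (R : realType) (X : set word)
    (mu : probability borel_word R) (a : nat -> int) (y : word) : Prop :=
  forall F : word -> R[i]^o, {within X, continuous F} ->
    average F a y @ \oo --> (complex_integral mu X F : R[i]^o).

(* Main.v *)
From HB Require Import structures.
Require Import Defs.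
From mathcomp Require Import all_boot all_order all_algebra.
From mathcomp Require Import all_classical all_reals all_analysis.
From mathcomp Require Import complex measurable_realfun.
From mathcomp Require Import zify ring lra.
From mathcomp Require Import all_solvable all_field.

(* A set A of integers, periodic modulo a product of many large primes, can be
   chosen so that A contains most powers m^k while every translate of A contains
   few powers m^l.  For a single prime p one takes the z with z^((p-1)/d) = v, for
   a suitable divisor d of p-1 and a suitable v: the proportion of such z among
   the m^k exceeds that among the m^l + a by an amount independent of p and a.
   For many primes the number of these conditions satisfied is concentrated near
   its mean, since residues modulo distinct primes are independent, and a
   threshold between the means defines A.

   Given such sets A_0, A_1, ... with periods P_s, let n_s = P_0 ... P_{s-1} and
   let x(z) be the parity of the least s with z outside A_s, where A_s is made to
   avoid the integers of absolute value at most n_s^k + s.  For most m <= n_s the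
   power m^k lies in A_0, ..., A_{s-1} but not in A_s, so the averages of the sign
   of x(m^k) oscillate with s.  Every translate of A_s contains a proportion of at
   most 2^-s of the m^l, so averages along m^l are approximated by averages of
   periodic functions and therefore converge.

   If m -> m^l is bijective modulo all P_s, these averages have the same limits
   as the averages along m, and the latter determine the invariant measure.  The
   primes needed for this, congruent to 1 modulo q but not modulo the primes
   dividing l, are found with Dirichlet characters and Mertens' estimates. *)

Set Implicit Arguments.
Unset Strict Implicit.
Unset Printing Implicit Defensive.

Import Order.TTheory GRing.Theory Num.Theory.
Local Open Scope ring_scope.

(** * Arithmetic functions *)

(** A single prime yields only a fixed gap between two proportions, while A_s has to miss at most
    2^-(s+3) of the m^k and to catch at most 2^-s of the m^l + a; hence the products of many primes.
    Uniformity in a is forced by the orbit closure, whose points are limits of translates of x. For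
    a nonzero modulo p it comes from the near-uniform distribution of m^l + a among the cosets of
    d-th powers, up to O(sqrt p). The case a = 0 dictates d and v. If k does not divide l, then d =
    k and v = 1: all nonzero m^k pass, but at most half of the m^l. If k divides l, this choice
    fails, since every m^l is also a k-th power; with d = l and v != 1 no m^l passes, and v can be
    chosen so that a proportion of about k/l >= 2/l of the m^k passes, against about 1/l for the
    other translates. The bijective case requires p - 1 prime to l, hence l odd because p - 1 is
    even, and a common factor q of k and p - 1 to single out the m^k. *)

Lemma pfactor_ind (P : nat -> Prop) :
  P 1%N ->
  (forall p a m, prime p -> ~~ (p %| m)%N -> (0 < m)%N -> P m ->
     P (p ^ a.+1 * m)%N) ->
  forall m, (0 < m)%N -> P m.
Proof.
move=> P1 PX m; have [n] := ubnP m; elim: n m => // n IHn m lt_mn m_gt0.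
have [m_le1|m_gt1] := leqP m 1; first by have ->: m = 1%N by lia.
set p := pdiv m; have p_pr : prime p by exact: pdiv_prime.
have [m' p'm' def_m] := pfactor_coprime p_pr m_gt0.
have m'_gt0 : (0 < m')%N by move: m_gt0; rewrite {1}def_m muln_gt0 => /andP[].
have logp_gt0 : (0 < logn p m)%N by rewrite logn_gt0 mem_primes p_pr m_gt0 pdiv_dvd.
have p_gt1 := prime_gt1 p_pr.
rewrite def_m -(prednK logp_gt0) mulnC; apply: PX => //.
  by rewrite -prime_coprime.
apply: IHn => //; rewrite ltnS in lt_mn; apply: leq_trans lt_mn.
rewrite [ltnRHS]def_m ltn_Pmulr // -(prednK logp_gt0) expnS.
by apply: leq_trans p_gt1 _; rewrite leq_pmulr // expn_gt0 prime_gt0.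
Qed.

Lemma perm_divisors_pfactor p a m : prime p -> ~~ (p %| m)%N -> (0 < m)%N ->
  perm_eq (divisors (p ^ a * m))
    [seq (p ^ j * d)%N | j <- iota 0 a.+1, d <- divisors m].
Proof.
move=> p_pr p'm m_gt0; have p_gt0 := prime_gt0 p_pr.
have co_d j d : (d %| m)%N -> logn p (p ^ j * d) = j.
  move=> dm; have d_gt0 := dvdn_gt0 m_gt0 dm.
  rewrite lognM ?expn_gt0 ?p_gt0 // pfactorK // (lognE p d).
  have /negPf-> : ~~ (p %| d)%N by apply: contraNN p'm => /dvdn_trans; apply.
  by rewrite !andbF addn0.
apply: uniq_perm; first exact: divisors_uniq.
  apply: allpairs_uniq; rewrite ?iota_uniq ?divisors_uniq //.
  move=> jd1 jd2 /allpairsP [[j1 d1] [_ d1m ->]].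
  move=> /allpairsP [[j2 d2] [_ d2m ->]] /= eq12; move: d1m d2m => /= d1m d2m.
  move: d1m d2m; rewrite -!dvdn_divisors // => d1m d2m.
  have eqj : j1 = j2 by rewrite -(co_d j1 d1) // eq12 co_d.
  move: eq12; rewrite eqj => /eqP; rewrite eqn_pmul2l ?expn_gt0 ?p_gt0 // => /eqP ->.
  by [].
move=> d; rewrite -dvdn_divisors ?muln_gt0 ?expn_gt0 ?p_gt0 //.
apply/idP/allpairsP => [dpm|[[j e] /= [jP em ->]]]; last first.
  move: jP em; rewrite -[_ :: _]/(iota 0 a.+1) mem_iota add0n ltnS -dvdn_divisors //.
  move=> /= ja em.
  by apply: dvdn_mul => //; rewrite dvdn_exp2l.
have d_gt0 : (0 < d)%N by apply: dvdn_gt0 dpm; rewrite muln_gt0 expn_gt0 p_gt0.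
have [e p'e def_d] := pfactor_coprime p_pr d_gt0.
exists (logn p d, e) => /=; split; last by rewrite mulnC.
  rewrite -[_ :: _]/(iota 0 a.+1) mem_iota /= add0n ltnS -(co_d a m) // dvdn_leq_log //.
  by rewrite muln_gt0 expn_gt0 p_gt0.
rewrite -dvdn_divisors // -(@Gauss_dvdr _ (p ^ a)).
  by apply: dvdn_trans dpm; rewrite [X in (_ %| X)%N]def_d dvdn_mulr.
by rewrite coprimeXr // coprime_sym.
Qed.

Lemma sum_divisors_pfactor (V : nmodType) (F : nat -> V) p a m :
  prime p -> ~~ (p %| m)%N -> (0 < m)%N ->
  \sum_(d <- divisors (p ^ a * m)) F d =
  \sum_(0 <= j < a.+1) \sum_(d <- divisors m) F (p ^ j * d)%N.
Proof.
move=> p_pr p'm m_gt0; rewrite (perm_big _ (perm_divisors_pfactor a p_pr p'm m_gt0)).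
by rewrite big_allpairs_dep /= /index_iota subn0.
Qed.

Lemma sum_multiples (V : nmodType) (F : nat -> V) d N : (0 < d)%N ->
  \sum_(1 <= m < N.+1 | (d %| m)%N) F m =
  \sum_(1 <= e < (N %/ d).+1) F (d * e)%N.
Proof.
move=> d_gt0; elim: N => [|N IHN]; first by rewrite div0n !big_geq.
rewrite big_mkcond big_nat_recr //= -big_mkcond IHN divnS //.
have [dN|] := boolP (d %| N.+1)%N; last by rewrite addr0.
rewrite add1n [RHS]big_nat_recr //=; congr (_ + F _).
by have := divnS N d_gt0; rewrite dN add1n => <-; rewrite mulnC divnK.
Qed.

Lemma sum_divisors (V : nmodType) (F : nat -> V) m N : (0 < m)%N -> (m <= N)%N ->
  \sum_(d <- divisors m) F d = \sum_(1 <= d < N.+1 | (d %| m)%N) F d.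
Proof.
move=> m_gt0 mN; rewrite -[RHS]big_filter; apply: perm_big; apply: uniq_perm.
- exact: divisors_uniq.
- by rewrite filter_uniq // iota_uniq.
move=> d; rewrite -dvdn_divisors // mem_filter mem_index_iota.
have [dm|//] := boolP (d %| m)%N; rewrite /= (dvdn_gt0 m_gt0 dm) ltnS.
by rewrite (leq_trans (dvdn_leq m_gt0 dm)).
Qed.

(** Each pair (d, e) with d e <= N occurs exactly once, for m = d e. *)
Lemma sum_dirichlet_convolution (V : nmodType) (G : nat -> nat -> V) N :
  \sum_(1 <= m < N.+1) \sum_(d <- divisors m) G d (m %/ d)%N =
  \sum_(1 <= d < N.+1) \sum_(1 <= e < (N %/ d).+1) G d e.
Proof.
under eq_big_nat => m /andP[m_gt0 mN] do rewrite (sum_divisors _ m_gt0 mN).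
rewrite (exchange_big_dep_nat predT) //=; apply: eq_big_nat => d /andP[d_gt0 _].
by rewrite sum_multiples //; apply: eq_bigr => e _; rewrite mulKn.
Qed.

(** * The von Mangoldt and Moebius functions *)

Section VonMangoldt.
Variable R : realType.

(** [primes m] lists the distinct prime divisors, so it is a singleton exactly when m is a power p^a
    with a > 0. *)
Definition mangoldt (m : nat) : R := if primes m is [:: p] then ln p%:R else 0.

Lemma perm_primes_pfactor p a m : prime p -> ~~ (p %| m)%N -> (0 < m)%N ->
  perm_eq (primes (p ^ a.+1 * m)) (p :: primes m).
Proof.
move=> p_pr p'm m_gt0; apply: uniq_perm; first exact: primes_uniq.
  by rewrite /= primes_uniq mem_primes (negPf p'm) !andbF.
move=> q; rewrite primesM // ?expn_gt0 ?prime_gt0 //.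
by rewrite primesX // primes_prime // !inE.
Qed.

Lemma mangoldt_ge0 m : 0 <= mangoldt m.
Proof.
rewrite /mangoldt; case E: (primes m) => [|p [|//]] //.
have : p \in primes m by rewrite E mem_head.
by rewrite mem_primes => /andP[p_pr _]; apply: ln_ge0; rewrite ler1n prime_gt0.
Qed.

Lemma mangoldt1 : mangoldt 1 = 0. Proof. by []. Qed.

Lemma mangoldt_pfactor p a : prime p -> mangoldt (p ^ a.+1) = ln p%:R.
Proof. by move=> p_pr; rewrite /mangoldt primesX // primes_prime. Qed.

Lemma mangoldt_eq0 p a m : prime p -> ~~ (p %| m)%N -> (1 < m)%N ->
  mangoldt (p ^ a.+1 * m) = 0.
Proof.
move=> p_pr p'm m_gt1; rewrite /mangoldt.
have /perm_size := perm_primes_pfactor a p_pr p'm (ltnW m_gt1).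
have : (0 < size (primes m))%N.
  have : pdiv m \in primes m by rewrite mem_primes pdiv_prime // pdiv_dvd ltnW.
  by case: (primes m).
by case: (primes (_ * _)) => [|q [|? ?]] //=; case: (size _).
Qed.

Lemma sum_mangoldt m : (0 < m)%N -> \sum_(d <- divisors m) mangoldt d = ln m%:R :> R.
Proof.
elim/pfactor_ind: m / => [|p a m p_pr p'm m_gt0 IHm]; first by rewrite big_seq1 ln1.
rewrite sum_divisors_pfactor // big_nat_recl //=.
rewrite (eq_bigr (@mangoldt)) => [|d _]; last by rewrite expn0 mul1n.
rewrite IHm natrM lnM ?posrE ?ltr0n ?expn_gt0 ?(prime_gt0 p_pr) //.
rewrite [in RHS]addrC; congr (_ + _).
under eq_bigr => j _.
  rewrite (bigD1_seq 1%N) ?divisors_uniq ?divisors1 -?dvdn_divisors ?dvd1n //=.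
  rewrite muln1 mangoldt_pfactor // big_seq_cond big1 ?addr0; last first.
    move=> d; rewrite -dvdn_divisors // => /andP[dm d1].
    rewrite mangoldt_eq0 //; first by apply: contraNN p'm => /dvdn_trans; apply.
    by have := dvdn_gt0 m_gt0 dm; move: d1; case: d dm => [|[|]].
  over.
by rewrite sumr_const_nat subn0 natrX lnXn ?ltr0n ?prime_gt0.
Qed.

Definition moebius (m : nat) : R :=
  if all (fun p => logn p m == 1%N) (primes m) then (-1) ^+ size (primes m) else 0.

Lemma normr_moebius m : `|moebius m| <= 1.
Proof. by rewrite /moebius; case: ifP; rewrite ?normr0 // normrX normrN1 expr1n. Qed.

Lemma moebius_pfactor p a m : prime p -> ~~ (p %| m)%N -> (0 < m)%N ->
  moebius (p ^ a.+1 * m) = if a == 0%N then - moebius m else 0.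
Proof.
move=> p_pr p'm m_gt0; rewrite /moebius.
have perm := perm_primes_pfactor a p_pr p'm m_gt0.
rewrite (perm_all _ perm) (perm_size perm) /=.
have p_gt0 := prime_gt0 p_pr.
rewrite lognM ?expn_gt0 ?p_gt0 // pfactorK // (lognE p m) (negPf p'm) !andbF addn0 eqSS.
case: eqP => [->|//] /=.
have -> : all (fun q => logn q (p ^ 1 * m) == 1%N) (primes m) =
    all (fun q => logn q m == 1%N) (primes m).
  apply: eq_in_all => q; rewrite mem_primes => /and3P[q_pr _ qm].
  rewrite lognM ?expn_gt0 ?p_gt0 // lognX (logn_prime _ p_pr).
  have /negPf-> : q != p by apply: contraNneq p'm => <-.
  by rewrite muln0.
by case: ifP; rewrite ?oppr0 // exprS mulN1r.
Qed.

(** The Moebius function kills the divisors divisible by p^2, and d and p d carry opposite signs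
    when p does not divide d. *)
Lemma sum_moebius_pfactor (F : nat -> R) p a m :
  prime p -> ~~ (p %| m)%N -> (0 < m)%N ->
  \sum_(d <- divisors (p ^ a.+1 * m)) moebius d * F d =
  \sum_(d <- divisors m) moebius d * (F d - F (p * d)%N).
Proof.
move=> p_pr p'm m_gt0; rewrite sum_divisors_pfactor // big_nat_recl //= big_nat_recl //=.
have pd d : d \in divisors m -> ~~ (p %| d)%N /\ (0 < d)%N.
  rewrite -dvdn_divisors // => dm; split; last exact: dvdn_gt0 dm.
  by apply: contraNN p'm => /dvdn_trans; apply.
rewrite [X in _ + (_ + X)]big1 ?addr0 => [|j _]; last first.
  by rewrite big_seq big1 // => d /pd[p'd d_gt0]; rewrite moebius_pfactor // mul0r.
rewrite -big_split /= big_seq [RHS]big_seq; apply: eq_bigr => d /pd[p'd d_gt0].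
by rewrite moebius_pfactor //= expn1 expn0 mul1n; ring.
Qed.

Lemma sum_moebius m : (0 < m)%N ->
  \sum_(d <- divisors m) moebius d = (m == 1%N)%:R.
Proof.
move=> m_gt0; rewrite -[LHS](eq_bigr _ (fun d _ => mulr1 _)).
elim/pfactor_ind: m / m_gt0 => [|p a m p_pr p'm m_gt0 _].
  by rewrite big_seq1 /moebius /= mulr1.
rewrite (sum_moebius_pfactor (fun=> 1)) // big1 => [|d _]; last by rewrite subrr mulr0.
by case: eqP => // /eqP; rewrite muln_eq1 expnS muln_eq1; case: (p) p_pr => [|[]].
Qed.

(** For F = ln the differences F(d) - F(p d) equal - ln p for all d. What remains is the sum of mu
    over the divisors of the cofactor m, which vanishes unless the whole number is a power of p. *)
Lemma sum_moebius_ln m : (0 < m)%N ->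
  \sum_(d <- divisors m) moebius d * ln d%:R = - mangoldt m.
Proof.
elim/pfactor_ind: m / => [|p a m p_pr p'm m_gt0 _].
  by rewrite big_seq1 ln1 mulr0 mangoldt1 oppr0.
rewrite (sum_moebius_pfactor (fun d => ln d%:R)) //.
transitivity (\sum_(d <- divisors m) moebius d * - ln p%:R : R).
  rewrite big_seq [RHS]big_seq; apply: eq_bigr => d; rewrite -dvdn_divisors // => dm.
  rewrite natrM lnM ?posrE ?ltr0n ?(prime_gt0 p_pr) ?(dvdn_gt0 m_gt0 dm) //.
  by congr (_ * _); ring.
rewrite -big_distrl /= sum_moebius //.
have [->|m_neq1] := eqVneq m 1%N; first by rewrite muln1 mangoldt_pfactor // mul1r.
by rewrite mangoldt_eq0 ?mul0r ?oppr0 //; case: (m) m_gt0 m_neq1 => [|[]].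
Qed.

End VonMangoldt.

(** * Chebyshev and Mertens estimates *)

Section Chebyshev.
Variable R : realType.
Local Notation mangoldt := (mangoldt R).

Definition sum_ln (N : nat) : R := \sum_(1 <= m < N.+1) ln m%:R.

Lemma ln_natS_sub m : (0 < m)%N -> ln m.+1%:R - ln m%:R <= m%:R^-1 :> R.
Proof.
move=> m_gt0; have m_gt0R : 0 < m%:R :> R by rewrite ltr0n.
rewrite -ln_div ?posrE ?ltr0n // -natr1 mulrDl divff ?gt_eqF // mul1r.
by apply: le_ln1Dx; rewrite (@lt_trans _ _ 0) // ?invr_gt0 // ltrN10.
Qed.

Lemma ler_ln_nat a b : (0 < a)%N -> (a <= b)%N -> ln a%:R <= ln b%:R :> R.
Proof. by move=> a0 ab; rewrite ler_ln ?posrE ?ltr0n ?(leq_trans a0) ?ler_nat. Qed.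

Lemma sum_ln_le N : sum_ln N <= N%:R * ln N%:R.
Proof.
rewrite /sum_ln -[leRHS]/(N%:R * ln N%:R) mulr_natl -[X in _ *+ X]subn0.
rewrite -[X in _ *+ (X - 0)]/(N.+1.-1) subn0 -{3}[N]subn0 -(subSS 0 N) -sumr_const_nat.
by apply: ler_sum_nat => m /andP[m_gt0 mN]; apply: ler_ln_nat.
Qed.

Lemma sum_ln_ge N : N%:R * ln N%:R - N%:R <= sum_ln N.
Proof.
rewrite /sum_ln; elim: N => [|N IHN]; first by rewrite big_geq // mul0r subr0.
rewrite big_nat_recr //=; apply: le_trans (lerD IHN (lexx _)).
have [->|N_gt0] := posnP N; first by rewrite ln1; lra.
have := ln_natS_sub N_gt0; rewrite -natr1 => le_ln.
have : N%:R * (ln (N%:R + 1) - ln N%:R) <= N%:R * N%:R^-1 :> R by rewrite ler_wpM2l.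
by rewrite divff ?pnatr_eq0 -?lt0n //; lra.
Qed.

(** Each ln m is the sum of Lambda over the divisors of m, and d has floor(N/d) multiples up to N:
    Legendre's formula for N! in logarithmic form. *)
Lemma sum_ln_mangoldt N :
  sum_ln N = \sum_(1 <= d < N.+1) mangoldt d * (N %/ d)%:R.
Proof.
rewrite /sum_ln; transitivity
  (\sum_(1 <= m < N.+1) \sum_(d <- divisors m) (fun d _ => mangoldt d) d (m %/ d)%N).
  by apply: eq_big_nat => m /andP[m_gt0 _]; rewrite sum_mangoldt.
rewrite (sum_dirichlet_convolution (fun d _ => mangoldt d)); apply: eq_bigr => d _.
by rewrite sumr_const_nat subSS subn0 mulr_natr.
Qed.

Definition chebyshev_psi (N : nat) : R := \sum_(1 <= d < N.+1) mangoldt d.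

(** Lambda(d) occurs in ln((2N)! / N!^2) with coefficient floor(2N/d) - 2 floor(N/d), which is
    nonnegative, and at least 1 for N < d <= 2N. This logarithm is at most 2N ln 2 + 2N <= 4N. *)
Lemma chebyshev_psi_double N :
  chebyshev_psi (N + N) <= chebyshev_psi N + 4 * N%:R.
Proof.
have [->|N_gt0] := posnP N; first by rewrite mulr0 addr0.
have ln2 : ln 2%:R <= 1 :> R by have := @ln_natS_sub 1 isT; rewrite ln1 invr1; lra.
have dbl : chebyshev_psi (N + N) - chebyshev_psi N <= sum_ln (N + N) - (sum_ln N + sum_ln N).
  have ext : sum_ln N = \sum_(1 <= d < (N + N).+1) mangoldt d * (N %/ d)%:R.
    rewrite sum_ln_mangoldt (@big_cat_nat _ _ _ N.+1 1%N (N + N).+1) //= ?ltnS ?leq_addr //.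
    rewrite [X in _ + X]big_nat [X in _ + X]big1 ?addr0 // => d /andP[Nd _].
    by rewrite divn_small ?mulr0.
  rewrite -mulr2n -mulr_natl ext sum_ln_mangoldt /chebyshev_psi.
  rewrite (@big_cat_nat _ _ _ N.+1 1%N (N + N).+1) //= ?ltnS ?leq_addr // addrAC subrr add0r.
  rewrite big_distrr /= -sumrB (@big_cat_nat _ _ _ N.+1 1%N (N + N).+1) //= ?ltnS ?leq_addr //.
  rewrite -[leLHS]add0r; apply: lerD.
    apply: sumr_ge0 => d _; rewrite mulrCA -mulrBr mulr_ge0 ?mangoldt_ge0 //.
    rewrite subr_ge0 -natrM ler_nat; have [->|d_gt0] := posnP d; first by rewrite !divn0.
    by rewrite leq_divRL // -mulnA mul2n -addnn leq_add ?leq_trunc_div.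
  apply: ler_sum_nat => d /andP[Nd dNN]; rewrite (divn_small Nd) !mulr0 subr0.
  by rewrite ler_peMr ?mangoldt_ge0 // ler1n divn_gt0 // (leq_trans _ Nd).
have := sum_ln_ge N; have := sum_ln_le (N + N).
have -> : ln (N + N)%:R = ln 2%:R + ln N%:R :> R.
  by rewrite addnn -mul2n natrM lnM ?posrE ?ltr0n.
rewrite natrD; have : N%:R * ln 2%:R <= N%:R :> R by rewrite ler_piMr.
move: dbl ln2; nra.
Qed.

Lemma chebyshev_psi_le N : chebyshev_psi N <= 8 * N%:R.
Proof.
have [n] := ubnP N; elim: n N => // n IHn N; rewrite ltnS => leNn.
have [N_le1|N_gt1] := leqP N 1.
  rewrite /chebyshev_psi; case: N N_le1 leNn => [|[|]] // _ _; first by rewrite big_geq ?mulr0.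
  by rewrite big_nat1 mangoldt1 mulr1.
have le1 : chebyshev_psi N <= chebyshev_psi (uphalf N + uphalf N).
  rewrite /chebyshev_psi [leRHS](@big_cat_nat _ _ _ N.+1) //=; last lia.
  by rewrite lerDl sumr_ge0 // => d _; exact: mangoldt_ge0.
have IH := IHn (uphalf N) ltac:(lia).
(* The constant 8 is the least c with c u + 4 u <= c N for u = ceil(N/2) and all N >= 2; the tight
   case is N = 3. *)
have : 12 * (uphalf N)%:R <= 8 * N%:R :> R by rewrite -!natrM ler_nat; lia.
have := chebyshev_psi_double (uphalf N); lra.
Qed.

Definition mertens_sum N : R := \sum_(1 <= d < N.+1) mangoldt d / d%:R.

(** Dropping the floors in the formula for ln N! adds an amount between 0 and psi(N) <= 8N; division
    by N gives Mertens' estimate with explicit constants. *)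
Lemma mertens_sum_bounds N : (0 < N)%N ->
  ln N%:R - 1 <= mertens_sum N <= ln N%:R + 8.
Proof.
move=> N_gt0; have N_gt0R : 0 < N%:R :> R by rewrite ltr0n.
have diff : 0 <= N%:R * mertens_sum N - sum_ln N <= chebyshev_psi N.
  rewrite /mertens_sum sum_ln_mangoldt /chebyshev_psi big_distrr /= -sumrB.
  have bnd d : (1 <= d < N.+1)%N ->
      0 <= N%:R * (mangoldt d / d%:R) - mangoldt d * (N %/ d)%:R <= mangoldt d.
    case/andP => d_gt0 _; have d_gt0R : 0 < d%:R :> R by rewrite ltr0n.
    rewrite mulrCA -mulrBr mulr_ge0 ?mangoldt_ge0 //=; last first.
      by rewrite subr_ge0 ler_pdivlMr // -natrM ler_nat leq_trunc_div.
    rewrite -[leRHS]mulr1 ler_wpM2l ?mangoldt_ge0 // lerBlDl natr1 ler_pdivrMr //.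
    by rewrite -natrM ler_nat ltnW // ltn_ceil.
  apply/andP; split; last by apply: ler_sum_nat => d dN; have /andP[] := bnd d dN.
  by rewrite big_nat; apply: sumr_ge0 => d dN; have /andP[] := bnd d dN.
have := sum_ln_ge N; have := sum_ln_le N; have := chebyshev_psi_le N.
move: diff => /andP[d1 d2] c1 c2 c3; apply/andP; split.
  by rewrite -(ler_pM2l N_gt0R); lra.
by rewrite -(ler_pM2l N_gt0R); lra.
Qed.

Lemma sum_geometric_le (x : R) J : 0 <= x -> x <= 2^-1 ->
  \sum_(2 <= j < J.+1) x ^+ j <= 2 * x ^+ 2.
Proof.
move=> x_ge0 x_le; have [J_le1|J_gt1] := leqP J 1.
  by rewrite big_geq // mulr_ge0 // exprn_ge0.
suff: \sum_(2 <= j < J.+1) x ^+ j <= 2 * x ^+ 2 - 2 * x ^+ J.+1.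
  by have := exprn_ge0 J.+1 x_ge0; lra.
elim: J J_gt1 => // -[//|[_ _|J /(_ isT) IH _]].
  rewrite big_nat1; have : 0 <= x ^+ 2 by rewrite exprn_ge0.
  by rewrite (exprS x 2); nra.
rewrite big_nat_recr //=; have : 0 <= x ^+ J.+3 by rewrite exprn_ge0.
by move: IH; rewrite (exprS x J.+3); nra.
Qed.

(** Since ln p <= 2 sqrt p, the terms are O(p^(-3/2)) and are dominated by differences of 4 / sqrt
    p, which telescope. *)
Lemma sum_ln_div_sqr_le N : \sum_(2 <= p < N.+1) ln p%:R / p%:R ^+ 2 <= 4 :> R.
Proof.
have [N_le1|N_gt1] := leqP N 1; first by rewrite big_geq // ?ler0n.
suff: \sum_(2 <= p < N.+1) ln p%:R / p%:R ^+ 2 <= 4 - 4 / Num.sqrt N%:R :> R.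
  have : 0 <= 4 / Num.sqrt N%:R :> R by rewrite divr_ge0 ?sqrtr_ge0.
  lra.
have step p : (0 < p)%N -> ln p.+1%:R / p.+1%:R ^+ 2 <=
    4 / Num.sqrt p%:R - 4 / Num.sqrt p.+1%:R :> R.
  move=> p_gt0; set s := Num.sqrt p.+1%:R; set r := Num.sqrt p%:R.
  have r_gt0 : 0 < r by rewrite sqrtr_gt0 ltr0n.
  have rs : r <= s by rewrite ler_sqrt ?ler_nat.
  have s_gt0 : 0 < s by apply: lt_le_trans rs.
  have s2 : p.+1%:R = s ^+ 2 by rewrite sqr_sqrtr.
  have r2 : r ^+ 2 = s ^+ 2 - 1 by rewrite -s2 sqr_sqrtr // -natr1; lra.
  have lns : ln p.+1%:R <= 2 * s.
    by rewrite s2 lnXn // mulr2n; have := ln_sublinear s_gt0; lra.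
  apply: (@le_trans _ _ (2 * s / s ^+ 4)).
    by rewrite s2 -exprM ler_wpM2r ?invr_ge0 ?exprn_ge0 ?(ltW s_gt0) // -s2.
  rewrite -mulrBr -subr_ge0.
  have -> : 4 * (r^-1 - s^-1) - 2 * s / s ^+ 4 =
     (4 * (s - r) * s ^+ 2 - 2 * r) / (r * s ^+ 3).
    by field; rewrite !gt_eqF.
  rewrite divr_ge0 ?mulr_ge0 ?exprn_ge0 ?ltW //.
  have : (s - r) * (s + r) = 1 by rewrite -subr_sqr r2; ring.
  nra.
elim: N N_gt1 => // -[//|[_ _|N /(_ isT) IH _]].
  by rewrite big_nat1; have := @step 1 isT; rewrite sqrtr1 divr1.
rewrite big_nat_recr //=; apply: le_trans (lerD IH (@step N.+2 isT)) _.
by rewrite addrA subrK.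
Qed.

(** Proper prime powers contribute a bounded amount, so sums weighted by Lambda(m)/m are governed by
    their primes. In the proof p runs over all integers from 2 on, which only enlarges the sum; for
    each p the powers p^j with j >= 2 give at most 2 ln p / p^2. *)
Lemma sum_mangoldt_nonprime_le N :
  \sum_(1 <= m < N.+1 | ~~ prime m) mangoldt m / m%:R <= 8.
Proof.
apply: (@le_trans _ _ (\sum_(1 <= m < N.+1) \sum_(2 <= p < N.+1)
   \sum_(2 <= j < N.+1) (m == p ^ j)%N%:R * (ln p%:R / m%:R))).
  rewrite big_mkcond /=; apply: ler_sum_nat => m /andP[m_gt0 mN].
  have term_ge0 p j : (0 < p)%N -> 0 <= (m == p ^ j)%N%:R * (ln p%:R / m%:R) :> R.
    by move=> p_gt0; rewrite mulr_ge0 // divr_ge0 // ln_ge0 // ler1n.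
  have sum_ge0 : 0 <= \sum_(2 <= p < N.+1)
      \sum_(2 <= j < N.+1) (m == p ^ j)%N%:R * (ln p%:R / m%:R) :> R.
    rewrite big_nat; apply: sumr_ge0 => p /andP[p_gt1 _]; apply: sumr_ge0 => j _.
    by rewrite term_ge0 // ltnW.
  case: ifP => // npr; rewrite /mangoldt; case E: (primes m) => [|p [|//]]; rewrite ?mul0r //.
  have : p \in primes m by rewrite E mem_head.
  rewrite mem_primes => /and3P[p_pr _ pm].
  have def_m : m = (p ^ logn p m)%N.
    by rewrite {1}(prod_prime_decomp m_gt0) prime_decompE E /= big_seq1.
  have log_gt1 : (1 < logn p m)%N.
    have : (0 < logn p m)%N by rewrite logn_gt0 E mem_head.
    case El: (logn p m) => [|[|]] // _.
    by move: npr; rewrite def_m El expn1 p_pr.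
  have pN : (p < N.+1)%N by rewrite (leq_ltn_trans (dvdn_leq m_gt0 pm)).
  have jN : (logn p m < N.+1)%N.
    by apply: leq_trans mN; rewrite ltnS [leqRHS]def_m ltnW // ltn_expl // prime_gt1.
  rewrite (bigD1_seq p) ?mem_index_iota ?prime_gt1 ?pN ?iota_uniq //=.
  rewrite (bigD1_seq (logn p m)) ?mem_index_iota ?log_gt1 ?jN ?iota_uniq //=.
  rewrite -def_m eqxx mul1r -addrA lerDl addr_ge0 //.
    by apply: sumr_ge0 => j _; rewrite term_ge0 ?prime_gt0.
  rewrite big_seq_cond; apply: sumr_ge0 => p'; rewrite mem_index_iota => /andP[/andP[p'_gt1 _] _].
  by apply: sumr_ge0 => j _; rewrite term_ge0 // ltnW.
rewrite exchange_big_nat /=.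
apply: (@le_trans _ _ (\sum_(2 <= p < N.+1) 2 * (ln p%:R / p%:R ^+ 2))); last first.
  by rewrite -big_distrr /=; have := sum_ln_div_sqr_le N; lra.
apply: ler_sum_nat => p /andP[p_gt1 _]; rewrite exchange_big_nat /=.
have p_gt0R : 0 < p%:R :> R by rewrite ltr0n ltnW.
have lnp : 0 <= ln p%:R :> R by rewrite ln_ge0 // ler1n ltnW.
apply: (@le_trans _ _ (\sum_(2 <= j < N.+1) ln p%:R * p%:R^-1 ^+ j)); last first.
  rewrite -big_distrr /= mulrCA ler_wpM2l // -exprVn.
  by apply: sum_geometric_le; rewrite ?invr_ge0 ?ler0n // lef_pV2 ?posrE ?ler_nat.
apply: ler_sum => j _.
have [pjN|pjN] := boolP ((p ^ j)%N \in index_iota 1 N.+1).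
  rewrite (bigD1_seq (p ^ j)%N) ?iota_uniq //= eqxx mul1r natrX exprVn.
  by rewrite big1 ?addr0 // => m /negPf->; rewrite mul0r.
rewrite big_seq big1 ?mulr_ge0 ?exprn_ge0 ?invr_ge0 ?ler0n // => m mN.
by case: eqP mN pjN => [->->//|]; rewrite mul0r.
Qed.

End Chebyshev.

(** * Non-vanishing of character sums *)

Section CharacterSums.
Local Open Scope complex_scope.
Import ComplexField.Normc.
Local Notation Re := complex.Re.
Local Notation Im := complex.Im.

Section ComplexModulus.
Variable R : realType.
Implicit Types z w : R[i].

Lemma normc_ge0 z : 0 <= normc z.
Proof. by case: z => a b; exact: sqrtr_ge0. Qed.

Lemma normc_real (r : R) : normc r%:C = `|r|.
Proof. by rewrite /= expr0n /= addr0 sqrtr_sqr. Qed.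

Lemma normcD z w : normc (z + w) <= normc z + normc w.
Proof. exact: (@le_normcD R). Qed.

Lemma normcB z w : normc (z - w) <= normc z + normc w.
Proof. by rewrite -(@normcN R w); exact: normcD. Qed.

Lemma normc_sum (I : Type) (r : seq I) (P : pred I) (F : I -> R[i]) :
  normc (\sum_(i <- r | P i) F i) <= \sum_(i <- r | P i) normc (F i).
Proof.
elim/big_rec2: _ => [|i y x _ le_xy]; first by rewrite normc0.
by apply: le_trans (normcD _ _) _; rewrite lerD2l.
Qed.

Lemma normr_Re_le z : `|Re z| <= normc z.
Proof.
by case: z => a b /=; rewrite -sqrtr_sqr ler_wsqrtr // lerDl sqr_ge0.
Qed.

Lemma normr_Im_le z : `|Im z| <= normc z.
Proof.
by case: z => a b /=; rewrite -sqrtr_sqr ler_wsqrtr // lerDr sqr_ge0.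
Qed.

Lemma normc_le_ReIm z : normc z <= `|Re z| + `|Im z|.
Proof.
case: z => a b /=; rewrite -(ler_pXn2r (n := 2)) ?nnegrE ?sqrtr_ge0 ?addr_ge0 //.
rewrite sqr_sqrtr ?addr_ge0 ?sqr_ge0 // sqrrD !real_normK ?num_real //.
have : 0 <= `|a| * `|b| by rewrite mulr_ge0.
lra.
Qed.

Lemma ReMreal z (r : R) : Re (z * r%:C) = Re z * r.
Proof. by case: z => a b /=; rewrite mulr0 subr0. Qed.

Lemma Re_sum (I : Type) (r : seq I) (P : pred I) (F : I -> R[i]) :
  Re (\sum_(i <- r | P i) F i) = \sum_(i <- r | P i) Re (F i).
Proof. by elim/big_rec2: _ => //= i y x _ <-; case: (F i) x => [? ?] [? ?]. Qed.

Lemma Im_sum (I : Type) (r : seq I) (P : pred I) (F : I -> R[i]) :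
  Im (\sum_(i <- r | P i) F i) = \sum_(i <- r | P i) Im (F i).
Proof. by elim/big_rec2: _ => //= i y x _ <-; case: (F i) x => [? ?] [? ?]. Qed.

(** The supremum of the lower bounds u_M - e_M serves as the limit: every u_N + e_N is above all of
    them, which yields the rate e directly. *)
Lemma cauchy_tail_limit (u e : nat -> R) :
  (forall M, 0 <= e M) ->
  (forall M N, (M <= N)%N -> `|u N - u M| <= e M) ->
  exists l, forall M, `|u M - l| <= e M.
Proof.
move=> e_ge0 ue; pose A := [set u M - e M | M in [set: nat]]%classic.
have ubA N : ubound A (u N + e N).
  move=> _ [M _ <-]; have [MN|/ltnW NM] := leqP M N.
    by have := ue _ _ MN; rewrite ler_norml => /andP[]; have := e_ge0 N; lra.
  by have := ue _ _ NM; rewrite ler_norml => /andP[]; have := e_ge0 M; lra.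
exists (sup A) => M; rewrite ler_distl; apply/andP; split.
  by rewrite lerBlDr; apply: ge_sup => //; exists (u 0%N - e 0%N); exists 0%N.
rewrite -lerBlDr; apply: ub_le_sup; last by exists M.
by exists (u 0%N + e 0%N).
Qed.

Lemma cauchy_tail_limitc (u : nat -> R[i]) (e : nat -> R) :
  (forall M, 0 <= e M) ->
  (forall M N, (M <= N)%N -> normc (u N - u M) <= e M) ->
  exists l, forall M, normc (u M - l) <= 2 * e M.
Proof.
move=> e_ge0 ue.
have ReB z w : Re (z - w) = Re z - Re w by case: z w => [? ?] [? ?].
have ImB z w : Im (z - w) = Im z - Im w by case: z w => [? ?] [? ?].
have [|a ha] := @cauchy_tail_limit (fun k => Re (u k)) e e_ge0.
  by move=> M N MN /=; rewrite -ReB; apply: le_trans (normr_Re_le _) (ue _ _ MN).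
have [|b hb] := @cauchy_tail_limit (fun k => Im (u k)) e e_ge0.
  by move=> M N MN /=; rewrite -ImB; apply: le_trans (normr_Im_le _) (ue _ _ MN).
exists (a +i* b) => M; apply: le_trans (normc_le_ReIm _) _.
by rewrite ReB ImB /=; have := ha M; have := hb M; rewrite /=; lra.
Qed.

End ComplexModulus.

(** * Dirichlet characters and the value L(1, chi) *)

Section DirichletCharacter.
Variable R : realType.
Local Notation mangoldt := (mangoldt R).

(** The field [normc_dchi] says at once that chi vanishes exactly on the residues not prime to n and
    has modulus 1 on the others. *)
Record dirichlet_character (n : nat) (chi : nat -> R[i]) : Prop :=
  DirichletCharacter {
    dchi_modulus_gt0 : (0 < n)%N;
    dchi_periodic : forall m, chi (m + n)%N = chi m;
    dchiM : forall a b, chi (a * b)%N = chi a * chi b;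
    normc_dchi : forall m, normc (chi m) = (coprime n m)%:R }.

Definition nonprincipal (n : nat) (chi : nat -> R[i]) : Prop :=
  exists2 c, coprime n c & chi c != 1.

Lemma dchi1 n chi : dirichlet_character n chi -> chi 1%N = 1.
Proof.
case=> n_gt0 _ chiM norm_chi; have := norm_chi 1%N; rewrite coprimen1 => n1.
have chi1_neq0 : chi 1%N != 0.
  by apply/eqP => chi10; move: n1; rewrite chi10 normc0 => /eqP; rewrite eq_sym oner_eq0.
by apply: (mulfI chi1_neq0); rewrite -chiM mulr1 muln1.
Qed.

Lemma dchi_mod n chi m : dirichlet_character n chi -> chi (m %% n)%N = chi m.
Proof.
case=> _ per _ _; rewrite [in RHS](divn_eq m n); elim: (m %/ n)%N => [|q ->] //.
by have -> : (q.+1 * n + m %% n = q * n + m %% n + n)%N by lia.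
Qed.

Lemma dirichlet_characterM n chi chi' :
  dirichlet_character n chi -> dirichlet_character n chi' ->
  dirichlet_character n (fun m => chi m * chi' m).
Proof.
move=> [n_gt0 per chiM nchi] [_ per' chiM' nchi']; split=> // [m|a b|m].
- by rewrite per per'.
- by rewrite chiM chiM' mulrACA.
by rewrite normcM nchi nchi' -natrM mulnb andbb.
Qed.

Definition char_sum (chi : nat -> R[i]) N : R[i] := \sum_(0 <= m < N) chi m.

(** Multiplication by c permutes the residues modulo n, so the sum over a period equals chi(c) times
    itself, with chi(c) != 1. *)
Lemma char_sum_period n chi : dirichlet_character n chi -> nonprincipal n chi ->
  char_sum chi n = 0.
Proof.
move=> chiP [c nc chi_c]; have [n_gt0 _ chiM _] := chiP.
case: n n_gt0 chiP nc => // n _ chiP nc.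
rewrite /char_sum big_mkord.
have inj_c : injective (fun m : 'I_n.+1 => inord (c * m %% n.+1) : 'I_n.+1).
  move=> a b /(congr1 val); rewrite /= !inordK ?ltn_mod // => /eqP.
  have wlog_ab (x y : 'I_n.+1) : (x <= y)%N -> c * x = c * y %[mod n.+1] -> x = y.
    move=> xy /eqP; rewrite eq_sym eqn_mod_dvd ?leq_mul // -mulnBr Gauss_dvdr //.
    move=> /dvdn_leq; have := ltn_ord y; rewrite subn_gt0 => yn yx.
    by apply/val_inj/eqP; rewrite eqn_leq xy leqNgt /=; apply/negP => /yx; lia.
  by case/orP: (leq_total a b) => [ab|ba] /eqP ?; [|apply/esym]; exact: wlog_ab.
have : \sum_(i < n.+1) chi i = chi c * \sum_(i < n.+1) chi i.
  rewrite {1}(reindex_inj inj_c) big_distrr /=; apply: eq_bigr => i _.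
  by rewrite inordK ?ltn_mod // (dchi_mod _ chiP) chiM.
move/eqP; rewrite -subr_eq0 -{1}[\sum_(i < _) _]mul1r -mulrBl mulf_eq0 subr_eq0.
by rewrite eq_sym (negPf chi_c) => /eqP.
Qed.

Lemma normc_char_sum n chi N : dirichlet_character n chi -> nonprincipal n chi ->
  normc (char_sum chi N) <= n%:R.
Proof.
move=> chiP npr; have [n_gt0 per chiM nchi] := chiP.
have sum_per m : char_sum chi (m + n) = char_sum chi m.
  elim: m => [|m IHm]; first by rewrite add0n (char_sum_period chiP npr) /char_sum big_geq.
  by rewrite addSn /char_sum !big_nat_recr //= -!/(char_sum _ _) IHm per.
have -> : char_sum chi N = char_sum chi (N %% n)%N.
  rewrite [in LHS](divn_eq N n); elim: (N %/ n)%N => [|q IHq] //.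
  by rewrite mulSn -addnA addnC sum_per.
apply: le_trans (normc_sum _ _ _) _.
apply: (@le_trans _ _ (\sum_(0 <= m < N %% n) 1)).
  by apply: ler_sum => m _; rewrite nchi; case: (coprime _ _).
by rewrite sumr_const_nat subn0 ler_nat ltnW // ltn_mod.
Qed.

(** Summation by parts: the character sums are bounded by n, and the variation of the decreasing f
    from a on is at most f(a). The bound is independent of b, so it controls tails of series. *)
Lemma char_sum_abel n chi (f : nat -> R) a b :
  dirichlet_character n chi -> nonprincipal n chi -> 
  (forall m, (a <= m)%N -> 0 <= f m) ->
  (forall m, (a <= m)%N -> f m.+1 <= f m) ->
  normc (\sum_(a <= m < b) chi m * (f m)%:C) <= 2 * n%:R * f a.
Proof.
move=> chiP npr f_ge0 f_dec; have nA N := normc_char_sum N chiP npr.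
have f_a : 0 <= 2 * n%:R * f a by rewrite !mulr_ge0 ?f_ge0.
have [ba|ab] := leqP b a; first by rewrite big_geq // normc0.
case: b ab => // b; rewrite ltnS => ab.
have abel : \sum_(a <= m < b.+1) chi m * (f m)%:C =
    char_sum chi b.+1 * (f b)%:C - char_sum chi a * (f a)%:C +
    \sum_(a <= m < b) char_sum chi m.+1 * (f m - f m.+1)%:C.
  have cS m : char_sum chi m.+1 = char_sum chi m + chi m.
    by rewrite /char_sum big_nat_recr.
  elim: b ab => [|b IHb] ab.
    move: ab; rewrite leqn0 => /eqP ->.
    by rewrite big_nat1 big_geq // cS; ring.
  move: ab; rewrite leq_eqVlt => /predU1P[->|ab].
    by rewrite big_nat1 big_geq // cS; ring.
  rewrite big_nat_recr //= 1?leqW // IHb // [in RHS]big_nat_recr //=.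
  by rewrite rmorphB /= (cS b.+1); ring.
rewrite abel; apply: le_trans (normcD _ _) _.
have -> : 2 * n%:R * f a = n%:R * f b + n%:R * f a + n%:R * (f a - f b) by ring.
have f_b := f_ge0 b ab; have f_a0 := f_ge0 a (leqnn a).
apply: lerD.
  apply: le_trans (normcB _ _) _; rewrite !normcM !normc_real !ger0_norm //.
  by apply: lerD; rewrite ler_wpM2r.
apply: le_trans (normc_sum _ _ _) _.
rewrite -(opprB (f b)) -telescope_sumr // -sumrN big_distrr /=.
apply: ler_sum_nat => m /andP[am mb]; rewrite normcM normc_real opprB.
have df : 0 <= f m - f m.+1 by rewrite subr_ge0 f_dec.
  rewrite (ger0_norm df).
by apply: ler_wpM2r.
Qed.

Definition partialL (chi : nat -> R[i]) N : R[i] :=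
  \sum_(1 <= m < N.+1) chi m * (m%:R^-1)%:C.

(** L is the value at 1 of the Dirichlet series of chi, specified by the rate of convergence that
    later estimates use. In the factor 4, one 2 comes from summation by parts and the other from
    treating real and imaginary parts separately. *)
Definition is_L1 n (chi : nat -> R[i]) (L : R[i]) : Prop :=
  forall N, normc (partialL chi N - L) <= 4 * n%:R / N.+1%:R.

Lemma exists_L1 n chi : dirichlet_character n chi -> nonprincipal n chi ->
  exists L, is_L1 n chi L.
Proof.
move=> chiP npr.
have [||L hL] := @cauchy_tail_limitc R (partialL chi) (fun N => 2 * n%:R / N.+1%:R).
- by move=> M; rewrite divr_ge0 // mulr_ge0.
- move=> M N MN; rewrite /partialL (@big_cat_nat _ _ _ M.+1) //= addrAC subrr add0r.
  apply: (char_sum_abel _ chiP npr) => m Mm; rewrite ?invr_ge0 //.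
  by rewrite lef_pV2 ?posrE ?ltr0n ?ler_nat // (leq_trans _ Mm).
exists L => N; apply: le_trans (hL N) _.
by have -> : 4 * n%:R / N.+1%:R = 2 * (2 * n%:R / N.+1%:R) :> R by ring.
Qed.

(** ln x / x decreases once ln x >= 1, and ln 4 >= 1 follows from ln(1/2) <= -1/2. *)
Lemma ln_div_nat_decreasing m : (4 <= m)%N ->
  ln m.+1%:R / m.+1%:R <= ln m%:R / m%:R :> R.
Proof.
move=> m_ge4; have m_gt0 : 0 < m%:R :> R by rewrite ltr0n; lia.
have ln4 : 1 <= ln m%:R :> R.
  apply: (@le_trans _ _ (ln 4%:R)); last by apply: ler_ln_nat.
  have half : ln (1 + - 2^-1) <= - 2^-1 :> R by apply: le_ln1Dx; lra.
  have eq1 : 1 + - 2^-1 = 2^-1 :> R by lra.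
  rewrite eq1 lnV ?posrE // in half.
  by rewrite -[4%N]/(2 * 2)%N natrM lnM ?posrE //; lra.
have := @ln_natS_sub R m; rewrite -(ltr0n R) m_gt0 => /(_ isT) le_ln.
rewrite ler_pdivrMr ?ltr0n // mulrAC ler_pdivlMr // -natr1.
have : m%:R * (ln (m%:R + 1) - ln m%:R) <= 1 :> R.
  rewrite -[leRHS](@divff _ m%:R) ?gt_eqF //.
  by apply: ler_wpM2l; rewrite ?(ltW m_gt0) // natr1.
nra.
Qed.

Lemma sum_char_ln_bounded n chi : dirichlet_character n chi -> nonprincipal n chi ->
  exists K, forall N,
    normc (\sum_(1 <= m < N.+1) chi m * (ln m%:R / m%:R)%:C) <= K.
Proof.
move=> chiP npr; set F := fun m => chi m * (ln m%:R / m%:R)%:C.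
exists (\sum_(1 <= m < 4) normc (F m) + 2 * n%:R * (ln 4%:R / 4%:R)) => N.
have tail b : normc (\sum_(4 <= m < b) F m) <= 2 * n%:R * (ln 4%:R / 4%:R).
  apply: (@char_sum_abel n chi (fun m => ln m%:R / m%:R)) => // m m_ge4.
    by rewrite divr_ge0 // ln_ge0 // ler1n; lia.
  exact: ln_div_nat_decreasing.
have tail0 : 0 <= 2 * n%:R * (ln 4%:R / 4%:R) :> R.
  by rewrite !mulr_ge0 // ?ln_ge0 // ler1n.
have [N_ge4|N_lt4] := leqP 4 N.+1.
  rewrite (@big_cat_nat _ _ _ 4) //=; apply: le_trans (normcD _ _) _.
  by apply: lerD (tail _); exact: normc_sum.
apply: le_trans (normc_sum _ _ _) _; rewrite -[leLHS]addr0; apply: lerD => //.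
rewrite [leRHS](@big_cat_nat _ _ _ N.+1) //=; last exact: ltnW.
by rewrite lerDl sumr_ge0 // => m _; exact: normc_ge0.
Qed.

(** Formally the partial sums of - L'/L at 1. *)
Definition char_mertens (chi : nat -> R[i]) N : R[i] :=
  \sum_(1 <= m < N.+1) chi m * (mangoldt m / m%:R)%:C.

Lemma inv_mul_floor_le N d : (0 < d)%N -> (0 < N)%N ->
  d%:R^-1 * (N %/ d).+1%:R^-1 <= N%:R^-1 :> R.
Proof.
move=> d_gt0 N_gt0; rewrite -invfM -natrM lef_pV2 ?posrE ?ltr0n ?muln_gt0 ?d_gt0 //.
by rewrite ler_nat mulnC ltnW // ltn_ceil.
Qed.

(* chi ln is the Dirichlet convolution of chi Lambda and chi, so this sum times [L]
   is, up to a bounded error, the sum of chi(m) ln m / m. *)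
Lemma char_mertens_bounded n chi L :
  dirichlet_character n chi -> nonprincipal n chi -> is_L1 n chi L -> L != 0 ->
  exists K, forall N, normc (char_mertens chi N) <= K.
Proof.
move=> chiP npr hL L0; have [K hK] := sum_char_ln_bounded chiP npr.
have [_ _ chiM nchi] := chiP.
have nL : 0 < normc L.
  by rewrite lt_def normc_ge0 andbT; apply: contraNneq L0 => /eq0_normc/eqP.
exists ((K + 4 * n%:R * 8) / normc L) => N; rewrite ler_pdivlMr // -normcM.
have [->|N_gt0] := posnP N.
  rewrite /char_mertens big_geq // mul0r normc0 addr_ge0 ?mulr_ge0 //.
  by have := hK 0%N; rewrite big_geq // normc0.
have eq_conv : \sum_(1 <= m < N.+1) chi m * (ln m%:R / m%:R)%:C =
    \sum_(1 <= d < N.+1) chi d * (mangoldt d / d%:R)%:C * partialL chi (N %/ d).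
  under [RHS]eq_bigr do rewrite big_distrr /=.
  rewrite -sum_dirichlet_convolution; apply: eq_big_nat => m /andP[m_gt0 _].
  rewrite -sum_mangoldt // big_distrl rmorph_sum big_distrr /=.
  rewrite big_seq [RHS]big_seq; apply: eq_bigr => d; rewrite -dvdn_divisors // => dm.
  rewrite -{1 2}(divnK dm) chiM natrM invfM !rmorphM /=; ring.
have -> : char_mertens chi N * L = \sum_(1 <= m < N.+1) chi m * (ln m%:R / m%:R)%:C -
   \sum_(1 <= d < N.+1) chi d * (mangoldt d / d%:R)%:C * (partialL chi (N %/ d) - L).
  rewrite eq_conv -sumrB big_distrl /=; apply: eq_bigr => d _; ring.
apply: le_trans (normcB _ _) _; apply: lerD => //.
apply: le_trans (normc_sum _ _ _) _.
apply: (@le_trans _ _ (\sum_(1 <= d < N.+1) mangoldt d * (4 * n%:R / N%:R))).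
  apply: ler_sum_nat => d /andP[d_gt0 _].
  have md : 0 <= mangoldt d by exact: mangoldt_ge0.
  rewrite !normcM nchi normc_real ger0_norm ?divr_ge0 //.
  apply: (@le_trans _ _ (mangoldt d / d%:R * (4 * n%:R / (N %/ d).+1%:R))).
    rewrite -[leRHS]mul1r -mulrA ler_pM ?mulr_ge0 ?invr_ge0 ?normc_ge0 //.
      by case: (coprime _ _).
    by rewrite ler_wpM2l // divr_ge0.
  rewrite -!mulrA ler_wpM2l // mulrCA ler_wpM2l // mulrCA ler_wpM2l //.
  exact: inv_mul_floor_le.
rewrite -big_distrl /= mulrCA; apply: ler_wpM2l; first by rewrite mulr_ge0.
by rewrite ler_pdivrMr ?ltr0n //; exact: chebyshev_psi_le.
Qed.

(* By Moebius inversion, summing chi(d) mu(d) ln(N/d) / d against the partial sums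
   of L(1, chi) gives ln N plus the sum of chi(m) Lambda(m) / m. *)
Lemma char_mertens_L0 n chi :
  dirichlet_character n chi -> is_L1 n chi 0 ->
  forall N, (0 < N)%N -> normc (char_mertens chi N + (ln N%:R)%:C) <= 4 * n%:R.
Proof.
move=> chiP hL N N_gt0; have [_ _ chiM nchi] := chiP.
have N_gt0R : 0 < N%:R :> R by rewrite ltr0n.
have -> : char_mertens chi N + (ln N%:R)%:C = \sum_(1 <= d < N.+1)
    chi d * (moebius R d * (ln N%:R - ln d%:R) / d%:R)%:C * partialL chi (N %/ d).
  under [RHS]eq_bigr do rewrite big_distrr /=.
  rewrite -sum_dirichlet_convolution.
  transitivity (\sum_(1 <= m < N.+1) chi m *
      (((m == 1%N)%:R * ln N%:R + mangoldt m) / m%:R)%:C).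
    rewrite addrC [RHS]big_nat_recl //= /char_mertens big_nat_recl //=.
    rewrite mangoldt1 !mul0r mulr0 add0r mul1r addr0 divr1 (dchi1 chiP) mul1r.
    congr (_ + _); apply: eq_big_nat => m /andP[m_gt0 _].
    have /negPf-> : m.+1 != 1%N by rewrite eqSS -lt0n.
    by rewrite mul0r add0r.
  apply: eq_big_nat => m /andP[m_gt0 _].
  rewrite -[mangoldt m]opprK -sum_moebius_ln // -sum_moebius // big_distrl /= -sumrB.
  rewrite big_distrl rmorph_sum big_distrr /= big_seq [RHS]big_seq.
  apply: eq_bigr => d; rewrite -dvdn_divisors // => dm.
  rewrite -{1 2}(divnK dm) chiM natrM invfM -mulrBr !rmorphM /=; ring.
apply: le_trans (normc_sum _ _ _) _.
apply: (@le_trans _ _ (\sum_(1 <= d < N.+1) (4 * n%:R / N%:R) * (ln N%:R - ln d%:R))).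
  apply: ler_sum_nat => d /andP[d_gt0 dN].
  have lnd : 0 <= ln N%:R - ln d%:R :> R by rewrite subr_ge0 ler_ln_nat.
  rewrite !normcM nchi normc_real !normrM normfV (ger0_norm lnd) (@ger0_norm _ d%:R) //.
  apply: (@le_trans _ _ (((ln N%:R - ln d%:R) / d%:R) * (4 * n%:R / (N %/ d).+1%:R))).
    apply: ler_pM; rewrite ?mulr_ge0 ?invr_ge0 ?normc_ge0 //.
      rewrite -[leRHS]mul1r -!mulrA ler_pM ?mulr_ge0 ?invr_ge0 //.
        by case: (coprime _ _).
      by rewrite -[leRHS]mul1r ler_wpM2r ?mulr_ge0 ?invr_ge0 // normr_moebius.
    by have := hL (N %/ d)%N; rewrite subr0.
  rewrite [leRHS]mulrC -!mulrA ler_wpM2l // mulrCA ler_wpM2l // mulrCA ler_wpM2l //.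
  exact: inv_mul_floor_le.
rewrite -big_distrr /= sumrB sumr_const_nat subSS subn0 -mulr_natl.
rewrite mulrAC ler_pdivrMr // ler_wpM2l ?mulr_ge0 //.
have := sum_ln_ge R N; rewrite /sum_ln; lra.
Qed.

End DirichletCharacter.

Section NonVanishing.
Variable R : realType.
Local Notation mangoldt := (mangoldt R).

Lemma ln_nat_unbounded (K : R) : exists2 N, (0 < N)%N & K < ln N%:R.
Proof.
pose N := (Num.truncn (expR K)).+1; exists N => //.
rewrite -ltr_expR lnK ?posrE ?ltr0n //.
by have /andP[] := truncn_itv (ltW (expR_gt0 K)).
Qed.

Lemma coprime_mertens_le n N : (0 < N)%N ->
  \sum_(1 <= m < N.+1) (coprime n m)%:R * (mangoldt m / m%:R) <= ln N%:R + 8.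
Proof.
move=> N_gt0; apply: (@le_trans _ _ (mertens_sum R N)); last first.
  by have /andP[] := mertens_sum_bounds R N_gt0.
apply: ler_sum => m _; rewrite ler_piMl ?divr_ge0 ?mangoldt_ge0 //.
by case: (coprime _ _).
Qed.

Lemma dchi_sqr_real n (chi : nat -> R[i]) : dirichlet_character n chi ->
  (forall c, coprime n c -> chi c * chi c = 1) ->
  exists rho : nat -> R, [/\ forall m, chi m = (rho m)%:C,
    rho 1%N = 1, forall a b, rho (a * b)%N = rho a * rho b &
    forall m, [|| rho m == 0, rho m == 1 | rho m == -1]].
Proof.
move=> chiP sqr1; have [_ _ chiM nchi] := chiP.
have real m : exists2 r : R, chi m = r%:C & [|| r == 0, r == 1 | r == -1].
  have [/sqr1/eqP|ncop] := boolP (coprime n m).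
    rewrite -expr2 sqrf_eq1 => /orP[] /eqP ->.
      by exists 1; rewrite ?eqxx ?orbT.
    by exists (- 1); rewrite ?eqxx ?orbT // rmorphN1.
  exists 0; rewrite ?eqxx //; apply/eqP; rewrite -[_ == _]negbK; apply/negP => /eqP n0.
  by apply: n0; apply: eq0_normc; rewrite nchi (negPf ncop).
have /choice[rho rhoP] m : exists r : R, chi m = r%:C /\ [|| r == 0, r == 1 | r == -1].
  by have [r] := real m; exists r.
exists rho; split=> [m||a b|m]; try by have [] := rhoP m.
  by apply: complexI; rewrite -(rhoP _).1 (dchi1 chiP).
by apply: complexI; rewrite rmorphM /= -!(rhoP _).1 chiM.
Qed.

(** * Real characters and the hyperbola method *)

Section RealCharacter.
Variable rho : nat -> R.
Hypothesis rho1 : rho 1%N = 1.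
Hypothesis rhoM : forall a b, rho (a * b)%N = rho a * rho b.
Hypothesis rho_vals : forall m, [|| rho m == 0, rho m == 1 | rho m == -1].

(** The coefficients of zeta(s) L(s, rho). *)
Definition rho_conv m : R := \sum_(d <- divisors m) rho d.

Lemma rhoX p j : rho (p ^ j)%N = rho p ^+ j.
Proof. by elim: j => // j IHj; rewrite expnS rhoM IHj exprS. Qed.

Lemma rho_conv_pfactor p a m : prime p -> ~~ (p %| m)%N -> (0 < m)%N ->
  rho_conv (p ^ a * m) = (\sum_(0 <= j < a.+1) rho p ^+ j) * rho_conv m.
Proof.
move=> p_pr p'm m_gt0; rewrite /rho_conv sum_divisors_pfactor // big_distrl /=.
apply: eq_bigr => j _; rewrite big_distrr /=; apply: eq_bigr => d _.
by rewrite rhoM rhoX.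
Qed.

(** The sum is 1, a + 1, or alternately 1 and 0, according to rho(p) = 0, 1 or -1. Even exponents
    thus give at least 1, which is why [rho_conv] is at least 1 at squares. *)
Lemma rho_geometric p a :
  (~~ odd a)%:R <= \sum_(0 <= j < a.+1) rho p ^+ j.
Proof.
have /or3P[] := rho_vals p => /eqP ->.
- rewrite big_nat_recl //= expr0 big1 ?addr0 => [|j _]; first by case: odd.
  by rewrite exprS mul0r.
- under eq_bigr do rewrite expr1n.
  by rewrite sumr_const_nat subn0 ler_nat; case: odd.
rewrite le_eqVlt; apply/orP; left; rewrite eq_sym.
elim: a => [|a IHa]; first by rewrite big_nat1.
rewrite big_nat_recr //= (eqP IHa) -signr_odd /=.
by case: odd; rewrite /= ?expr1 ?expr0 ?subrr ?add0r.
Qed.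

Lemma rho_conv_ge0 m : (0 < m)%N -> 0 <= rho_conv m.
Proof.
elim/pfactor_ind: m / => [|p a m p_pr p'm m_gt0 IHm].
  by rewrite /rho_conv big_seq1 rho1.
by rewrite rho_conv_pfactor // mulr_ge0 // (le_trans _ (rho_geometric p _)).
Qed.

Lemma rho_conv_sqr_ge1 m : (0 < m)%N -> 1 <= rho_conv (m ^ 2).
Proof.
elim/pfactor_ind: m / => [|p a m p_pr p'm m_gt0 IHm].
  by rewrite /rho_conv big_seq1 rho1.
rewrite expnMn -expnM rho_conv_pfactor ?expn_gt0 ?m_gt0 //; last first.
  by rewrite Euclid_dvdX // andbT.
rewrite -[leLHS]mul1r ler_pM //; apply: le_trans (rho_geometric p _).
by rewrite oddM andbF.
Qed.

Lemma harmonic_ge_ln M : ln M.+1%:R <= \sum_(1 <= j < M.+1) j%:R^-1 :> R.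
Proof.
elim: M => [|M IHM]; first by rewrite big_geq // ln1.
rewrite big_nat_recr //=; apply: le_trans (lerD IHM (lexx _)).
by rewrite -lerBlDl; exact: ln_natS_sub.
Qed.

(** The squares j^2 alone contribute at least the harmonic sum of the 1/j, and the other terms are
    nonnegative. *)
Lemma sum_rho_conv_ge M : ln M.+1%:R <=
  \sum_(1 <= m < (M ^ 2).+1) rho_conv m / Num.sqrt m%:R.
Proof.
apply: le_trans (harmonic_ge_ln M) _.
elim: M => [|M IHM]; first by rewrite !big_geq.
rewrite big_nat_recr //= [leRHS](@big_cat_nat _ _ _ (M ^ 2).+1) //=; last first.
  by rewrite ltnS leq_sqr.
apply: lerD => //; rewrite big_nat_recr //=; last by rewrite ltn_sqr.
rewrite -[leLHS]add0r; apply: lerD.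
  rewrite big_nat; apply: sumr_ge0 => m /andP[m_gt0 _].
  by rewrite divr_ge0 ?sqrtr_ge0 // rho_conv_ge0 // (leq_trans _ m_gt0).
rewrite natrX sqrtr_sqr ger0_norm // -[leLHS]mul1r ler_wpM2r ?invr_ge0 //.
exact: rho_conv_sqr_ge1.
Qed.

Definition sum_isqrt y : R := \sum_(1 <= e < y.+1) (Num.sqrt e%:R)^-1.

Lemma sqrt_natS_bounds e : (0 < e)%N ->
  (Num.sqrt (e.+1%:R : R))^-1 <= 2 * (Num.sqrt e.+1%:R - Num.sqrt e%:R) <=
     (Num.sqrt (e%:R : R))^-1.
Proof.
move=> e_gt0; set s := Num.sqrt _; set r := Num.sqrt _.
have r_gt0 : 0 < r by rewrite sqrtr_gt0 ltr0n.
have rs : r <= s by rewrite ler_sqrt ?ler_nat.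
have s_gt0 : 0 < s by apply: lt_le_trans rs.
have rs1 : (s - r) * (s + r) = 1.
  by rewrite -subr_sqr !sqr_sqrtr // -natr1; ring.
apply/andP; split.
  by rewrite -div1r ler_pdivrMr //; nra.
by rewrite -[leRHS]div1r ler_pdivlMr //; nra.
Qed.

Lemma sum_isqrt_le y : sum_isqrt y <= 2 * Num.sqrt y%:R.
Proof.
rewrite /sum_isqrt; elim: y => [|[_|y IHy]]; first by rewrite big_geq // sqrtr0 mulr0.
  by rewrite big_nat1 sqrtr1 invr1; lra.
rewrite big_nat_recr //=; have /andP[+ _] := @sqrt_natS_bounds y.+1 isT.
by move: IHy; lra.
Qed.

(** By [sqrt_natS_bounds], the sum minus 2 sqrt y decreases in y, and becomes increasing once 1 /
    sqrt y is subtracted. The value at Y stands in for the limit zeta(1/2). *)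
Lemma sum_isqrt_approx y Y : (0 < y)%N -> (y <= Y)%N ->
  `|(sum_isqrt y - 2 * Num.sqrt y%:R) - (sum_isqrt Y - 2 * Num.sqrt Y%:R)| <=
  (Num.sqrt y%:R)^-1.
Proof.
move=> y_gt0 yY; rewrite ger0_norm.
  elim: Y yY => [|Y IHY]; first by rewrite leqn0 => /eqP y0; rewrite y0 in y_gt0.
  rewrite leq_eqVlt => /predU1P[<-|yY].
    by rewrite subrr invr_ge0 sqrtr_ge0.
  suff: (sum_isqrt y - 2 * Num.sqrt y%:R) - (sum_isqrt Y.+1 - 2 * Num.sqrt Y.+1%:R) <=
     (Num.sqrt y%:R)^-1 - (Num.sqrt Y.+1%:R)^-1.
    have : 0 <= (Num.sqrt Y.+1%:R)^-1 :> R by rewrite invr_ge0 sqrtr_ge0.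
    lra.
  elim: Y yY {IHY} => [|Y IHY]; first by rewrite ltnS leqn0 => /eqP y0; rewrite y0 in y_gt0.
  have sS Z : sum_isqrt Z.+1 = sum_isqrt Z + (Num.sqrt Z.+1%:R)^-1.
    by rewrite /sum_isqrt big_nat_recr.
  rewrite ltnS leq_eqVlt => /predU1P[->|yY].
    by rewrite (sS Y.+1); have /andP[_] := @sqrt_natS_bounds Y.+1 isT; lra.
  have := IHY yY; rewrite (sS Y.+1); have /andP[_] := @sqrt_natS_bounds Y.+1 isT; lra.
elim: Y yY => [|Y IHY]; first by rewrite leqn0 => /eqP ->; rewrite subrr.
rewrite leq_eqVlt => /predU1P[<-|yY]; first by rewrite subrr.
have := IHY yY; have /andP[+ _] := @sqrt_natS_bounds Y (leq_trans y_gt0 yY).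
have -> : sum_isqrt Y.+1 = sum_isqrt Y + (Num.sqrt Y.+1%:R)^-1.
  by rewrite /sum_isqrt big_nat_recr.
lra.
Qed.

(** The pairs (d, e) with d e <= M^2 are split at d = M. When d > M, necessarily e <= M, and d is
    put in the inner sum so that the cancellation of rho over a long range can be used. *)
Lemma hyperbola_sum M : (0 < M)%N ->
  \sum_(1 <= m < (M ^ 2).+1) rho_conv m / Num.sqrt m%:R =
  \sum_(1 <= d < M.+1) rho d / Num.sqrt d%:R * sum_isqrt (M ^ 2 %/ d) +
  \sum_(1 <= e < M.+1) (Num.sqrt e%:R)^-1 *
     \sum_(M.+1 <= d < (M ^ 2 %/ e).+1) rho d / Num.sqrt d%:R.
Proof.
move=> M_gt0.
transitivity (\sum_(1 <= m < (M ^ 2).+1) \sum_(d <- divisors m)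
    (fun d e => rho d / Num.sqrt d%:R * (Num.sqrt e%:R)^-1) d (m %/ d)%N).
  apply: eq_big_nat => m /andP[m_gt0 _]; rewrite /rho_conv big_distrl /=.
  rewrite big_seq [RHS]big_seq; apply: eq_bigr => d; rewrite -dvdn_divisors // => dm.
  by rewrite -{1}(divnK dm) natrM sqrtrM // invfM mulrA mulrAC.
rewrite (sum_dirichlet_convolution (fun d e => rho d / Num.sqrt d%:R * (Num.sqrt e%:R)^-1)).
have MM : (M <= M ^ 2)%N by rewrite -mulnn leq_pmulr.
rewrite (@big_cat_nat _ _ _ M.+1) //=; congr (_ + _).
  by apply: eq_bigr => d _; rewrite big_distrr.
transitivity (\sum_(M.+1 <= d < (M ^ 2).+1) \sum_(1 <= e < M.+1 | (d * e <= M ^ 2)%N)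
    (rho d / Num.sqrt d%:R * (Num.sqrt e%:R)^-1)).
  apply: eq_big_nat => d /andP[Md dM]; have d_gt0 : (0 < d)%N by apply: leq_trans Md.
  have le_div e : (e < (M ^ 2 %/ d).+1)%N = (d * e <= M ^ 2)%N.
    by rewrite ltnS leq_divRL // mulnC.
  have divM : ((M ^ 2 %/ d).+1 <= M.+1)%N.
    rewrite ltnS -ltnS ltn_divLR // -mulnn mulSn; nia.
  rewrite [RHS](@big_cat_nat _ _ _ (M ^ 2 %/ d).+1) //= [X in _ + X]big_nat_cond.
  rewrite [X in _ + X]big1 ?addr0 => [|e /andP[/andP[+ _]]]; last first.
    by rewrite leqNgt le_div => /negPf->.
  rewrite big_nat_cond [RHS]big_nat_cond; apply: eq_bigl => e.
  by rewrite andbT -andbA -le_div andbb.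
rewrite (exchange_big_dep_nat predT) //=; apply: eq_big_nat => e /andP[e_gt0 eM].
rewrite big_distrr /=.
have le_div d : (d < (M ^ 2 %/ e).+1)%N = (d * e <= M ^ 2)%N by rewrite ltnS leq_divRL.
have M_div : (M.+1 <= (M ^ 2 %/ e).+1)%N.
  by rewrite ltnS leq_divRL // -mulnn leq_mul2l -ltnS eM orbT.
have div_MM : ((M ^ 2 %/ e).+1 <= (M ^ 2).+1)%N by rewrite ltnS leq_div.
rewrite (@big_cat_nat _ _ _ (M ^ 2 %/ e).+1) //= [X in _ + X]big_nat_cond.
rewrite [X in _ + X]big1 ?addr0 => [|d /andP[/andP[+ _]]]; last first.
  by rewrite leqNgt le_div => /negPf->.
rewrite big_nat_cond [RHS]big_nat_cond; apply: eq_big => d.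
  by rewrite andbT -andbA -le_div andbb.
by rewrite mulrC.
Qed.

(** With z = M / sqrt d and s the square root of floor(z^2), there are two errors of at most 1/s <=
    2/z each: one from [sum_isqrt_approx], the other from replacing 2 s by 2 z. *)
Lemma sum_isqrt_floor M d : (0 < d)%N -> (d <= M)%N ->
  `|sum_isqrt (M ^ 2 %/ d) - 2 * (M%:R / Num.sqrt d%:R) -
    (sum_isqrt (M ^ 2) - 2 * M%:R)| <= 4 * Num.sqrt d%:R / M%:R.
Proof.
move=> d_gt0 dM; have M_gt0 : (0 < M)%N by apply: leq_trans dM.
have M_gt0R : 0 < M%:R :> R by rewrite ltr0n.
set y := (M ^ 2 %/ d)%N; set z := M%:R / Num.sqrt d%:R.
have dR : 0 < d%:R :> R by rewrite ltr0n.
have y_gt0 : (0 < y)%N by rewrite divn_gt0 // (leq_trans dM) // -mulnn leq_pmulr.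
have z2 : z ^+ 2 = (M ^ 2)%:R / d%:R.
  by rewrite expr_div_n sqr_sqrtr ?ler0n // natrX.
have z_gt0 : 0 < z by rewrite divr_gt0 ?sqrtr_gt0.
have yz : y%:R <= z ^+ 2.
  by rewrite z2 ler_pdivlMr // -natrM ler_nat leq_trunc_div.
have zy : z ^+ 2 <= y.+1%:R.
  by rewrite z2 ler_pdivrMr // -natrM ler_nat ltnW // ltn_ceil.
have := @sum_isqrt_approx y (M ^ 2) y_gt0 (leq_div _ _).
rewrite [in X in X -> _]natrX sqrtr_sqr (ger0_norm (ltW M_gt0R)).
set s := Num.sqrt y%:R; set S1 := sum_isqrt _; set S2 := sum_isqrt _ => approx.
have s_gt0 : 0 < s by rewrite sqrtr_gt0 ltr0n.
have s2 : s ^+ 2 = y%:R by rewrite sqr_sqrtr ?ler0n.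
have sz : s <= z by rewrite -(ler_pXn2r (n := 2)) ?nnegrE ?(ltW s_gt0) ?(ltW z_gt0) // s2.
have zs : z <= 2 * s.
  rewrite -(ler_pXn2r (n := 2)) ?nnegrE ?mulr_ge0 ?(ltW s_gt0) ?(ltW z_gt0) // [leRHS]exprMn s2.
  apply: le_trans zy _; rewrite -natr1.
  have : 1 <= y%:R :> R by rewrite ler1n.
  rewrite expr2; lra.
have zs1 : z - s <= (2 * s)^-1.
  rewrite -div1r ler_pdivlMr ?mulr_gt0 //.
  move: zy; rewrite -natr1 -s2; nra.
have inv_zs : s^-1 <= 2 * z^-1.
  by rewrite -div1r ler_pdivrMr // mulrAC ler_pdivlMr // mul1r.
have -> : 4 * Num.sqrt d%:R / M%:R = 2 * (2 * z^-1).
  by rewrite /z invf_div; ring.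
have -> : S1 - 2 * z - (S2 - 2 * M%:R) =
   (S1 - 2 * s - (S2 - 2 * M%:R)) - 2 * (z - s) by ring.
apply: le_trans (ler_normB _ _) _; rewrite (ger0_norm (_ : 0 <= 2 * (z - s))); last first.
  by rewrite mulr_ge0 // subr_ge0.
rewrite invfM in zs1; lra.
Qed.

Lemma normr_rho m : `|rho m| <= 1.
Proof. by have /or3P[] := rho_vals m => /eqP ->; rewrite ?normrN ?normr0 ?normr1. Qed.

(** The only term that could grow with M is 2 M times the sum of rho(d)/d; the last hypothesis,
    which encodes L(1, rho) = 0, keeps it below 8 n. The term with factor A contributes 4 n, the
    rounding errors 4, and the part with d > M another 4 n. *)
Lemma hyperbola_bound (n : R) M : (0 < M)%N ->
  (forall a b, `|\sum_(a <= d < b) rho d / Num.sqrt d%:R| <= 2 * n / Num.sqrt a%:R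
     \/ a = 0%N) ->
  `|\sum_(1 <= d < M.+1) rho d / d%:R| <= 4 * n / M.+1%:R ->
  \sum_(1 <= m < (M ^ 2).+1) rho_conv m / Num.sqrt m%:R <= 16 * n + 4.
Proof.
move=> M_gt0 sqr_bnd L_bnd; rewrite hyperbola_sum //.
have M_gt0R : 0 < M%:R :> R by rewrite ltr0n.
have n_ge0 : 0 <= n.
  have := le_trans (normr_ge0 _) L_bnd; rewrite ler_pdivlMr ?ltr0n // mul0r; lra.
have sqr_bnd1 a b : (0 < a)%N -> `|\sum_(a <= d < b) rho d / Num.sqrt d%:R| <= 2 * n / Num.sqrt a%:R.
  by move=> a_gt0; have [//|a0] := sqr_bnd a b; rewrite a0 in a_gt0.
have part2 : \sum_(1 <= e < M.+1) (Num.sqrt e%:R)^-1 *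
     \sum_(M.+1 <= d < (M ^ 2 %/ e).+1) rho d / Num.sqrt d%:R <= 4 * n.
  apply: (@le_trans _ _ (\sum_(1 <= e < M.+1) (Num.sqrt e%:R)^-1 * (2 * n / Num.sqrt M%:R))).
    apply: ler_sum => e _; rewrite ler_wpM2l ?invr_ge0 ?sqrtr_ge0 //.
    apply: le_trans (ler_norm _) _; apply: le_trans (sqr_bnd1 _ _ (ltn0Sn M)) _.
    rewrite ler_wpM2l ?mulr_ge0 // lef_pV2 ?posrE ?sqrtr_gt0 ?ltr0n //.
    by rewrite ler_sqrt ?ler_nat.
  rewrite -big_distrl /= mulrA ler_pdivrMr ?sqrtr_gt0 //.
  have := sum_isqrt_le M; rewrite /sum_isqrt => le_sqrt.
  have := ler_wpM2r (_ : 0 <= 2 * n) le_sqrt; rewrite mulr_ge0 // => /(_ isT); lra.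
set A := sum_isqrt (M ^ 2) - 2 * M%:R.
have A_bnd : `|A| <= 2.
  have M2 : (0 < M ^ 2)%N by rewrite expn_gt0 M_gt0.
  have := sum_isqrt_approx (isT : (0 < 1)%N) M2.
  rewrite /sum_isqrt big_nat1 sqrtr1 invr1 -/(sum_isqrt _) natrX sqrtr_sqr.
  by rewrite (ger0_norm (ltW M_gt0R)) -/A !ler_norml => /andP[]; lra.
have -> : \sum_(1 <= d < M.+1) rho d / Num.sqrt d%:R * sum_isqrt (M ^ 2 %/ d) =
    2 * M%:R * (\sum_(1 <= d < M.+1) rho d / d%:R) +
    A * (\sum_(1 <= d < M.+1) rho d / Num.sqrt d%:R) +
    \sum_(1 <= d < M.+1) rho d / Num.sqrt d%:R *
      (sum_isqrt (M ^ 2 %/ d) - 2 * (M%:R / Num.sqrt d%:R) - A).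
  rewrite !big_distrr /= -!big_split /=; apply: eq_big_nat => d /andP[d_gt0 _].
  have d2 : d%:R = Num.sqrt d%:R * Num.sqrt d%:R :> R.
    by rewrite -expr2 sqr_sqrtr ?ler0n.
  by rewrite {2}d2 invfM; ring.
have p1 : 2 * M%:R * (\sum_(1 <= d < M.+1) rho d / d%:R) <= 8 * n.
  apply: (@le_trans _ _ (2 * M%:R * (4 * n / M.+1%:R))).
    by rewrite ler_wpM2l ?mulr_ge0 // (le_trans (ler_norm _)).
  rewrite mulrA ler_pdivrMr ?ltr0n // -natr1; nra.
have p2 : A * (\sum_(1 <= d < M.+1) rho d / Num.sqrt d%:R) <= 4 * n.
  apply: le_trans (ler_norm _) _; rewrite normrM.
  have := sqr_bnd1 1%N M.+1 isT; rewrite sqrtr1 divr1 => b1.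
  have -> : 4 * n = 2 * (2 * n) by ring.
  exact: ler_pM.
have p3 : \sum_(1 <= d < M.+1) rho d / Num.sqrt d%:R *
      (sum_isqrt (M ^ 2 %/ d) - 2 * (M%:R / Num.sqrt d%:R) - A) <= 4.
  apply: (@le_trans _ _ (\sum_(1 <= d < M.+1) 4 / M%:R)); last first.
    by rewrite sumr_const_nat subSS subn0 -[_ *+ M]mulr_natr divfK ?gt_eqF.
  apply: ler_sum_nat => d /andP[d_gt0 dM]; apply: le_trans (ler_norm _) _.
  have sd : 0 < Num.sqrt d%:R :> R by rewrite sqrtr_gt0 ltr0n.
  rewrite normrM normrM normfV (gtr0_norm sd).
  apply: (@le_trans _ _ (1 / Num.sqrt d%:R * (4 * Num.sqrt d%:R / M%:R))).
    by rewrite ler_pM ?mulr_ge0 ?invr_ge0 ?ler_wpM2r ?invr_ge0 ?(ltW sd) ?normr_rho ?sum_isqrt_floor.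
  by rewrite le_eqVlt; apply/orP; left; apply/eqP; field; rewrite !gt_eqF.
lra.
Qed.

End RealCharacter.

(* With rho_conv = rho * 1 nonnegative and at least 1 at squares, the sums of
   rho_conv(m) / sqrt m are unbounded; if L(1, rho) vanished, the hyperbola method
   would bound them. *)
Lemma L1_real_neq0 n (chi : nat -> R[i]) L : dirichlet_character n chi ->
  nonprincipal n chi -> (forall c, coprime n c -> chi c * chi c = 1) ->
  is_L1 n chi L -> L != 0.
Proof.
move=> chiP npr sqr1 hL; apply/eqP => L0; rewrite L0 in hL.
have [rho [chi_rho rho1 rhoM rho_vals]] := dchi_sqr_real chiP sqr1.
have [N N_gt0] := ln_nat_unbounded (16 * n%:R + 4); apply/negP; rewrite -leNgt.
apply: le_trans (_ : ln N.+1%:R <= _); first exact: ler_ln_nat.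
apply: le_trans (sum_rho_conv_ge rho1 rhoM rho_vals N) _.
have to_real (f : nat -> R) a b :
    normc (\sum_(a <= m < b) chi m * (f m)%:C) = `|\sum_(a <= m < b) rho m * f m|.
  rewrite -normc_real rmorph_sum /=; congr normc; apply: eq_bigr => m _.
  by rewrite chi_rho rmorphM.
apply: hyperbola_bound => // [a b|].
  have [->|a_gt0] := posnP a; [by right|left].
  rewrite -to_real; apply: (char_sum_abel _ chiP npr) => m am.
    by rewrite invr_ge0 sqrtr_ge0.
  have m_gt0 := leq_trans a_gt0 am.
  by rewrite lef_pV2 ?posrE ?sqrtr_gt0 ?ltr0n // ler_sqrt ?ler_nat.
by rewrite -to_real; have := hL N; rewrite subr0.
Qed.

(* 3 + 4 Re z + Re z^2 = 2 (Re z + 1)^2 >= 0 on the unit circle, while a zero of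
   L(1, chi) would make the corresponding sums tend to minus infinity. *)
Lemma L1_complex_neq0 n (chi : nat -> R[i]) L : dirichlet_character n chi ->
  nonprincipal n (fun m => chi m * chi m) -> is_L1 n chi L -> L != 0.
Proof.
move=> chiP npr2 hL; apply/eqP => L0; rewrite L0 in hL.
have chi2P := dirichlet_characterM chiP chiP.
have [L' hL'] := exists_L1 chi2P npr2.
have [K hK] : exists K, forall N, (0 < N)%N ->
    Re (char_mertens (fun m => chi m * chi m) N) <= K.
  have [L'0|L'0] := eqVneq L' 0.
    rewrite L'0 in hL'; exists (4 * n%:R) => N N_gt0.
    have := char_mertens_L0 chi2P hL' N_gt0; set z := char_mertens _ _ => bz.
    have lnN : 0 <= ln N%:R :> R by rewrite ln_ge0 // ler1n.
    have := le_trans (ler_norm _) (le_trans (normr_Re_le _) bz).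
    by case: (z) => a b /=; lra.
  have [K hK] := char_mertens_bounded chi2P npr2 hL' L'0; exists K => N _.
  exact: le_trans (ler_norm _) (le_trans (normr_Re_le _) (hK N)).
have [N N_gt0] := ln_nat_unbounded (24 + 16 * n%:R + K).
apply/negP; rewrite -leNgt.
have S1 : Re (char_mertens chi N) <= - ln N%:R + 4 * n%:R.
  have := char_mertens_L0 chiP hL N_gt0; set z := char_mertens _ _ => bz.
  have := le_trans (ler_norm _) (le_trans (normr_Re_le _) bz).
  by case: (z) => a b /=; lra.
have S2 := hK N N_gt0; have S0 := @coprime_mertens_le n N N_gt0.
suff : 0 <= 3 * (\sum_(1 <= m < N.+1) (coprime n m)%:R * (mangoldt m / m%:R)) +
   4 * Re (char_mertens chi N) + Re (char_mertens (fun m => chi m * chi m) N) by lra.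
rewrite /char_mertens !Re_sum !big_distrr /= -!big_split /=; apply: sumr_ge0 => m _.
rewrite !ReMreal !mulrA -!mulrDl mulr_ge0 // ?invr_ge0 // mulr_ge0 ?mangoldt_ge0 //.
have [_ _ _ nchi] := chiP; have := nchi m; case: (chi m) => a b /= nab.
have : (coprime n m)%:R = a ^+ 2 + b ^+ 2.
  have <- : Num.sqrt (a ^+ 2 + b ^+ 2) ^+ 2 = a ^+ 2 + b ^+ 2.
    by rewrite sqr_sqrtr // addr_ge0 ?sqr_ge0.
  by rewrite nab; case: (coprime _ _); rewrite ?expr1n ?expr0n.
case: (coprime n m) => /= ab; last first.
  have [a0 b0] : a = 0 /\ b = 0.
    by move/esym/eqP: ab; rewrite paddr_eq0 ?sqr_ge0 // !sqrf_eq0 => /andP[/eqP -> /eqP ->].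
  by rewrite a0 b0; lra.
have := sqr_ge0 (a + 1); rewrite !expr2 in ab *; nra.
Qed.

(** If chi^2 is principal, then chi is real; otherwise the argument for complex characters
    applies. *)
Lemma char_mertens_nonprincipal n (chi : nat -> R[i]) :
  dirichlet_character n chi -> nonprincipal n chi ->
  exists K, forall N, normc (char_mertens chi N) <= K.
Proof.
move=> chiP npr; have [L hL] := exists_L1 chiP npr.
apply: (char_mertens_bounded chiP npr hL).
have [npr2|pr2] := pselect (nonprincipal n (fun m => chi m * chi m)).
  exact: L1_complex_neq0 chiP npr2 hL.
apply: (L1_real_neq0 chiP npr _ hL) => c nc; apply/eqP.
by apply: contra_notT pr2 => c2; exists c.
Qed.

End NonVanishing.

End CharacterSums.

(** * Primes in residue classes *)

Section PrimesInResidueClasses.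
Local Open Scope complex_scope.
Import ComplexField.Normc.
Local Notation Re := complex.Re.
Local Notation Im := complex.Im.

Section PrimesInClasses.
Variable R : realType.
Local Notation mangoldt := (mangoldt R).

Lemma complex_prim_root n : (0 < n)%N -> exists w : R[i], n.-primitive_root w.
Proof.
move=> n_gt0; have [s def_s] := closed_field_poly_normal ('X^n - 1 : {poly R[i]}).
rewrite (monicP _) ?monicXnsubC // scale1r in def_s.
have s_unity : all n.-unity_root s by apply/allP => z; rewrite -root_prod_XsubC -def_s.
have size_s : (n <= size s)%N.
  by rewrite -ltnS -(size_prod_XsubC s id) -def_s size_XnsubC.
have uniq_s : uniq s.
  by rewrite -separable_prod_XsubC -def_s separable_Xn_sub_1 // pnatr_eq0 -lt0n.
by have /hasP[w _ w_prim] := has_prim_root n_gt0 s_unity uniq_s size_s; exists w.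
Qed.

Lemma fermat_Fp p (x : 'F_p) : prime p -> x != 0 -> x ^+ p.-1 = 1.
Proof.
move=> p_pr x0; have := expf_card x; rewrite card_Fp //.
have -> : x ^+ p = x * x ^+ p.-1 by rewrite -exprS prednK ?prime_gt0.
by move=> xp; apply: (mulfI x0); rewrite xp mulr1.
Qed.

Lemma prime_field_prim_root p : prime p -> exists g : 'F_p, p.-1.-primitive_root g.
Proof.
move=> p_pr; have p1_gt0 : (0 < p.-1)%N by rewrite -subn1 subn_gt0 prime_gt1.
pose s := [seq x <- enum 'F_p | x != 0].
have s_unity : all p.-1.-unity_root s.
  apply/allP => x; rewrite mem_filter => /andP[x0 _]; apply/unity_rootP.
  exact: fermat_Fp.
have size_s : (p.-1 <= size s)%N.
  have := cardC1 (0 : 'F_p); rewrite card_Fp // => <-; rewrite cardE.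
  apply: uniq_leq_size (enum_uniq _) _ => x; rewrite mem_enum inE => x0.
  by rewrite mem_filter x0 mem_enum.
have uniq_s : uniq s by rewrite filter_uniq // enum_uniq.
by have /hasP[g _ g_prim] := has_prim_root p1_gt0 s_unity uniq_s size_s; exists g.
Qed.

Lemma natr_Fp_eq p a b : prime p -> ((a%:R == b%:R :> 'F_p) = (a == b %[mod p]))%N.
Proof.
move=> p_pr; apply/eqP/eqP => [|ab].
  by move/(congr1 val); rewrite /= !val_Fp_nat.
by apply: val_inj; rewrite /= !val_Fp_nat.
Qed.

Lemma natr_Fp_eq0 p a : prime p -> (a%:R == 0 :> 'F_p) = (p %| a)%N.
Proof. by move=> p_pr; rewrite (natr_Fp_eq a 0 p_pr) mod0n. Qed.

(** Sending a generator g of the units of F_p to a primitive (p-1)-st root of unity w gives a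
    faithful character, equal to 1 only on the class of 1. One such character for each prime stands
    in for the whole character group. *)
Lemma exists_prime_character p : prime p ->
  exists psi : nat -> R[i],
    [/\ dirichlet_character p psi,
        forall m, psi m = 1 -> m = 1 %[mod p],
        forall m, coprime p m -> psi m ^+ p.-1 = 1 &
        exists2 c, coprime p c & p.-1.-primitive_root (psi c)].
Proof.
move=> p_pr; have p1_gt0 : (0 < p.-1)%N by rewrite -subn1 subn_gt0 prime_gt1.
have [g g_prim] := prime_field_prim_root p_pr; have [w w_prim] := complex_prim_root p1_gt0.
(* Multiples of p are not powers of g; the default 0 is the value of the character there. *)
pose psi (m : nat) := if [pick i : 'I_p.-1 | m%:R == g ^+ i] is Some i then w ^+ i else 0.
have g0 : g != 0.
  apply: contraTneq g_prim => ->; apply/negP => /prim_expr_order.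
  by rewrite expr0n gtn_eqF // => /eqP; rewrite eq_sym oner_eq0.
have psi_g m i : m%:R = g ^+ i -> psi m = w ^+ i.
  move=> m_gi; rewrite /psi; case: pickP => [j|/(_ (Ordinal (ltn_pmod i p1_gt0)))].
    by rewrite m_gi (eq_prim_root_expr g_prim) => /eqP ij; apply/eqP;
      rewrite (eq_prim_root_expr w_prim) ij.
  by rewrite /= m_gi (eq_prim_root_expr g_prim) modn_mod eqxx.
have logg m : coprime p m -> exists i, m%:R = g ^+ i.
  rewrite prime_coprime // -natr_Fp_eq0 // => m0.
  have [|i ->] := prim_rootP g_prim (x := m%:R); last by exists i.
  exact: fermat_Fp.
have psi0 m : ~~ coprime p m -> psi m = 0.
  rewrite prime_coprime // negbK -natr_Fp_eq0 // => /eqP m0; rewrite /psi m0.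
  by case: pickP => // i; rewrite eq_sym expf_eq0 (negPf g0) andbF.
have nw i : normc (w ^+ i) = 1.
  have nX (z : R[i]) j : normc (z ^+ j) = normc z ^+ j.
    by elim: j => [|j IHj]; rewrite ?normc1 // !exprS normcM IHj.
  have : normc w ^+ p.-1 = 1 by rewrite -nX (prim_expr_order w_prim) normc1.
  move/eqP; rewrite pexpr_eq1 ?normc_ge0 // => /eqP nw.
  by rewrite nX nw expr1n.
have p1_g0 : psi 1%N = 1 by rewrite (psi_g 1%N 0%N).
exists psi; split.
- split=> [|m|a b|m]; first exact: prime_gt0.
  + by rewrite /psi natrD pchar_Fp_0 // addr0.
  + have [/logg[i ai]|na] := boolP (coprime p a); last first.
      by rewrite (psi0 a) // mul0r psi0 // coprimeMr (negPf na).
    have [/logg[j bj]|nb] := boolP (coprime p b); last first.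
      by rewrite (psi0 b) // mulr0 psi0 // coprimeMr (negPf nb) andbF.
    by rewrite (psi_g _ _ ai) (psi_g _ _ bj) -exprD; apply: psi_g; rewrite natrM ai bj exprD.
  have [/logg[i mi]|nm] := boolP (coprime p m); first by rewrite (psi_g _ _ mi) nw.
  by rewrite psi0 // normc0.
- move=> m; have [/logg[i mi]|nm] := boolP (coprime p m); last first.
    by rewrite psi0 // => /eqP; rewrite eq_sym oner_eq0.
  rewrite (psi_g _ _ mi) => /eqP; rewrite -(expr0 w) (eq_prim_root_expr w_prim).
  rewrite -(eq_prim_root_expr g_prim) -mi expr0 => /eqP m1; apply/eqP.
  by rewrite -natr_Fp_eq // m1.
- move=> m /logg[i mi]; rewrite (psi_g _ _ mi) exprAC (prim_expr_order w_prim).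
  by rewrite expr1n.
have gval : (val g)%:R = g ^+ 1 by rewrite natr_Zp.
exists (val g); last by rewrite (psi_g _ _ gval).
by rewrite prime_coprime // -natr_Fp_eq0 // gval expr1.
Qed.

Lemma dirichlet_character_dvd n r chi psi : (r %| n)%N ->
  dirichlet_character n chi -> dirichlet_character r psi ->
  dirichlet_character n (fun m => chi m * psi m : R[i]).
Proof.
move=> rn [n_gt0 per chiM nchi] psiP; have [r_gt0 _ psiM npsi] := psiP.
split=> // [m|a b|m]; first by rewrite per -(dchi_mod _ psiP) -modnDmr (eqP rn) addn0 dchi_mod.
  by rewrite chiM psiM mulrACA.
rewrite normcM nchi npsi -natrM mulnb; congr (nat_of_bool _)%:R.
by case: (boolP (coprime n m)) => // /(coprime_dvdl rn).
Qed.

Definition principal n (m : nat) : R[i] := (coprime n m)%:R.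

Lemma principalP n : (0 < n)%N -> dirichlet_character n (principal n).
Proof.
move=> n_gt0; rewrite /principal; split=> // [m|a b|m].
- by rewrite /coprime gcdnDr.
- by rewrite coprimeMr -natrM mulnb.
by case: coprime; rewrite ?normc1 ?normc0.
Qed.

Lemma char_mertens_add (f g : nat -> R[i]) N :
  char_mertens (fun m => f m + g m) N = char_mertens f N + char_mertens g N.
Proof. by rewrite /char_mertens -big_split; apply: eq_bigr => m _; rewrite mulrDl. Qed.

Lemma char_mertens_sub (f g : nat -> R[i]) N :
  char_mertens (fun m => f m - g m) N = char_mertens f N - char_mertens g N.
Proof. by rewrite /char_mertens -sumrB; apply: eq_bigr => m _; rewrite mulrBl. Qed.

Lemma char_mertens_eq (f g : nat -> R[i]) N : f =1 g -> char_mertens f N = char_mertens g N.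
Proof. by move=> fg; apply: eq_bigr => m _; rewrite fg. Qed.

(** Among the terms with m not prime to n, the non-primes contribute at most 8, and the primes
    divide n, hence are at most n. The 9 also contains the 1 of the lower bound in
    [mertens_sum_bounds]. *)
Lemma principal_mertens n : (0 < n)%N -> exists K, forall N, (0 < N)%N ->
  normc (char_mertens (principal n) N - (ln N%:R)%:C) <= K.
Proof.
move=> n_gt0; have S_ge0 : 0 <= mertens_sum R n.
  by apply: sumr_ge0 => m _; rewrite divr_ge0 // mangoldt_ge0.
exists (mertens_sum R n + 9) => N N_gt0.
have term_ge0 m : 0 <= mangoldt m / m%:R by rewrite divr_ge0 // mangoldt_ge0.
set S := \sum_(1 <= m < N.+1) (coprime n m)%:R * (mangoldt m / m%:R).
have -> : char_mertens (principal n) N = S%:C.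
  by rewrite rmorph_sum; apply: eq_bigr => m _; rewrite /principal !rmorphM /= rmorph_nat.
have <- : (S - ln N%:R)%:C = S%:C - (ln N%:R)%:C by rewrite rmorphB.
rewrite normc_real ler_norml; apply/andP; split; last first.
  by have := @coprime_mertens_le R n N N_gt0; rewrite -/S; lra.
have /andP[low _] := mertens_sum_bounds R N_gt0.
suff : mertens_sum R N - S <= mertens_sum R n + 8 by lra.
rewrite /S /mertens_sum -sumrB.
apply: (@le_trans _ _ (\sum_(1 <= m < N.+1)
   ((if ~~ prime m then mangoldt m / m%:R else 0) +
    (if (m <= n)%N then mangoldt m / m%:R else 0)))).
  apply: ler_sum_nat => m /andP[m_gt0 _]; have := term_ge0 m.
  case: (boolP (coprime n m)) => /= nm; rewrite ?mul1r ?mul0r ?subrr ?subr0.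
    by move=> t; rewrite addr_ge0 //; case: ifP.
  case: (boolP (prime m)) => /= m_pr t; last by rewrite lerDl; case: ifP.
  rewrite add0r ifT //; apply: dvdn_leq => //.
  by move: nm; rewrite coprime_sym prime_coprime // negbK.
rewrite big_split /= -!big_mkcond /= [leRHS]addrC; apply: lerD.
  exact: sum_mangoldt_nonprime_le.
rewrite big_mkcond /=; have [Nn|nN] := leqP N n.
  rewrite [leRHS](@big_cat_nat _ _ _ N.+1) //= -[leLHS]addr0; apply: lerD.
    by apply: ler_sum => m _; case: ifP.
  exact: sumr_ge0.
rewrite (@big_cat_nat _ _ _ n.+1) //=; last exact: ltnW.
rewrite [X in _ + X]big_nat [X in _ + X]big1 ?addr0 => [|m /andP[nm _]]; last first.
  by rewrite leqNgt nm.
by apply: ler_sum => m _; case: ifP.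
Qed.

(** * Weights that exclude residue classes *)

Section Weights.
Variable psi : nat -> nat -> R[i].
Hypothesis psiP : forall r, prime r ->
    [/\ dirichlet_character r (psi r),
        forall m, psi r m = 1 -> m = 1 %[mod r],
        forall m, coprime r m -> psi r m ^+ r.-1 = 1 &
        exists2 c, coprime r c & r.-1.-primitive_root (psi r c)].

(** Vanishes as soon as m = 1 modulo some r in rs, and expands into a signed sum of products of
    characters. *)
Definition weight (rs : seq nat) m : R[i] := \prod_(r <- rs) (1 - psi r m).

(** Since psi_r(c) = 1, every product of chi with some of the psi_r still takes the value chi(c) !=
    1 at c. All characters in the expansion are therefore nonprincipal, with the same witness. *)
Lemma weight_nonprincipal n rs chi : {in rs, forall r, prime r && (r %| n)%N} ->
  dirichlet_character n chi ->
  (exists2 c, coprime n c & chi c != 1 /\ {in rs, forall r, c = 1 %[mod r]}) ->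
  exists K, forall N, normc (char_mertens (fun m => chi m * weight rs m) N) <= K.
Proof.
elim: rs chi => [|r rs IHrs] chi rsP chiP [c nc [chi_c c_rs]].
  have [|K hK] := @char_mertens_nonprincipal R n chi chiP; first by exists c.
  exists K => N; rewrite (@char_mertens_eq _ chi) // => m.
  by rewrite /weight big_nil mulr1.
have /andP[r_pr rn] := rsP r (mem_head _ _); have [psi_r _ _ _] := psiP r_pr.
have rsP' : {in rs, forall r, prime r && (r %| n)%N}.
  by move=> s s_rs; apply: rsP; rewrite inE s_rs orbT.
have c_rs' : {in rs, forall r, c = 1 %[mod r]}.
  by move=> s s_rs; apply: c_rs; rewrite inE s_rs orbT.
have [|K hK] := IHrs _ rsP' chiP; first by exists c.
have [|K' hK'] := IHrs _ rsP' (dirichlet_character_dvd rn chiP psi_r).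
  exists c => //; split=> //; rewrite -(dchi_mod c psi_r) c_rs ?mem_head //.
  by rewrite (dchi_mod _ psi_r) (dchi1 psi_r) mulr1.
exists (K + K') => N; rewrite (@char_mertens_eq _
  (fun m => chi m * weight rs m - chi m * psi r m * weight rs m)); last first.
  by move=> m; rewrite /weight big_cons; ring.
by rewrite char_mertens_sub; apply: le_trans (normcB _ _) _; apply: lerD.
Qed.

Lemma chinese_one n r a : coprime r (n %/ r) -> (r %| n)%N -> coprime r a ->
  exists2 c, coprime n c & c = a %[mod r] /\ c = 1 %[mod n %/ r].
Proof.
move=> co rn ra; pose c := chinese r (n %/ r) a 1.
have cr : c = a %[mod r] by exact: chinese_modl.
have cn : c = 1 %[mod n %/ r] by exact: chinese_modr.
exists c => //; rewrite -(divnK rn) coprimeMl -(coprime_modr (n %/ r)) cn coprime_modr coprimen1.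
by rewrite -coprime_modr cr coprime_modr.
Qed.

(** In the expansion of the weight only the term without any psi_r is principal, and it gives ln N.
    As r is odd, psi_r is nontrivial; a residue equal to g modulo r and to 1 modulo n / r shows that
    the products containing psi_r are nonprincipal. *)
Lemma weight_principal n rs : (0 < n)%N -> uniq rs ->
  {in rs, forall r, [&& prime r, odd r, (r %| n)%N & coprime r (n %/ r)]} ->
  exists K, forall N, (0 < N)%N ->
    normc (char_mertens (fun m => principal n m * weight rs m) N - (ln N%:R)%:C) <= K.
Proof.
move=> n_gt0; elim: rs => [|r rs IHrs] /= => [_ _|/andP[r_rs uniq_rs] rsP].
  have [K hK] := principal_mertens n_gt0; exists K => N N_gt0.
  rewrite (@char_mertens_eq _ (principal n)); first exact: hK.
  by move=> m; rewrite /weight big_nil mulr1.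
have /and4P[r_pr r_odd rn r_co] := rsP r (mem_head _ _).
have [psi_r psi_r1 _ [g rg g_prim]] := psiP r_pr.
have rsP1 : {in rs, forall s, [&& prime s, odd s, (s %| n)%N & coprime s (n %/ s)]}.
  by move=> s s_rs; apply: rsP; rewrite inE s_rs orbT.
have [K hK] := IHrs uniq_rs rsP1.
have rsP2 : {in rs, forall s, prime s && (s %| n)%N}.
  by move=> s /rsP1 /and4P[-> _ ->].
have [|K' hK'] := @weight_nonprincipal n rs _ rsP2
    (dirichlet_character_dvd rn (principalP n_gt0) psi_r).
  have [c nc [cr cn]] := chinese_one r_co rn rg.
  exists c => //; split.
    rewrite /principal nc mul1r -(dchi_mod c psi_r) cr (dchi_mod _ psi_r).
    apply/eqP => g1; have := eq_prim_root_expr g_prim 1 0.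
    rewrite expr1 g1 expr0 eqxx mod0n => /esym; rewrite modn_small //.
    by move: r_pr r_odd; case: (r) => [|[|[|]]].
  move=> s s_rs; have /and4P[s_pr _ sn _] := rsP1 s s_rs.
  have sr : (s %| n %/ r)%N.
    rewrite -(@Gauss_dvdr _ r) ?[(r * _)%N]mulnC ?divnK // prime_coprime //.
    by rewrite dvdn_prime2 //; apply: contraNneq r_rs => <-.
  by apply/eqP; rewrite -(modn_dvdm c sr) cn modn_dvdm.
exists (K + K') => N N_gt0; rewrite (@char_mertens_eq _
  (fun m => principal n m * weight rs m - principal n m * psi r m * weight rs m)); last first.
  by move=> m; rewrite /weight big_cons; ring.
rewrite char_mertens_sub addrAC; apply: le_trans (normcB _ _) _; apply: lerD => //.
exact: hK.
Qed.

Lemma weight_bounded rs : all prime rs -> exists C, forall m, normc (weight rs m) <= C.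
Proof.
elim: rs => [|r rs IHrs] /= => [_|/andP[r_pr /IHrs[C hC]]].
  by exists 1 => m; rewrite /weight big_nil normc1.
have [[_ _ _ npsi] _ _ _] := psiP r_pr.
exists (2 * C) => m; rewrite /weight big_cons normcM ler_pM ?normc_ge0 ?hC //.
apply: le_trans (normcB _ _) _; rewrite normc1 npsi.
by case: coprime; rewrite ?addr0 ?ler1n // -natrD.
Qed.

End Weights.

(** W is the product of the geometric sum of psi_q, which detects 1 modulo q, and of the weight,
    which excludes 1 modulo each r. Without the desired p, it vanishes at all primes above B, so its
    Mertens sum is bounded; yet the principal character in its expansion contributes ln N and all
    others a bounded amount. *)
Lemma prime_in_classes q rs B : prime q -> q \notin rs -> uniq rs ->
  {in rs, forall r, prime r && odd r} ->
  exists p, [/\ prime p, (B < p)%N, p = 1 %[mod q] & {in rs, forall r, p <> 1 %[mod r]}].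
Proof.
move=> q_pr q_rs uniq_rs rsP; apply: contrapT => no_p.
have /choice[psi psiP] r : exists psi : nat -> R[i], prime r ->
    [/\ dirichlet_character r psi,
        forall m, psi m = 1 -> m = 1 %[mod r],
        forall m, coprime r m -> psi m ^+ r.-1 = 1 &
        exists2 c, coprime r c & r.-1.-primitive_root (psi c)].
  have [/exists_prime_character[psi H]|_] := boolP (prime r); first by exists psi.
  by exists (fun=> 0).
have rs_pr : all prime rs by apply/allP => r /rsP/andP[].
pose n := (q * \prod_(r <- rs) r)%N.
have n_gt0 : (0 < n)%N.
  rewrite muln_gt0 prime_gt0 //= big_seq; apply: prodn_cond_gt0 => r /rsP/andP[r_pr _].
  exact: prime_gt0.
have co_prod s t : prime s -> s \notin t -> all prime t -> coprime s (\prod_(r <- t) r).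
  move=> s_pr st /allP tP; rewrite big_seq; apply: (big_ind (coprime s)); first exact: coprimen1.
    by move=> x y sx sy; rewrite coprimeMr sx.
  move=> r rt; rewrite prime_coprime // dvdn_prime2 ?(tP r rt) //.
  by apply: contraNneq st => ->.
have rs_n : {in rs, forall r, [&& prime r, odd r, (r %| n)%N & coprime r (n %/ r)]}.
  move=> r r_rs; have /andP[r_pr r_odd] := rsP r r_rs.
  have n_r : n = (q * \prod_(s <- rem r rs) s * r)%N.
    by rewrite /n (perm_big _ (perm_to_rem r_rs)) big_cons /=; lia.
  rewrite r_pr r_odd n_r dvdn_mull // mulnK ?prime_gt0 //= coprimeMr.
  rewrite prime_coprime // dvdn_prime2 //; apply/andP; split.
    by apply: contraNneq q_rs => <-.
  apply: co_prod => //; first by rewrite mem_rem_uniq // inE eqxx.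
  by apply/allP => s /mem_rem /rsP/andP[].
have qn : (q %| n)%N by rewrite dvdn_mulr.
have n_q : (n %/ q = \prod_(r <- rs) r)%N by rewrite mulKn ?prime_gt0.
have q_co : coprime q (n %/ q) by rewrite n_q co_prod.
have [psi_q psi_q1 psi_qX [g qg g_prim]] := psiP q q_pr.
have charX j : dirichlet_character n (fun m => principal n m * psi q m ^+ j).
  elim: j => [|j IHj].
    by have := principalP n_gt0; congr dirichlet_character; apply/funext => m; rewrite mulr1.
  have := dirichlet_character_dvd qn IHj psi_q.
  by congr dirichlet_character; apply/funext => m; rewrite exprSr mulrA.
have rs_n' : {in rs, forall r, prime r && (r %| n)%N} by move=> r /rs_n/and4P[-> _ ->].
have [C hC] := weight_bounded psiP rs_pr.
have C_ge0 : 0 <= C by apply: le_trans (hC 0%N); exact: normc_ge0.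
pose W J m := principal n m * (\sum_(0 <= j < J) psi q m ^+ j) * weight psi rs m.
have WS J m : W J.+1 m = W J m + principal n m * psi q m ^+ J * weight psi rs m.
  by rewrite /W big_nat_recr //=; ring.
have [K hK] : exists K, forall N, (0 < N)%N ->
    normc (char_mertens (W q.-1) N - (ln N%:R)%:C) <= K.
  have : (0 < q.-1)%N by rewrite -subn1 subn_gt0 prime_gt1.
  have : (q.-1 <= q.-1)%N by [].
  elim: {1 3 4}(q.-1) => // -[|J] IH Jq _.
    have [K hK] := weight_principal psiP n_gt0 uniq_rs rs_n; exists K => N N_gt0.
    rewrite (@char_mertens_eq _ (fun m => principal n m * weight psi rs m)) ?hK // => m.
    by rewrite /W big_nat1 expr0 mulr1.
  have [K hK] := IH (ltnW Jq) isT.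
  have [|K' hK'] := weight_nonprincipal psiP rs_n' (charX J.+1).
    have [c nc [cq cn]] := chinese_one q_co qn qg.
    exists c => //; split.
      rewrite /principal nc mul1r -(dchi_mod c psi_q) cq (dchi_mod _ psi_q).
      rewrite -(expr0 (psi q g)) (eq_prim_root_expr g_prim) mod0n modn_small //.
    move=> r r_rs; have rn : (r %| n %/ q)%N.
      by rewrite n_q (perm_big _ (perm_to_rem r_rs)) big_cons /= dvdn_mulr.
    by apply/eqP; rewrite -(modn_dvdm c rn) cn modn_dvdm.
  exists (K + K') => N N_gt0; rewrite (char_mertens_eq _ (WS J.+1)) char_mertens_add.
  rewrite addrAC; apply: le_trans (normcD _ _) _; apply: lerD; last exact: hK'.
  exact: hK.
have nW m : normc (W q.-1 m) <= q%:R * C.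
  rewrite !normcM -mulrA -[leRHS]mul1r ler_pM ?mulr_ge0 ?normc_ge0 //.
    have [_ _ _ ->] := principalP n_gt0.
    by case: coprime.
  rewrite ler_pM ?normc_ge0 //; apply: le_trans (normc_sum _ _ _) _.
  apply: (@le_trans _ _ (\sum_(0 <= j < q.-1) 1)); last first.
    by rewrite sumr_const_nat subn0 ler_nat leq_pred.
  apply: ler_sum => j _; have [_ _ _ npsi] := psi_q.
  elim: j => [|j IHj]; first by rewrite expr0 normc1.
  rewrite exprS normcM -[leRHS]mul1r ler_pM ?normc_ge0 // npsi.
  by case: coprime.
have W0 p : prime p -> (B < p)%N -> W q.-1 p = 0.
  move=> p_pr Bp; apply: contrapT => Wp; apply: no_p; exists p; split=> //.
    apply: psi_q1; apply: contrapT => psi1; apply: Wp.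
    have [np|np] := boolP (coprime n p); last by rewrite /W /principal (negPf np) !mul0r.
    suff sum0 : \sum_(0 <= j < q.-1) psi q p ^+ j = 0 by rewrite /W sum0 mulr0 mul0r.
    have /psi_qX : coprime q p by apply: coprime_dvdl np.
    move/eqP; rewrite -subr_eq0 subrX1 mulf_eq0 subr_eq0.
    by case/orP => [/eqP //|/eqP]; rewrite big_mkord.
  move=> r r_rs p1; apply: Wp; rewrite /W /weight (perm_big _ (perm_to_rem r_rs)) big_cons.
  have /andP[r_pr _] := rsP r r_rs; have [psi_r _ _ _] := psiP r r_pr.
  have psi_p1 : psi r p = 1 by rewrite -(dchi_mod p psi_r) p1 (dchi_mod _ psi_r) (dchi1 psi_r).
  by rewrite /= psi_p1 subrr mul0r mulr0.
have term_ge0 m : 0 <= mangoldt m / m%:R by rewrite divr_ge0 // mangoldt_ge0.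
have [N N_gt0] := ln_nat_unbounded (q%:R * C * (8 + mertens_sum R B) + K).
apply/negP; rewrite -leNgt.
have -> : ln N%:R = normc (char_mertens (W q.-1) N - (char_mertens (W q.-1) N - (ln N%:R)%:C)).
  by rewrite subKr normc_real ger0_norm // ln_ge0 // ler1n.
apply: le_trans (normcB _ _) _; apply: lerD; last exact: hK.
apply: le_trans (normc_sum _ _ _) _.
apply: (@le_trans _ _ (\sum_(1 <= m < N.+1) q%:R * C *
   ((if ~~ prime m then mangoldt m / m%:R else 0) +
    (if (m <= B)%N then mangoldt m / m%:R else 0)))).
  apply: ler_sum => m _; rewrite normcM normc_real ger0_norm //.
  have qC : 0 <= q%:R * C by rewrite mulr_ge0.
  have [m_pr|m_npr] := boolP (prime m); last first.
    apply: ler_pM; rewrite ?normc_ge0 //= lerDl.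
    by case: ifP.
  rewrite /= add0r; have [mB|Bm] := leqP m B; last by rewrite W0 // normc0 mul0r mulr0.
  by apply: ler_pM; rewrite ?normc_ge0.
rewrite -big_distrr /= ler_wpM2l ?mulr_ge0 // big_split /= -!big_mkcond /=; apply: lerD.
  exact: sum_mangoldt_nonprime_le.
rewrite big_mkcond /=; have [NB|BN] := leqP N B.
  rewrite [leRHS](@big_cat_nat _ _ _ N.+1) //= -[leLHS]addr0; apply: lerD.
    by apply: ler_sum => m _; case: ifP.
  exact: sumr_ge0.
rewrite (@big_cat_nat _ _ _ B.+1) //=; last exact: ltnW.
rewrite [X in _ + X]big_nat [X in _ + X]big1 ?addr0 => [|m /andP[nm _]]; last first.
  by rewrite leqNgt nm.
by apply: ler_sum => m _; case: ifP.
Qed.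

End PrimesInClasses.

End PrimesInResidueClasses.

(** * Power residues in finite fields *)

Lemma horner_Cyclotomic_dvd n (a : int) : (0 < n)%N ->
  (('Phi_n).[a] %| a ^+ n - 1)%Z.
Proof.
move=> n_gt0; have := prod_Cyclotomic n_gt0.
rewrite (bigD1_seq n) ?divisors_uniq -?dvdn_divisors //= => /(congr1 (horner^~ a)).
by rewrite hornerM !hornerE => <-; rewrite dvdz_mulr.
Qed.

(* A prime dividing the value of the n-th cyclotomic polynomial at a multiple a of
   n B! divides neither n nor B!, and a has order n modulo this prime. *)
Lemma prime_one_mod n B : (0 < n)%N ->
  exists p, [/\ prime p, (B < p)%N & (n %| p.-1)%N].
Proof.
move=> n_gt0; pose f := 'Phi_n.
have f0 : f != 0 by rewrite monic_neq0 // Cyclotomic_monic.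
have size_f : (1 < size f)%N by rewrite size_Cyclotomic ltnS totient_gt0.
(* The factors f - 1 and f + 1 make |f(a)| > 1 at a non-root a of g, so that f(a) has a prime
   divisor. *)
pose g := f * (f - 1) * (f + 1).
have fc (c : int) : f - c%:P != 0.
  rewrite subr_eq0; apply: contraTneq size_f => ->.
  by rewrite -leqNgt size_polyC; case: eqP.
have g0 : g != 0.
  rewrite !mulf_neq0 //; first by have := fc 1.
  by have := fc (-1); rewrite polyCN opprK.
pose c := (n * B`!)%N; have c_gt0 : (0 < c)%N by rewrite muln_gt0 n_gt0 fact_gt0.
have [a /andP[ca ga]] : exists a : int, ((c%:Z %| a)%Z && ~~ root g a).
  apply: contrapT => no_a.
  pose rs := [seq c%:Z * t%:Z | t <- iota 0 (size g)].
  have rs_root : all (root g) rs.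
    apply/allP => _ /mapP[t _ ->]; apply: contra_notT no_a => rt.
    by exists (c%:Z * t%:Z); rewrite rt dvdz_mulr.
  have rs_uniq : uniq rs.
    have c0 : c%:Z != 0 by rewrite eqz_nat -lt0n.
    by rewrite map_inj_uniq ?iota_uniq // => s t /(mulfI c0)[].
  by have := max_poly_roots g0 rs_root rs_uniq; rewrite size_map size_iota ltnn.
have fa_gt1 : (1 < `|f.[a]|)%N.
  move: ga; rewrite /root /g !hornerE !mulf_eq0 !negb_or -andbA => /and3P[].
  by move: (f.[a]) => z; lia.
pose p := pdiv `|f.[a]|%N; have p_pr : prime p by exact: pdiv_prime.
have p_fa : (p%:Z %| f.[a])%Z by rewrite dvdzE pdiv_dvd.
have p_a : ~~ (p%:Z %| a)%Z.
  apply/negP => pa; have := dvdz_trans p_fa (horner_Cyclotomic_dvd a n_gt0).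
  have pan : (p%:Z %| a ^+ n)%Z by rewrite -(prednK n_gt0) exprS dvdz_mulr.
  move=> /(rpredB pan); rewrite subKr => p1.
  have : (p%:Z %| 1)%Z by [].
  by rewrite dvdzE /= dvdn1; case: (p) p_pr => [|[]].
have p_c : ~~ (p %| c)%N by apply: contraNN p_a => pc; apply: dvdz_trans ca.
have pn : ~~ (p %| n)%N by apply: contraNN p_c => pn; apply: dvdn_mulr.
have Bp : (B < p)%N.
  rewrite ltnNge; apply: contraNN p_c => pB; apply: dvdn_mull.
  by apply: dvdn_fact; rewrite pB prime_gt0.
exists p; split=> //; pose x : 'F_p := a%:~R.
have Fp_dvd (z : int) : (p%:Z %| z)%Z -> z%:~R = 0 :> 'F_p.
  case/dvdzP => y ->; rewrite intrM; have -> : p%:~R = 0 :> 'F_p by exact: pchar_Fp_0.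
  by rewrite mulr0.
have fx : (map_poly intr f).[x] = 0 by rewrite horner_map /= Fp_dvd.
have xn : x ^+ n = 1.
  have /Fp_dvd := dvdz_trans p_fa (horner_Cyclotomic_dvd a n_gt0).
  by rewrite rmorphB rmorphXn /= -/x => /eqP; rewrite subr_eq0 => /eqP.
have x0 : x != 0.
  by apply: contra_eqN xn => /eqP ->; rewrite expr0n gtn_eqF //= eq_sym oner_neq0.
have [d d_prim dn] := prim_order_exists n_gt0 xn.
have [<-|d_neq_n] := eqVneq d n.
  by rewrite (prim_order_dvd d_prim) fermat_Fp.
have d_gt0 := prim_order_gt0 d_prim.
(* If the order d of x were a proper divisor of n, then x would be a root of both f and X^d - 1,
   hence a double root of X^n - 1 modulo p; but the derivative n x^(n-1) does not vanish. *)
have [h def_h] : exists h : {poly int}, 'X^n - 1 = f * ('X^d - 1) * h.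
  exists (\prod_(e <- divisors n | (e != n) && ~~ (e %| d)%N) 'Phi_e).
  rewrite -(prod_Cyclotomic n_gt0) (bigD1_seq n) ?divisors_uniq -?dvdn_divisors //=.
  rewrite -mulrA; congr (_ * _); rewrite (bigID (fun e => (e %| d)%N)) /=; congr (_ * _).
  rewrite -(prod_Cyclotomic d_gt0) -big_filter; apply: perm_big; apply: uniq_perm.
  - by rewrite filter_uniq ?divisors_uniq.
  - exact: divisors_uniq.
  move=> e; rewrite mem_filter -!dvdn_divisors //.
  apply/idP/idP => [/andP[/andP[]]//|ed]; rewrite ed (dvdn_trans ed dn) !andbT.
  by apply: contraNneq d_neq_n => en; rewrite eqn_dvd dn -en.
have := congr1 (fun u => (map_poly intr u : {poly 'F_p})^`().[x]) def_h.
rewrite !rmorphM !rmorphB /= !rmorph1 !map_polyXn !derivM !derivB !derivXn.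
rewrite -!polyC1 !derivC !subr0 !hornerE fx.
rewrite hornerMn !hornerE (prim_expr_order d_prim) subrr !(mulr0, mul0r, addr0).
move/eqP; rewrite -mulr_natr mulf_eq0 expf_eq0 (negPf x0) andbF /= natr_Fp_eq0 //.
by rewrite (negPf pn).
Qed.

Lemma sum_injective_mod (V : nmodType) n (s : nat -> nat) (g : nat -> V) :
  (forall m, g (m %% n)%N = g m) ->
  (forall a b, (a < n)%N -> (b < n)%N -> s a = s b %[mod n] -> a = b) ->
  \sum_(0 <= m < n) g (s m) = \sum_(0 <= m < n) g m.
Proof.
case: n => [|n] g_per s_inj; first by rewrite !big_geq.
rewrite !big_mkord.
have inj : injective (fun m : 'I_n.+1 => inord (s m %% n.+1) : 'I_n.+1).
  move=> a b /(congr1 val); rewrite /= !inordK ?ltn_mod // => sab.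
  exact: val_inj (s_inj _ _ (ltn_ord a) (ltn_ord b) sab).
rewrite [RHS](reindex_inj inj); apply: eq_bigr => i _.
by rewrite inordK ?ltn_mod // g_per.
Qed.

Lemma affine_inj_mod n c i a b : coprime n c -> (a < n)%N -> (b < n)%N ->
  (i + c * a = i + c * b %[mod n])%N -> a = b.
Proof.
move=> nc; wlog ab : a b / (a <= b)%N => [W an bn|an bn].
  by case/orP: (leq_total a b) => [/W|/W H /esym E]; [apply|apply/esym/H].
move=> /eqP; rewrite eqn_modDl eq_sym eqn_mod_dvd ?leq_mul // -mulnBr Gauss_dvdr //.
move=> /dvdn_leq; rewrite subn_gt0 => nba; apply/eqP; rewrite eqn_leq ab leqNgt.
by apply/negP => /nba; lia.
Qed.

(** Independence of residues modulo coprime P and p: in m = i + P j the residue modulo P is that of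
    i, and for fixed i the residue modulo p runs once through all classes as j varies. *)
Lemma sum_coprime_periodM (R : comNzRingType) P p (f g : nat -> R) : coprime P p ->
  (forall m, f (m %% P)%N = f m) -> (forall m, g (m %% p)%N = g m) ->
  \sum_(0 <= m < P * p) f m * g m =
  (\sum_(0 <= m < P) f m) * (\sum_(0 <= m < p) g m).
Proof.
move=> co_Pp f_per g_per; rewrite mulnC.
have -> : \sum_(0 <= m < p * P) f m * g m =
    \sum_(0 <= j < p) \sum_(0 <= i < P) f i * g (i + P * j)%N.
  elim: p {co_Pp g_per} => [|p IHp]; first by rewrite !big_geq.
  rewrite [RHS]big_nat_recr //= -IHp mulSn addnC (@big_cat_nat _ _ _ (p * P)) ?leq_addr //=.
  congr (_ + _); rewrite -{1}[(p * P)%N]add0n big_addn addKn.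
  apply: eq_bigr => i _; rewrite [(P * p)%N]mulnC; congr (_ * _).
  by rewrite -f_per addnC modnMDl f_per.
rewrite exchange_big_nat /= big_distrl /=; apply: eq_bigr => i _.
rewrite -big_distrr /=; congr (_ * _).
by apply: sum_injective_mod => // a b; apply: affine_inj_mod; rewrite coprime_sym.
Qed.

(** * Translates of l-th powers in cosets of d-th powers *)

Section PowerCosets.
Variables (R : realType) (F : finFieldType) (d e l : nat).
Hypothesis de : (d * e = #|F|.-1)%N.
Hypothesis l_gt0 : (0 < l)%N.
Local Notation p := (#|F|%:R : R).

(** On nonzero elements z -> z^e maps onto the d-th roots of unity, with the cosets of the d-th
    powers as fibres; v names such a coset. *)
Definition coset_count (v h : F) : R := \sum_(m : F) ((m ^+ l + h) ^+ e == v)%:R.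

Lemma d_gt0_card : (0 < d)%N /\ (0 < e)%N.
Proof.
by apply/andP; rewrite -muln_gt0 de -subn1 subn_gt0 card_finNzRing_gt1.
Qed.

Lemma natr_card_pred : #|F|.-1%:R = p - 1.
Proof. by rewrite -subn1 natrB // (ltn_trans _ (card_finNzRing_gt1 F)). Qed.

Lemma expf_card1 (x : F) : x != 0 -> x ^+ #|F|.-1 = 1.
Proof.
move=> x0; have := expf_card x.
have -> : x ^+ #|F| = x * x ^+ #|F|.-1.
  by rewrite -exprS prednK // (ltn_trans _ (card_finNzRing_gt1 F)).
by move=> xp; apply: (mulfI x0); rewrite xp mulr1.
Qed.

Lemma sum_bool_card (P : pred F) : \sum_(x : F) (P x)%:R = #|[pred x | P x]|%:R :> R.
Proof.
rewrite -sum1_card natr_sum [RHS]big_mkcond; apply: eq_bigr => x _.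
by rewrite inE; case: (P x).
Qed.

Lemma card_roots_Xn (n : nat) (c : F) : (0 < n)%N ->
  \sum_(x : F) (x ^+ n == c)%:R <= n%:R :> R.
Proof.
move=> n_gt0; rewrite sum_bool_card ler_nat.
have pn0 : 'X^n - c%:P != 0 :> {poly F} by rewrite -size_poly_gt0 size_XnsubC.
have := max_poly_roots pn0 (rs := enum [pred x : F | x ^+ n == c]).
rewrite size_XnsubC // ltnS -cardE; apply; rewrite ?enum_uniq //.
by apply/allP => x; rewrite mem_enum inE /root !hornerE subr_eq0.
Qed.

Lemma sum_root_classes (x y : F) :
  \sum_(v : F | v ^+ d == 1) ((x == v)%:R * (y == v)%:R : R) <= ((x == y) && (x != 0))%:R.
Proof.
have [d_gt0 _] := d_gt0_card.
have [/andP[/eqP-> y0]|xy] := boolP ((x == y) && (x != 0)); last first.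
  rewrite big1 // => v /eqP vd; apply/eqP; rewrite -natrM mulnb pnatr_eq0 eqb0.
  apply: contraNN xy => /andP[/eqP-> /eqP->]; rewrite eqxx /=.
  by apply: contra_eqN vd => /eqP->; rewrite expr0n gtn_eqF // eq_sym oner_neq0.
rewrite (@le_trans _ _ (\sum_(v : F) (y == v)%:R)) //.
  rewrite big_mkcond; apply: ler_sum => v _; case: ifP => _ //.
  by case: (y == v); rewrite ?mulr0 ?mulr1.
rewrite (bigD1 y) //= eqxx big1 ?addr0 // => v; rewrite eq_sym => /negPf-> //.
Qed.

(* h -> (c + h) / (c' + h) is injective and sends the counted h to e-th roots of 1. *)
Lemma correlation_le (c c' : F) : c != c' ->
  \sum_(h : F) (((c + h) ^+ e == (c' + h) ^+ e) && ((c + h) ^+ e != 0))%:R <= e%:R :> R.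
Proof.
move=> cc'; have [_ e_gt0] := d_gt0_card.
apply: le_trans (@card_roots_Xn e 1 e_gt0).
rewrite !sum_bool_card ler_nat.
pose f h := (c + h) / (c' + h).
have f_inj : {in [pred h | (((c + h) ^+ e == (c' + h) ^+ e) && ((c + h) ^+ e != 0))] &,
    injective f}.
  have nz h : ((c + h) ^+ e == (c' + h) ^+ e) && ((c + h) ^+ e != 0) -> c' + h != 0.
    by case/andP=> /eqP->; rewrite expf_eq0 e_gt0.
  move=> h h' /nz h0 /nz h'0 /eqP; rewrite /f eqr_div // => /eqP fhh'.
  have /eqP : (c - c') * (h' - h) = 0.
    transitivity ((c + h) * (c' + h') - (c + h') * (c' + h)); first ring.
    by rewrite fhh' subrr.
  by rewrite mulf_eq0 !subr_eq0 (negPf cc') /= => /eqP ->.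
rewrite -(card_in_image f_inj); apply: subset_leq_card.
apply/fintype.subsetP => _ /fintype.imageP[h hP ->].
case/andP: hP => /eqP ch ch0; rewrite inE /f expr_div_n -ch divff //.
Qed.

(** A second moment over all shifts takes the place of bounds for individual character sums. In the
    expanded square, the at most l p pairs with m^l = m'^l cost at most p each, and every other pair
    at most e; once the expected value p / d is subtracted, the terms of order p^3 cancel. *)
Lemma variance_cosets :
  \sum_(h : F) \sum_(v : F | v ^+ d == 1) (coset_count v h - p / d%:R) ^+ 2 <=
  l.+1%:R * p ^+ 2.
Proof.
have [d_gt0 e_gt0] := d_gt0_card; have dR : 0 < d%:R :> R by rewrite ltr0n.
have p_gt1 : 1 < p by rewrite ltr1n card_finNzRing_gt1.
have deR : d%:R * e%:R = p - 1.
  by rewrite -natrM de natr_card_pred.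
have sqr_part : \sum_(h : F) \sum_(v : F | v ^+ d == 1) coset_count v h ^+ 2 <=
    l%:R * p ^+ 2 + p ^+ 2 * e%:R.
  have -> : \sum_(h : F) \sum_(v : F | v ^+ d == 1) coset_count v h ^+ 2 =
     \sum_(m : F) \sum_(m' : F) \sum_(h : F) \sum_(v : F | v ^+ d == 1)
       ((m ^+ l + h) ^+ e == v)%:R * ((m' ^+ l + h) ^+ e == v)%:R.
    transitivity (\sum_(h : F) \sum_(m : F) \sum_(m' : F) \sum_(v : F | v ^+ d == 1)
       ((m ^+ l + h) ^+ e == v)%:R * ((m' ^+ l + h) ^+ e == v)%:R : R).
      apply: eq_bigr => h _; rewrite pair_big /= exchange_big /=; apply: eq_bigr => v _.
      by rewrite expr2 /coset_count big_distrlr /= pair_big.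
    by rewrite exchange_big /=; apply: eq_bigr => m _; rewrite exchange_big.
  have -> : l%:R * p ^+ 2 + p ^+ 2 * e%:R = \sum_(m : F) (l%:R * p + p * e%:R) :> R.
    by rewrite sumr_const -mulr_natr; ring.
  apply: ler_sum => m _.
  apply: (@le_trans _ _ (\sum_(m' : F) ((m' ^+ l == m ^+ l)%:R * p + e%:R))).
    apply: ler_sum => m' _.
    apply: (@le_trans _ _ (\sum_(h : F) (((m ^+ l + h) ^+ e == (m' ^+ l + h) ^+ e)
        && ((m ^+ l + h) ^+ e != 0))%:R)).
      by apply: ler_sum => h _; exact: sum_root_classes.
    case: eqVneq => [_|mm']; last first.
      by rewrite mul0r add0r; apply: correlation_le; rewrite eq_sym.
    rewrite mul1r -[leLHS]addr0; apply: lerD => //.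
    apply: (@le_trans _ _ (\sum_(h : F) 1)); last by rewrite sumr_const.
    by apply: ler_sum => h _; rewrite lern1 leq_b1.
  rewrite big_split /= -big_distrl /= sumr_const -[e%:R *+ _]mulr_natl lerD //.
  by rewrite ler_wpM2r ?ler0n // card_roots_Xn.
have lin_part : \sum_(h : F) \sum_(v : F | v ^+ d == 1) coset_count v h = p * (p - 1).
  transitivity (\sum_(m : F) \sum_(h : F) \sum_(v : F | v ^+ d == 1)
      ((m ^+ l + h) ^+ e == v)%:R : R).
    rewrite [RHS]exchange_big /=; apply: eq_bigr => h _.
    by rewrite [RHS]exchange_big.
  rewrite mulr_natl -sumr_const.
  apply: eq_bigr => m _; rewrite (reindex_inj (addrI (- m ^+ l))) /=.
  under eq_bigr do under eq_bigr do rewrite addrA subrr add0r.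
  rewrite (bigD1 0) //= big1 ?add0r => [|v /eqP vd]; last first.
    rewrite expr0n gtn_eqF //; case: eqP => // v0.
    by move: vd; rewrite -v0 expr0n gtn_eqF // => /eqP; rewrite eq_sym oner_eq0.
  transitivity (\sum_(h : F | h != 0) 1 : R).
    apply: eq_bigr => h h0; rewrite (bigD1 (h ^+ e)) /=; last first.
      by rewrite -exprM mulnC de expf_card1.
    by rewrite eqxx big1 ?addr0 // => v /andP[_]; rewrite eq_sym => /negPf->.
  by rewrite sumr_const cardC1 natr_card_pred.
have const_part : \sum_(h : F) \sum_(v : F | v ^+ d == 1) (p / d%:R) ^+ 2 <= p ^+ 3 / d%:R.
  apply: (@le_trans _ _ (\sum_(h : F) d%:R * (p / d%:R) ^+ 2)); last first.
    rewrite sumr_const -mulr_natl le_eqVlt; apply/orP; left; apply/eqP.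
    by field; rewrite gt_eqF.
  apply: ler_sum => h _; rewrite sumr_const -[leLHS]mulr_natl.
  apply: ler_wpM2r; first exact: sqr_ge0.
  by have := @card_roots_Xn d 1 d_gt0; rewrite sum_bool_card.
have -> : \sum_(h : F) \sum_(v : F | v ^+ d == 1) (coset_count v h - p / d%:R) ^+ 2 =
   \sum_(h : F) \sum_(v : F | v ^+ d == 1) coset_count v h ^+ 2 -
   2 * (p / d%:R) * (\sum_(h : F) \sum_(v : F | v ^+ d == 1) coset_count v h) +
   \sum_(h : F) \sum_(v : F | v ^+ d == 1) (p / d%:R) ^+ 2.
  rewrite big_distrr /= -sumrB -big_split /=; apply: eq_bigr => h _.
  rewrite big_distrr /= -sumrB -big_split /=; apply: eq_bigr => v _; ring.
rewrite lin_part.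
have -> : l.+1%:R * p ^+ 2 = l%:R * p ^+ 2 + p ^+ 2 by rewrite -natr1; ring.
have eE : e%:R = (p - 1) / d%:R by rewrite -deR mulrAC divff ?mul1r ?gt_eqF.
have : p ^+ 2 * e%:R - 2 * (p / d%:R) * (p * (p - 1)) + p ^+ 3 / d%:R = p ^+ 2 / d%:R.
  by rewrite eE; field; rewrite gt_eqF.
have : p ^+ 2 / d%:R <= p ^+ 2.
  by rewrite ler_pdivrMr // ler_peMr ?sqr_ge0 // ler1n.
move: sqr_part const_part; lra.
Qed.

(** Substituting t m for m turns m^l + h t^l into t^l (m^l + h), whose e-th power differs by a fixed
    d-th root of unity: the terms are permuted. *)
Lemma coset_deviation_scale (h t : F) : t != 0 ->
  \sum_(v : F | v ^+ d == 1) (coset_count v (h * t ^+ l) - p / d%:R) ^+ 2 =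
  \sum_(v : F | v ^+ d == 1) (coset_count v h - p / d%:R) ^+ 2.
Proof.
move=> t0; set u := (t ^+ l) ^+ e.
have u0 : u != 0 by rewrite !expf_neq0.
have ud : u ^+ d = 1 by rewrite -exprM mulnC de expf_card1 ?expf_neq0.
rewrite (reindex_inj (mulfI u0)) /=; apply: eq_big => v.
  by rewrite exprMn ud mul1r.
move=> _; congr ((_ - _) ^+ 2); rewrite /coset_count (reindex_inj (mulfI t0)) /=.
apply: eq_bigr => m _; rewrite exprMn mulrC [h * _]mulrC mulrC -mulrDr exprMn -/u.
by rewrite (inj_eq (mulfI u0)).
Qed.

(* The sum over v in [variance_cosets] takes equal values at h and h t^l, and each
   such value is attained at least (p - 1) / l times. *)
Lemma coset_count_deviation (v h : F) : h != 0 -> v ^+ d = 1 ->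
  (p - 1) * (coset_count v h - p / d%:R) ^+ 2 <= (l * l.+1)%:R * p ^+ 2.
Proof.
move=> h0 vd; pose G h := \sum_(v : F | v ^+ d == 1) (coset_count v h - p / d%:R) ^+ 2.
have G_ge0 h' : 0 <= G h' by apply: sumr_ge0 => *; exact: sqr_ge0.
have p_gt1 : 1 < p by rewrite ltr1n card_finNzRing_gt1.
apply: (@le_trans _ _ ((p - 1) * G h)).
  apply: ler_wpM2l; first by rewrite subr_ge0 ltW.
  rewrite /G (bigD1 v) ?vd //= lerDl.
  by apply: sumr_ge0 => *; exact: sqr_ge0.
have -> : (p - 1) * G h = \sum_(t : F | t != 0) \sum_(h' : F) (h * t ^+ l == h')%:R * G h'.
  transitivity (\sum_(t : F | t != 0) G h).
    by rewrite sumr_const cardC1 -[RHS]mulr_natl natr_card_pred.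
  apply: eq_bigr => t t0; have <- : G (h * t ^+ l) = G h by exact: coset_deviation_scale.
  rewrite (bigD1 (h * t ^+ l)) //= eqxx mul1r big1 ?addr0 // => h'.
  by rewrite eq_sym => /negPf->; rewrite mul0r.
rewrite exchange_big /= natrM -mulrA.
apply: (@le_trans _ _ (\sum_(h' : F) l%:R * G h')); last first.
  by rewrite -big_distrr /= ler_wpM2l // variance_cosets.
apply: ler_sum => h' _; rewrite -big_distrl /= ler_wpM2r //.
apply: le_trans (@card_roots_Xn l (h^-1 * h') l_gt0).
rewrite [leRHS](bigID (fun t => t != 0)) /= -[leLHS]addr0 lerD ?sumr_ge0 //.
apply: ler_sum => t _.
by rewrite -(inj_eq (mulfI h0) (t ^+ l) (h^-1 * h')) mulVKf.
Qed.

End PowerCosets.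

(** * Sets correlated with powers *)

Section PrimeTests.
Variable R : realType.

Definition prime_test (k l : nat) (alpha beta : R) (p : nat) (w : int -> bool) : Prop :=
  [/\ prime p,
      forall z z', (p%:Z %| z - z')%Z -> w z = w z',
      beta * p%:R <= \sum_(0 <= m < p) (w (m ^ k)%N%:Z)%:R &
      forall a : int, \sum_(0 <= m < p) (w ((m ^ l)%N%:Z + a))%:R <= alpha * p%:R].

Lemma sum_Fp (V : nmodType) p (f : 'F_p -> V) : prime p ->
  \sum_(0 <= m < p) f m%:R = \sum_(x : 'F_p) f x.
Proof.
move=> p_pr; rewrite -{1}(Fp_cast p_pr) big_mkord; apply: eq_bigr => x _.
by rewrite natr_Zp.
Qed.

Definition residue_test p (e : nat) (v : 'F_p) (z : int) : bool := z%:~R ^+ e == v.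

Lemma residue_test_mod p e (v : 'F_p) z z' : prime p ->
  (p%:Z %| z - z')%Z -> residue_test e v z = residue_test e v z'.
Proof.
move=> p_pr /dvdzP[y zz']; rewrite /residue_test; congr (_ ^+ _ == _).
apply/eqP; rewrite -subr_eq0 -rmorphB zz' rmorphM /=.
have -> : p%:~R = 0 :> 'F_p by exact: pchar_Fp_0.
by rewrite mulr0.
Qed.

Lemma sum_residue_test_pow p e (v : 'F_p) j : prime p ->
  \sum_(0 <= m < p) (residue_test e v (m ^ j)%N%:Z)%:R =
  \sum_(x : 'F_p) (x ^+ (j * e) == v)%:R :> R.
Proof.
move=> p_pr; rewrite -(sum_Fp _ p_pr); apply: eq_bigr => m _.
by rewrite /residue_test -pmulrn natrX -exprM.
Qed.

Lemma sum_residue_test_shift p e (v : 'F_p) j (a : int) : prime p ->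
  \sum_(0 <= m < p) (residue_test e v ((m ^ j)%N%:Z + a))%:R =
  \sum_(x : 'F_p) ((x ^+ j + a%:~R) ^+ e == v)%:R :> R.
Proof.
move=> p_pr; rewrite -(sum_Fp _ p_pr); apply: eq_bigr => m _.
by rewrite /residue_test rmorphD /= -pmulrn natrX.
Qed.

(** The deviation in [coset_count_deviation] is O(sqrt p); the lower bound on the cardinality makes
    it at most eta p. *)
Lemma coset_count_le (F : finFieldType) (d e l : nat) (v h : F) (eta : R) :
  (d * e = #|F|.-1)%N -> (0 < l)%N -> h != 0 -> v ^+ d = 1 -> 0 < eta ->
  (l * l.+1)%:R <= eta ^+ 2 * (#|F|%:R - 1) ->
  \sum_(m : F) ((m ^+ l + h) ^+ e == v)%:R <= #|F|%:R / d%:R + eta * #|F|%:R.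
Proof.
move=> de l_gt0 h0 vd eta_gt0 big_p; set p : R := #|F|%:R; set S := \sum_(m : F) _.
have p_gt1 : 1 < p by rewrite ltr1n card_finNzRing_gt1.
have p1 : 0 < p - 1 by rewrite subr_gt0.
have := coset_count_deviation R de l_gt0 h0 vd; rewrite -/p -/S => dev.
rewrite -lerBlDl; apply: le_trans (ler_norm _) _.
rewrite -(ler_pXn2r (n := 2)) ?nnegrE ?mulr_ge0 ?(ltW eta_gt0) ?ler0n //.
rewrite real_normK ?num_real // -(ler_pM2l p1); apply: le_trans dev _.
have -> : (p - 1) * (eta * p) ^+ 2 = eta ^+ 2 * (p - 1) * p ^+ 2 by ring.
by apply: ler_wpM2r; rewrite ?sqr_ge0.
Qed.

(** For y != 0, the order of x / y divides both l and p - 1. *)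
Lemma Fp_inj_pow p l (x y : 'F_p) : prime p -> coprime l p.-1 -> (0 < l)%N ->
  x ^+ l = y ^+ l -> x = y.
Proof.
move=> p_pr co l_gt0 xy; have [y0|y0] := eqVneq y 0.
  by apply/eqP; move: xy; rewrite y0 expr0n gtn_eqF //= => /eqP; rewrite expf_eq0 l_gt0.
have zl : (x / y) ^+ l = 1 by rewrite expr_div_n xy divff // expf_neq0.
have z0 : x / y != 0.
  by apply: contra_eqN zl => /eqP ->; rewrite expr0n gtn_eqF // eq_sym oner_neq0.
have [d d_prim dl] := prim_order_exists l_gt0 zl.
have dp : (d %| p.-1)%N by rewrite (prim_order_dvd d_prim) fermat_Fp.
have d1 : d = 1%N by apply/eqP; rewrite -dvdn1 -(eqP co) dvdn_gcd dl.
have := prim_expr_order d_prim; rewrite d1 expr1 => /eqP.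
by rewrite -subr_eq0 -(mulfV y0) -mulrBl mulf_eq0 invr_eq0 (negPf y0) orbF subr_eq0 => /eqP.
Qed.

Lemma sum_nonzero_Fp p : prime p -> \sum_(x : 'F_p | x != 0) 1 = p%:R - 1 :> R.
Proof.
by move=> p_pr; rewrite sumr_const cardC1 card_Fp // -subn1 natrB // prime_gt0.
Qed.

Lemma ninetenths p : (10 <= p)%N -> 9%:R / 10%:R * p%:R <= p%:R - 1 :> R.
Proof. by rewrite -(ler_nat R); lra. Qed.

(** At most m = 0 fails the test, and the factor 9/10 allows for it as soon as p >= 10. *)
Lemma test_pow_ge p e k (pe : (p.-1 %| k * e)%N) : prime p -> (10 <= p)%N ->
  9%:R / 10%:R * p%:R <= \sum_(0 <= m < p) (residue_test e (1 : 'F_p) (m ^ k)%N%:Z)%:R :> R.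
Proof.
move=> p_pr p10; rewrite sum_residue_test_pow //.
apply: le_trans (ninetenths p10) _; rewrite -(sum_nonzero_Fp p_pr) big_mkcond.
apply: ler_sum => x _; case: ifP => // x0.
by rewrite -(divnK pe) mulnC exprM fermat_Fp // expr1n eqxx.
Qed.

(** The test is z^e = 1 with e = (p - 1) / k. For a nonzero shift the proportion is at most 1/k +
    1/4 <= 3/4. For shift 0, since k does not divide l, g^(l e) != 1; multiplication by g then sends
    passing x to failing ones, and at most half pass. *)
Lemma tests_not_dvdn k l B : (1 < k)%N -> (0 < l)%N -> ~~ (k %| l)%N ->
  exists p w, (B < p)%N /\ prime_test k l (3%:R / 4%:R) (9%:R / 10%:R) p w.
Proof.
move=> k_gt1 l_gt0 kl; have k_gt0 := ltnW k_gt1.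
have [p [p_pr p_gt kp]] := @prime_one_mod k (B + 10 + 16 * (l * l.+1)) k_gt0.
pose e := (p.-1 %/ k)%N; have ke : (k * e = p.-1)%N by rewrite mulnC divnK.
have p_gt0 := prime_gt0 p_pr.
exists p, (residue_test e (1 : 'F_p)); split; first by lia.
split=> // [z z'||a]; first exact: residue_test_mod.
  by apply: test_pow_ge; rewrite ?ke //; lia.
rewrite sum_residue_test_shift //.
have cardF : #|'F_p| = p by exact: card_Fp.
have [->|a0] := eqVneq (a%:~R : 'F_p) 0; last first.
  have := @coset_count_le 'F_p k e l 1 a%:~R 4^-1; rewrite cardF => /(_ ke l_gt0 a0).
  rewrite expr1n invr_gt0 ltr0n => /(_ erefl isT) le_count.
  apply: le_trans (le_count _) _.
    have : 16 * (l * l.+1)%:R <= p%:R - 1 :> R.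
      by rewrite lerBrDr -natrM natr1 ler_nat; lia.
    by rewrite expr2; lra.
  have : p%:R / k%:R <= p%:R / 2 :> R.
    by rewrite ler_wpM2l // lef_pV2 ?posrE ?ltr0n ?ler_nat.
  lra.
have [g g_prim] := prime_field_prim_root p_pr.
have g0 : g != 0.
  apply: contraTneq g_prim => ->; apply/negP => /prim_expr_order.
  have p1_gt0 : (0 < p.-1)%N by rewrite -subn1 subn_gt0 prime_gt1.
  by rewrite expr0n gtn_eqF // => /eqP; rewrite eq_sym oner_eq0.
have g_le : g ^+ (l * e) != 1.
  rewrite -(prim_order_dvd g_prim) -ke; apply: contraNN kl.
  by rewrite dvdn_pmul2r // divn_gt0 // dvdn_leq // -subn1 subn_gt0 prime_gt1.
under eq_bigr do rewrite addr0 -exprM.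
suff : \sum_(x : 'F_p) (x ^+ (l * e) == 1)%:R +
       \sum_(x : 'F_p) (x ^+ (l * e) == 1)%:R <= p%:R :> R.
  have : 0 <= p%:R :> R by [].
  lra.
rewrite [X in _ + X](reindex_inj (mulfI g0)) /= -big_split /=.
apply: (@le_trans _ _ (\sum_(x : 'F_p) 1)); last by rewrite sumr_const cardF.
apply: ler_sum => x _; rewrite exprMn.
case: eqP => [->|_]; first by rewrite mulr1 (negPf g_le) addr0.
by rewrite add0r lern1 leq_b1.
Qed.

(** The test is z^e = v with e = (p - 1) / l. Nonzero l-th powers have e-th power 1, so v = g^(k e),
    which is not 1 because k < l, is never attained at shift 0. For x = g y, the power x^k passes
    when y^(k e) = 1, a proportion of about k / l >= 2 / l; nonzero shifts give at most 1 / l + 1 /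
    (4 l). *)
Lemma tests_dvdn k l B : (1 < k)%N -> (k %| l)%N -> (k < l)%N ->
  exists p w, (B < p)%N /\
    prime_test k l (5%:R / (4 * l%:R)) (6%:R / (4 * l%:R)) p w.
Proof.
move=> k_gt1 kl k_lt_l; have l_gt0 : (0 < l)%N by apply: leq_ltn_trans k_lt_l.
have k_gt0 := ltnW k_gt1.
have [p [p_pr p_gt lp]] := @prime_one_mod l (B + 10 + 16 * (l * l) * (l * l.+1)) l_gt0.
pose e := (p.-1 %/ l)%N; have le : (l * e = p.-1)%N by rewrite mulnC divnK.
have p1_gt0 : (0 < p.-1)%N by rewrite -subn1 subn_gt0 prime_gt1.
have e_gt0 : (0 < e)%N by rewrite divn_gt0 // dvdn_leq.
have lR : 0 < l%:R :> R by rewrite ltr0n.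
have [g g_prim] := prime_field_prim_root p_pr.
have g0 : g != 0.
  apply: contraTneq g_prim => ->; apply/negP => /prim_expr_order.
  by rewrite expr0n gtn_eqF // => /eqP; rewrite eq_sym oner_eq0.
pose v := g ^+ (k * e).
have v1 : v != 1.
  rewrite -(prim_order_dvd g_prim) -le dvdn_pmul2r //.
  by apply/negP => /(dvdn_leq k_gt0); rewrite leqNgt k_lt_l.
have v0 : v != 0 by rewrite expf_neq0.
have vl : v ^+ l = 1 by rewrite /v -exprM -mulnA [(e * l)%N]mulnC le mulnC exprM fermat_Fp ?expr1n.
have cardF : #|'F_p| = p by exact: card_Fp.
exists p, (residue_test e v); split; first by lia.
split=> // [z z'||a]; first exact: residue_test_mod.
  rewrite sum_residue_test_pow //.
  pose c := (l %/ k)%N; have kc : (k * c = l)%N by rewrite mulnC divnK.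
  have c_gt0 : (0 < c)%N by rewrite divn_gt0 // ltnW.
  have count_ge : p%:R - 1 <= c%:R * (\sum_(y : 'F_p) (y ^+ (k * e) == 1)%:R) :> R.
    apply: (@le_trans _ _ (\sum_(z : 'F_p | z != 0) \sum_(y : 'F_p) (z ^+ c == y)%:R)).
      rewrite -(sum_nonzero_Fp p_pr); apply: ler_sum => z _.
      by rewrite (bigD1 (z ^+ c)) //= eqxx lerDl sumr_ge0.
    rewrite exchange_big /= big_distrr /=; apply: ler_sum => y _.
    case: eqVneq => [_|y1]; last first.
      rewrite mulr0 big1 // => z z0; case: eqP => // zy; case/eqP: y1.
      by rewrite -zy -exprM mulnA [(c * k)%N]mulnC kc le fermat_Fp.
    rewrite mulr1; apply: le_trans (@card_roots_Xn R 'F_p c y c_gt0).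
    by rewrite [leRHS](bigID (fun t => t != 0)) /= lerDl sumr_ge0.
  rewrite (reindex_inj (mulfI g0)) /=.
  under eq_bigr do rewrite exprMn -[X in _ == X]mulr1 (inj_eq (mulfI v0)).
  have c2 : 2 * c%:R <= l%:R :> R by rewrite -natrM ler_nat -kc leq_mul2r k_gt1 orbT.
  have p10 : 10 <= p%:R :> R by rewrite ler_nat (leq_trans _ (ltnW p_gt)) // addnAC leq_addl.
  set S := \sum_(y : 'F_p) _ in count_ge *; have S_ge0 : 0 <= S by rewrite sumr_ge0.
  rewrite mulrAC ler_pdivrMr ?mulr_gt0 //; nra.
rewrite sum_residue_test_shift //.
have [->|a0] := eqVneq (a%:~R : 'F_p) 0.
  rewrite big1 ?mulr_ge0 ?invr_ge0 ?mulr_ge0 // => x _.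
  rewrite addr0 -exprM le; have [->|x0] := eqVneq x 0.
    by rewrite expr0n gtn_eqF // eq_sym (negPf v0).
  by rewrite fermat_Fp // eq_sym (negPf v1).
have := @coset_count_le 'F_p l e l v a%:~R (4 * l%:R)^-1; rewrite cardF => /(_ le l_gt0 a0 vl).
rewrite invr_gt0 mulr_gt0 // => /(_ isT) le_count; apply: le_trans (le_count _) _.
  rewrite exprVn mulrC ler_pdivlMr ?exprn_gt0 ?mulr_gt0 // exprMn.
  have : 16 * (l * l)%:R * (l * l.+1)%:R <= p%:R - 1 :> R.
    by rewrite lerBrDr -!natrM natr1 ler_nat (leq_ltn_trans _ p_gt) // leq_addl.
  rewrite [(l * l)%:R]natrM; lra.
rewrite le_eqVlt; apply/orP; left; apply/eqP; field.
by rewrite gt_eqF.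
Qed.

Lemma tests_exist k l : (1 < k)%N -> (1 < l)%N -> k <> l ->
  exists alpha beta : R, alpha < beta /\
    forall B, exists p w, (B < p)%N /\ prime_test k l alpha beta p w.
Proof.
move=> k_gt1 l_gt1 neq_kl; have l_gt0 := ltnW l_gt1.
have [kl|kl] := boolP (k %| l)%N; last first.
  by exists (3%:R / 4%:R), (9%:R / 10%:R); split; [lra|move=> B; exact: tests_not_dvdn].
have k_lt_l : (k < l)%N by rewrite ltn_neqAle dvdn_leq // andbT; apply/eqP.
exists (5%:R / (4 * l%:R)), (6%:R / (4 * l%:R)); split; last by move=> B; exact: tests_dvdn.
by rewrite ltr_pM2r ?invr_gt0 ?mulr_gt0 ?ltr0n // ltr_nat.
Qed.

(** The prime factors of l are odd, so p can be chosen with p - 1 divisible by q and prime to l.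
    Then x -> x^l + a permutes F_p, and whatever a is, at most e = (p - 1) / q <= p / 2 elements
    pass. *)
Lemma tests_bijective k l q B : odd l -> (0 < l)%N -> prime q -> (q %| k)%N -> ~~ (q %| l)%N ->
  exists p w, (B < p)%N /\
    coprime l p.-1 /\ prime_test k l (3%:R / 4%:R) (9%:R / 10%:R) p w.
Proof.
move=> l_odd l_gt0 q_pr qk ql.
have [||p [p_pr p_gt pq pr]] := @prime_in_classes R q (primes l) (B + 10) q_pr _ (primes_uniq l).
- by rewrite mem_primes (negPf ql) !andbF.
- move=> r; rewrite mem_primes => /and3P[r_pr _ rl]; rewrite r_pr /=.
  by apply: dvdn_odd rl l_odd.
have p1_gt0 : (0 < p.-1)%N by rewrite -subn1 subn_gt0 prime_gt1.
have dvd1 r : (r %| p.-1)%N = (p == 1 %[mod r])%N.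
  by rewrite eqn_mod_dvd ?prime_gt0 // subn1.
have co : coprime l p.-1.
  rewrite coprime_has_primes //; apply/hasPn => r; rewrite mem_primes => /and3P[r_pr _].
  rewrite dvd1 => /eqP rp1; apply/negP => r_l; exact: (pr r r_l).
have qp : (q %| p.-1)%N by rewrite dvd1; apply/eqP.
have [e qe] : exists e, (q * e = p.-1)%N by exists (p.-1 %/ q)%N; rewrite mulnC divnK.
have e_gt0 : (0 < e)%N by move: p1_gt0; rewrite -qe muln_gt0 => /andP[].
have p10 : (10 <= p)%N by apply: leq_trans (ltnW p_gt); rewrite leq_addl.
exists p, (residue_test e (1 : 'F_p)); split; first by apply: leq_ltn_trans p_gt; rewrite leq_addr.
split=> //; split=> // [z z'||a]; first exact: residue_test_mod.
  by apply: test_pow_ge => //; rewrite -qe dvdn_mul.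
rewrite sum_residue_test_shift //.
have inj : injective (fun x : 'F_p => x ^+ l + a%:~R).
  by move=> x y /addIr; exact: Fp_inj_pow.
have -> : \sum_(x : 'F_p) ((x ^+ l + a%:~R) ^+ e == 1)%:R =
    \sum_(y : 'F_p) (y ^+ e == 1)%:R :> R by rewrite [RHS](reindex_inj inj).
apply: le_trans (@card_roots_Xn R 'F_p e 1 e_gt0) _.
have : (2 * e <= p)%N by rewrite (leq_trans _ (leq_pred p)) // -qe leq_mul2r prime_gt1 ?orbT.
by rewrite -(ler_nat R) natrM; have : 0 <= p%:R :> R by []; lra.
Qed.

(** * Combining the tests at many primes *)

Section Blocks.
Variables (k l : nat) (alpha beta : R) (Q : nat -> Prop).
Hypothesis lt_alpha_beta : alpha < beta.
Hypothesis tests : forall B, exists p w,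
  (B < p)%N /\ Q p /\ prime_test k l alpha beta p w.

(** The centred functions have mean zero and coprime periods, so by [sum_coprime_periodM] the cross
    terms vanish and the variances, each at most 1, add up. Periodicity and zero mean of G are
    carried along for the induction. *)
Lemma variance_independent (p : nat -> nat) (f : nat -> nat -> R) (mu : nat -> R) :
  (forall i j, (i < j)%N -> coprime (p i) (p j)) ->
  (forall i, (0 < p i)%N) ->
  (forall i m, f i (m %% p i)%N = f i m) ->
  (forall i m, 0 <= f i m <= 1) ->
  (forall i, \sum_(0 <= m < p i) f i m = mu i * (p i)%:R) ->
  forall r, let P := (\prod_(0 <= i < r) p i)%N in
    let G m := \sum_(0 <= i < r) (f i m - mu i) in
    [/\ forall m, G (m %% P)%N = G m, \sum_(0 <= m < P) G m = 0 &
        \sum_(0 <= m < P) G m ^+ 2 <= r%:R * P%:R].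
Proof.
move=> co p_gt0 f_per f01 f_mu r /=.
have mu01 i : 0 <= mu i <= 1.
  have pR : 0 < (p i)%:R :> R by rewrite ltr0n.
  rewrite -(ler_pM2r pR) mul0r -(ler_pM2r pR (mu i) 1) mul1r -f_mu; apply/andP; split.
    by apply: sumr_ge0 => m _; have /andP[] := f01 i m.
  apply: (@le_trans _ _ (\sum_(0 <= m < p i) 1)); last by rewrite sumr_const_nat subn0.
  by apply: ler_sum => m _; have /andP[] := f01 i m.
elim: r => [|r [G_per G_sum G_sqr]].
  have -> : (\prod_(0 <= i < 0) p i = 1)%N by rewrite big_geq.
  by split=> [m||]; rewrite ?big_nat1 !big_geq // expr0n mul0r.
set P := (\prod_(0 <= i < r) p i)%N in G_per G_sum G_sqr.
pose G m := \sum_(0 <= i < r) (f i m - mu i).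
pose g m := f r m - mu r.
have GS m : \sum_(0 <= i < r.+1) (f i m - mu i) = G m + g m by rewrite big_nat_recr.
have -> : (\prod_(0 <= i < r.+1) p i = P * p r)%N by rewrite big_nat_recr.
have g_per m : g (m %% p r)%N = g m by rewrite /g f_per.
have g_sum : \sum_(0 <= m < p r) g m = 0.
  by rewrite sumrB f_mu sumr_const_nat subn0 mulr_natr subrr.
have co_P : coprime P (p r).
  rewrite /P big_nat; apply: (big_ind (fun x => coprime x (p r))).
  - exact: coprime1n.
  - by move=> x y xr yr; rewrite coprimeMl xr.
  by move=> i /andP[_ ir]; exact: co.
have one_sum n : \sum_(0 <= m < n) (1 : R) = n%:R by rewrite sumr_const_nat subn0.
have prodM (a b : nat -> R) := @sum_coprime_periodM R P (p r) a b co_P.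
split=> [m||].
- rewrite !GS -[G m]G_per -(g_per m); congr (_ + _).
    by rewrite -[LHS]G_per modn_dvdm ?dvdn_mulr.
  by rewrite -[LHS]g_per modn_dvdm ?dvdn_mull.
- under eq_bigr do rewrite GS.
  rewrite big_split /=.
  have -> : \sum_(0 <= m < P * p r) G m = (\sum_(0 <= m < P) G m) * \sum_(0 <= m < p r) 1.
    by rewrite -prodM //; apply: eq_bigr => m _; rewrite mulr1.
  have -> : \sum_(0 <= m < P * p r) g m = (\sum_(0 <= m < P) 1) * \sum_(0 <= m < p r) g m.
    by rewrite -prodM //; apply: eq_bigr => m _; rewrite mul1r.
  by rewrite G_sum g_sum mul0r mulr0 addr0.
have sqr_per (h : nat -> R) n : (forall m, h (m %% n)%N = h m) ->
    forall m, (fun m => h m ^+ 2) (m %% n)%N = h m ^+ 2 by move=> hp m; rewrite hp.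
have -> : \sum_(0 <= m < P * p r) (\sum_(0 <= i < r.+1) (f i m - mu i)) ^+ 2 =
    \sum_(0 <= m < P * p r) (G m ^+ 2 * 1 + 2 * (G m * g m) + 1 * g m ^+ 2).
  by apply: eq_bigr => m _; rewrite GS; ring.
have e1 := prodM _ (fun=> 1) (sqr_per G P G_per) (fun=> erefl).
have e2 := prodM (fun=> 1) _ (fun=> erefl) (sqr_per g (p r) g_per).
rewrite !big_split /= -big_distrr /= (prodM G g G_per g_per) e1 e2.
rewrite G_sum mul0r mulr0 addr0 !one_sum.
have g2 : \sum_(0 <= m < p r) g m ^+ 2 <= (p r)%:R.
  rewrite -[leRHS]one_sum; apply: ler_sum => m _; rewrite /g.
  have /andP[f0 f1] := f01 r m; have /andP[m0 m1] := mu01 r; rewrite expr2; nra.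
rewrite natrM -natr1 mulrDl mul1r; apply: lerD; last by rewrite ler_wpM2l.
by rewrite mulrA ler_wpM2r.
Qed.

Lemma chebyshev_count P r (G : nat -> R) (A : pred nat) (delta eps : R) :
  0 < delta -> (0 < r)%N -> \sum_(0 <= m < P) G m ^+ 2 <= r%:R * P%:R ->
  (forall m, A m -> r%:R * delta <= `|G m|) -> (eps * delta ^+ 2)^-1 <= r%:R -> 0 < eps ->
  \sum_(0 <= m < P) (A m)%:R <= eps * P%:R.
Proof.
move=> d_gt0 r_gt0 G2 AG r_big e_gt0; have rR : 0 < r%:R :> R by rewrite ltr0n.
have rd : 0 < (r%:R * delta) ^+ 2 by rewrite exprn_gt0 ?mulr_gt0.
rewrite -(ler_pM2l rd) big_distrr /=; apply: (@le_trans _ _ (r%:R * P%:R)).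
  apply: le_trans G2; apply: ler_sum => m _.
  case: (boolP (A m)) => [Am|_]; last by rewrite mulr0 sqr_ge0.
  rewrite mulr1 -(real_normK (num_real (G m))).
  by rewrite ler_pXn2r ?nnegrE ?mulr_ge0 ?(ltW rR) ?(ltW d_gt0) ?normr_ge0 ?AG.
rewrite mulrA; apply: ler_wpM2r => //.
have : 1 <= eps * delta ^+ 2 * r%:R.
  by rewrite -ler_pdivrMl ?mulr_gt0 ?exprn_gt0 // mulr1.
move=> /(ler_wpM2l (ltW rR)); rewrite mulr1 => /le_trans; apply.
by rewrite le_eqVlt; apply/orP; left; apply/eqP; ring.
Qed.

(** The threshold is at distance at least r delta from both means, with delta half the gap, so the
    number r of primes depends only on eps and the gap. The primes can therefore be taken beyond any
    B; [Q] transmits what else is known of them. *)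
Lemma blocks_exist (eps : R) B : 0 < eps ->
  exists (P : nat) (A : int -> bool),
    [/\ exists ps : seq nat, [/\ (P = \prod_(p <- ps) p)%N, uniq ps, ps != [::] &
          {in ps, forall p, [/\ prime p, (B < p)%N & Q p]}],
        forall z z', (P%:Z %| z - z')%Z -> A z = A z',
        \sum_(0 <= m < P) (~~ A (m ^ k)%N%:Z)%:R <= eps * P%:R &
        forall a : int, \sum_(0 <= m < P) (A ((m ^ l)%N%:Z + a))%:R <= eps * P%:R].
Proof.
move=> eps_gt0.
have /choice[c cP] b : exists pw : nat * (int -> bool),
    (b < pw.1)%N /\ Q pw.1 /\ prime_test k l alpha beta pw.1 pw.2.
  by have [p [w H]] := tests b; exists (p, w).
have [p [w [pP p_lt p0_B]]] : exists (p : nat -> nat) (w : nat -> int -> bool),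
    [/\ forall i, Q (p i) /\ prime_test k l alpha beta (p i) (w i),
        forall i, (p i < p i.+1)%N & (B < p 0)%N].
  pose p i := iter i.+1 (fun b => (c b).1) B.
  exists p, (fun i => (c (iter i (fun b => (c b).1) B)).2); split=> [i|i|].
  - exact: (cP (iter i (fun b => (c b).1) B)).2.
  - by have [] := cP (p i).
  by have [] := cP B.
have p_mono i j : (i < j)%N -> (p i < p j)%N.
  elim: j => // j IHj; rewrite ltnS leq_eqVlt => /predU1P[->//|/IHj ij].
  exact: ltn_trans ij (p_lt j).
have p_B i : (B < p i)%N.
  elim: i => [|i IHi]; first exact: p0_B.
  exact: ltn_trans IHi (p_lt i).
have p_pr i : prime (p i) by have [_ []] := pP i.
have p_gt0 i : (0 < p i)%N by exact: prime_gt0.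
have co i j : (i < j)%N -> coprime (p i) (p j).
  by move=> /p_mono ij; rewrite prime_coprime // dvdn_prime2 // ltn_eqF.
pose delta := (beta - alpha) / 2; have d_gt0 : 0 < delta by rewrite divr_gt0 ?subr_gt0.
have [r r_gt0 r_big] : exists2 r : nat, (0 < r)%N & (eps * delta ^+ 2)^-1 <= r%:R.
  exists (Num.truncn (eps * delta ^+ 2)^-1).+1 => //.
  have ed : 0 <= (eps * delta ^+ 2)^-1 by rewrite invr_ge0 mulr_ge0 ?exprn_ge0 ?ltW.
  by have /andP[_ /ltW] := truncn_itv ed.
pose P := (\prod_(0 <= i < r) p i)%N.
pose X z := \sum_(0 <= i < r) (w i z)%:R : R.
pose A z := r%:R * ((alpha + beta) / 2) <= X z.
have w_mod i z z' : ((p i)%:Z %| z - z')%Z -> w i z = w i z' by have [_ []] := pP i; auto.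
have p_dvd i : (i < r)%N -> (p i %| P)%N.
  by move=> ir; rewrite /P (bigD1_seq i) ?mem_index_iota ?iota_uniq //= dvdn_mulr.
have natw_mod i (s : nat -> int) : (forall m, ((p i)%:Z %| s (m %% p i)%N - s m)%Z) ->
    forall m, (w i (s (m %% p i)%N))%:R = (w i (s m))%:R :> R.
  by move=> sP m; rewrite (w_mod _ _ _ (sP m)).
have pow_mod i j (a : int) m : ((p i)%:Z %| ((m %% p i) ^ j)%N%:Z + a - ((m ^ j)%N%:Z + a))%Z.
  have -> : ((m %% p i) ^ j)%N%:Z + a - ((m ^ j)%N%:Z + a) =
     ((m %% p i) ^ j)%N%:Z - (m ^ j)%N%:Z by ring.
  by rewrite -eqz_mod_dvd !modz_nat modnXm.
have main (s : nat -> int) : 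
    (forall i m, ((p i)%:Z %| s (m %% p i)%N - s m)%Z) ->
    exists mu : nat -> R, [/\ forall i, \sum_(0 <= m < p i) (w i (s m))%:R = mu i * (p i)%:R
      & \sum_(0 <= m < P) (X (s m) - \sum_(0 <= i < r) mu i) ^+ 2 <= r%:R * P%:R].
  move=> sP; pose mu i := (\sum_(0 <= m < p i) (w i (s m))%:R) / (p i)%:R : R.
  have muP i : \sum_(0 <= m < p i) (w i (s m))%:R = mu i * (p i)%:R.
    by rewrite divfK // pnatr_eq0 -lt0n.
  exists mu; split=> //.
  have [||_ _ /=] := @variance_independent p (fun i m => (w i (s m))%:R) mu co p_gt0 _ _ muP r.
  - by move=> i m; apply: (natw_mod i s); exact: sP.
  - by move=> i m; rewrite ler0n lern1 leq_b1.
  by under eq_bigr do rewrite sumrB.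
have rR : 0 < r%:R :> R by rewrite ltr0n.
have rab : r%:R * alpha < r%:R * beta by rewrite ltr_pM2l.
exists P, A; split.
- exists [seq p i | i <- index_iota 0 r]; split.
  + by rewrite big_map.
  + rewrite map_inj_uniq ?iota_uniq // => i j ij.
    by case: (ltngtP i j) => // /p_mono; rewrite ij ltnn.
  + by rewrite -size_eq0 size_map size_iota subn0 -lt0n.
  by move=> _ /mapP[i _ ->]; split=> //; have [] := pP i.
- move=> z z' Pz; rewrite /A /X; congr (_ <= _); apply: eq_big_nat => i /andP[_ ir].
  by rewrite (w_mod i z z') // (dvdz_trans _ Pz) // dvdzE /= p_dvd.
- have [|mu [muP var]] := main (fun m => (m ^ k)%N%:Z).
    by move=> i m; have := pow_mod i k 0 m; rewrite !addr0.
  apply: (chebyshev_count d_gt0 _ var) => // m; rewrite /A -ltNge => XA.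
  have mu_ge : r%:R * beta <= \sum_(0 <= i < r) mu i.
    have -> : r%:R * beta = \sum_(0 <= i < r) beta.
      by rewrite sumr_const_nat subn0 mulr_natl.
    apply: ler_sum => i _; have [_ [_ _ + _]] := pP i; rewrite muP.
    by rewrite ler_pM2r ?ltr0n.
  by rewrite ltr0_norm /delta; lra.
move=> a; have [|mu [muP var]] := main (fun m => (m ^ l)%N%:Z + a).
  by move=> i m; exact: pow_mod.
apply: (chebyshev_count d_gt0 _ var) => // m; rewrite /A => XA.
have mu_le : \sum_(0 <= i < r) mu i <= r%:R * alpha.
  have -> : r%:R * alpha = \sum_(0 <= i < r) alpha.
    by rewrite sumr_const_nat subn0 mulr_natl.
  apply: ler_sum => i _; have [_ [_ _ _ /(_ a)]] := pP i; rewrite muP.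
  by rewrite ler_pM2r ?ltr0n.
by apply: le_trans (ler_norm _); rewrite /delta; lra.
Qed.

End Blocks.
End PrimeTests.

Import numFieldNormedType.Exports.
Local Open Scope classical_set_scope.
Local Open Scope ring_scope.

(** * Topology of the full shift *)

Definition agree (W : nat) (y z : word) : Prop :=
  forall i : int, (`|i| <= W)%N -> y i = z i.

Lemma agreeW W W' y z : (W <= W')%N -> agree W' y z -> agree W y z.
Proof. by move=> WW' yz i iW; apply: yz; apply: leq_trans WW'. Qed.

Lemma agree_sym W y z : agree W y z -> agree W z y.
Proof. by move=> yz i iW; rewrite yz. Qed.

Lemma agree_trans W x y z : agree W x y -> agree W y z -> agree W x z.
Proof. by move=> xy yz i iW; rewrite xy // yz. Qed.

Lemma nbhs_coord (y : word) (i : int) : nbhs y [set z : word | y i = z i].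
Proof.
apply: (@proj_continuous _ (fun _ : int => bool) i y [set b | y i = b]).
by change (nbhs (y i) [set b | y i = b]); rewrite nbhs_principalE; exact/principal_filterP.
Qed.

Lemma nbhs_agree (y : word) W : nbhs y [set z | agree W y z].
Proof.
elim: W => [|W IHW].
  by apply: filterS (nbhs_coord y 0) => z yz i; rewrite leqn0 absz_eq0 => /eqP ->.
apply: filterS (filterI IHW (filterI (nbhs_coord y W.+1%:Z) (nbhs_coord y (- W.+1%:Z)))).
move=> z [yzW [yz1 yz2]] i iW; have [iW'|Wi] := leqP `|i| W; first exact: yzW.
have : i = W.+1%:Z \/ i = - W.+1%:Z by lia.
by case=> ->.
Qed.

(** The filter of windows around y converges to y in each coordinate, hence in the product
    topology. *)
Lemma nbhs_wordP (y : word) (U : set word) :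
  nbhs y U <-> exists W, [set z | agree W y z] `<=` U.
Proof.
split=> [yU|[W yWU]]; last exact: filterS yWU (nbhs_agree y W).
pose G := filter_from [set: nat] (fun W => [set z | agree W y z]).
have GF : Filter G.
  apply: filter_from_filter; first by exists 0%N.
  move=> W W' _ _; exists (maxn W W') => // z yz.
  by split; apply: agreeW yz; rewrite ?leq_maxl ?leq_maxr.
have Gy : G --> y.
  apply/cvg_sup => i V [V' [[B oB <-]] /= By sV'V].
  exists `|i|%N => // z yz; apply: sV'V; rewrite /= -(yz i) //.
by have [W _ WU] := Gy U yU; exists W.
Qed.

Lemma word_compact : compact [set: word].
Proof.
have := @tychonoff _ (fun _ : int => _) _ (fun=> bool_compact).
by congr (compact _); rewrite eqEsubset.
Qed.

Lemma orbit_closure_closed x : closed (orbit_closure x).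
Proof. exact: closed_closure. Qed.

Lemma orbit_closure_compact x : compact (orbit_closure x).
Proof. exact: subclosed_compact (@orbit_closure_closed x) word_compact _. Qed.

Lemma orbit_closureP x (y : word) :
  orbit_closure x y <-> forall W, exists n, agree W y (shiftz n x).
Proof.
split=> [yX W|H U /nbhs_wordP[W yWU]].
  by have [z [[n _ <-] yz]] := yX _ (nbhs_agree y W); exists n.
by have [n yn] := H W; exists (shiftz n x); split; [exists n|exact: yWU].
Qed.

Lemma orbit_closure_shift x n : orbit_closure x (shiftz n x).
Proof. by apply/orbit_closureP => W; exists n. Qed.

Lemma shiftz_orbit_closure x n y : orbit_closure x y -> orbit_closure x (shiftz n y).
Proof.
move=> /orbit_closureP H; apply/orbit_closureP => W.
have [m ym] := H (W + `|n|)%N; exists (m + n) => i iW.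
by rewrite /shiftz ym /shiftz; [congr x; ring|lia].
Qed.

Section UniformContinuity.
Variable R : realType.

Lemma within_continuous_agree (X : set word) (f : word -> R) (y : word) (e : R) :
  {within X, continuous f} -> X y -> 0 < e ->
  exists W, forall z, X z -> agree W y z -> `|f y - f z| < e.
Proof.
move=> /subspace_continuousP cf Xy e_gt0.
have /cf /cvgrPdist_lt /(_ e e_gt0) /nbhs_wordP[W yW] := Xy.
by exists W => z Xz yz; apply: yW.
Qed.

Lemma within_continuous_uniform (X : set word) (f : word -> R) (e : R) :
  compact X -> {within X, continuous f} -> 0 < e ->
  exists W, forall y z, X y -> X z -> agree W y z -> `|f y - f z| < e.
Proof.
move=> /compact_near_coveringP cX cf e_gt0.
have e2 : 0 < e / 2 by rewrite divr_gt0.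
have [|W _ HW] := cX nat \oo (fun W y => X y -> forall z, X z -> agree W y z ->
    `|f y - f z| < e).
  move=> y Xy; have [W hW] := within_continuous_agree cf Xy e2.
  exists ([set y' | agree W y y'], [set W' | (W <= W')%N]) => /=.
    by split; [exact: nbhs_agree|exists W].
  move=> [y' W'] /= [yy' WW'] Xy' z Xz y'z.
  have -> : f y' - f z = (f y - f z) - (f y - f y') by ring.
  apply: le_lt_trans (ler_normB _ _) _.
  have := hW _ Xy' yy'; have := hW z Xz (agree_trans yy' (agreeW WW' y'z)).
  lra.
by exists W => y z Xy Xz yz; exact: (HW W (leqnn W) y Xy Xy z Xz yz).
Qed.

Lemma within_continuous_bounded (X : set word) (f : word -> R) :
  compact X -> {within X, continuous f} -> exists2 C, 0 <= C & forall y, X y -> `|f y| <= C.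
Proof.
move=> cX cf; have := continuous_compact cf cX => /compact_bounded[M [_ HM]].
exists (`|M| + 1); first by rewrite addr_ge0.
move=> y Xy; apply: HM; last by exists y.
by rewrite (le_lt_trans (ler_norm M)) // ltrDl.
Qed.

End UniformContinuity.

(** * The Toeplitz word of a scheme *)

Definition int_periodic (T : Type) (n : nat) (g : int -> T) : Prop :=
  forall z z', (n%:Z %| z - z')%Z -> g z = g z'.

Section PeriodicAverages.
Variable R : realType.

Lemma periodic_sum_approx (g : nat -> R) n C N : (0 < n)%N ->
  (forall m, g (m + n)%N = g m) -> (forall m, `|g m| <= C) ->
  `|\sum_(0 <= m < N) g m - N%:R / n%:R * \sum_(0 <= m < n) g m| <= 2 * n%:R * C.
Proof.
move=> n_gt0 g_per gC; have nR : 0 < n%:R :> R by rewrite ltr0n.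
have C_ge0 : 0 <= C by apply: le_trans (gC 0%N).
have bnd M : `|\sum_(0 <= m < M) g m| <= M%:R * C.
  apply: le_trans (ler_norm_sum _ _ _) _; rewrite mulr_natl -[M in leRHS]subn0 -sumr_const_nat.
  by apply: ler_sum => m _.
have perq q m : g (m + q * n)%N = g m.
  by elim: q => [|q IHq]; rewrite ?mul0n ?addn0 // mulSn addnCA addnC g_per IHq.
have sum_q q M : \sum_(0 <= m < q * n + M) g m =
    q%:R * \sum_(0 <= m < n) g m + \sum_(0 <= m < M) g m.
  elim: q => [|q IHq]; first by rewrite mul0r add0r.
  rewrite mulSn -addnA (@big_cat_nat _ _ _ n) ?leq_addr //=.
  rewrite -[X in \sum_(X <= _ < _) _ + _]add0n -{2}[n]add0n big_addn addKn.
  under [X in _ + X]eq_bigr do rewrite g_per.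
  by rewrite IHq -natr1; ring.
set S := \sum_(0 <= m < n) g m.
have r_n : (N %% n < n)%N by rewrite ltn_mod.
have -> : \sum_(0 <= m < N) g m - N%:R / n%:R * S =
    \sum_(0 <= m < N %% n) g m - (N %% n)%:R / n%:R * S.
  rewrite {1 2}(divn_eq N n) sum_q natrD natrM -/S; field.
  by rewrite gt_eqF.
apply: le_trans (ler_normB _ _) _.
have -> : 2 * n%:R * C = n%:R * C + n%:R * C by ring.
apply: lerD.
  by apply: le_trans (bnd _) _; rewrite ler_wpM2r // ler_nat ltnW.
rewrite normrM ger0_norm ?divr_ge0 // mulrAC ler_pdivrMr // mulrC.
by apply: ler_pM; rewrite ?ler_nat ?(ltnW r_n) //; exact: bnd.
Qed.

Lemma sum_int_shift (V : nmodType) n (g : int -> V) (a : int) : int_periodic n g ->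
  \sum_(0 <= m < n) g (m%:Z + a) = \sum_(0 <= m < n) g m%:Z.
Proof.
have [->|n_gt0] := posnP n; first by rewrite !big_geq.
move=> g_per; pose b := `|(a %% n)%Z|%N.
have b_a : (n%:Z %| b%:Z - a)%Z.
  rewrite /b gez0_abs ?modz_ge0 ?eqz_nat -?lt0n //.
  by rewrite -eqz_mod_dvd modz_mod.
have -> : \sum_(0 <= m < n) g (m%:Z + a) = \sum_(0 <= m < n) g (b + m)%N%:Z.
  apply: eq_bigr => m _; apply: g_per.
  have -> : m%:Z + a - (b + m)%N%:Z = - (b%:Z - a) by rewrite PoszD; ring.
  by rewrite rpredN.
apply: (@sum_injective_mod _ n (fun m => b + m)%N (fun m => g m%:Z)).
  by move=> m; apply: g_per; rewrite -eqz_mod_dvd !modz_nat modn_mod.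
by move=> c d cn dn /eqP; rewrite eqn_modDl !modn_small // => /eqP.
Qed.

Lemma int_periodic_nat (T : Type) n (g : int -> T) m : int_periodic n g ->
  g (m + n)%N%:Z = g m%:Z.
Proof. by apply; rewrite PoszD addrAC subrr add0r. Qed.

Lemma int_periodic_dvd (T : Type) n n' (g : int -> T) : (n %| n')%N ->
  int_periodic n g -> int_periodic n' g.
Proof. by move=> nn' gn z z' zz'; apply: gn; apply: dvdz_trans zz'. Qed.

Lemma sum_period_dvd (g : nat -> R) n n' : (0 < n)%N -> (n %| n')%N ->
  (forall m, g (m + n)%N = g m) ->
  n%:R * \sum_(0 <= m < n') g m = n'%:R * \sum_(0 <= m < n) g m.
Proof.
move=> n_gt0 /dvdnP[q ->] g_per.
have perq m j : g (m + j * n)%N = g m.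
  by elim: j => [|j IHj]; rewrite ?mul0n ?addn0 // mulSn addnCA addnC g_per IHj.
suff -> : \sum_(0 <= m < q * n) g m = q%:R * \sum_(0 <= m < n) g m.
  by rewrite natrM; ring.
elim: q => [|q IHq]; first by rewrite big_geq // mul0r.
rewrite mulSn addnC (@big_cat_nat _ _ _ (q * n)) ?leq_addr //= IHq.
rewrite -[X in _ + \sum_(X <= _ < _) _]add0n big_addn addKn.
by under [X in _ + X]eq_bigr do rewrite perq; rewrite -natr1 mulrDl mul1r.
Qed.

End PeriodicAverages.

Lemma Posz_exp m k : (m ^ k)%N%:Z = m%:Z ^+ k.
Proof. by elim: k => // k IHk; rewrite expnS PoszM IHk exprS. Qed.

Lemma pow_int_periodic n k m : (n%:Z %| ((m + n) ^ k)%N%:Z - (m ^ k)%N%:Z)%Z.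
Proof.
rewrite !Posz_exp subrXX PoszD addrAC subrr add0r; exact: dvdz_mulr.
Qed.

(** In [scheme_fill], the term n_s^k keeps the level of m^k at most s for all m <= n_s, and the
    extra s puts every integer outside some A_s. The proportions 2^-(s+3) sum to 1/4, so that most
    m^k with m <= n_s reach level s; the bounds 2^-s make visits to translates of A_s rare. *)
Record scheme (R : realType) (k l : nat) (P : nat -> nat) (A : nat -> int -> bool)
    (n : nat -> nat) : Prop := Scheme {
  scheme_P_gt1 : forall s, (1 < P s)%N;
  scheme_n0 : n 0%N = 1%N;
  scheme_nS : forall s, n s.+1 = (n s * P s)%N;
  scheme_A : forall s, int_periodic (P s) (A s);
  scheme_fill : forall s z, (`|z| <= n s ^ k + s)%N -> A s z = false;
  scheme_k : forall s, \sum_(0 <= m < P s) (~~ A s (m ^ k)%N%:Z)%:R <=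
    (2 ^- s.+3 : R) * (P s)%:R;
  scheme_l : forall s (a : int), \sum_(0 <= m < P s) (A s ((m ^ l)%N%:Z + a))%:R <=
    (2 ^- s : R) * (P s)%:R }.

Section Scheme.
Variables (R : realType) (k l : nat) (P : nat -> nat) (A : nat -> int -> bool).
Variable n : nat -> nat.
Hypothesis S : scheme R k l P A n.

Let P_gt0 s : (0 < P s)%N. Proof. exact: ltnW (scheme_P_gt1 S s). Qed.

Lemma scheme_n_gt0 s : (0 < n s)%N.
Proof.
elim: s => [|s IHs]; first by rewrite (scheme_n0 S).
by rewrite (scheme_nS S) muln_gt0 IHs P_gt0.
Qed.

Lemma scheme_n_dvd s t : (s <= t)%N -> (n s %| n t)%N.
Proof.
elim: t => [|t IHt]; first by rewrite leqn0 => /eqP->.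
rewrite leq_eqVlt => /predU1P[->//|st].
by rewrite (scheme_nS S) dvdn_mulr // IHt.
Qed.

Lemma scheme_P_dvd s t : (s < t)%N -> (P s %| n t)%N.
Proof. by move=> /scheme_n_dvd; apply: dvdn_trans; rewrite (scheme_nS S) dvdn_mull. Qed.

Lemma scheme_n_ltn s : (s < n s)%N.
Proof.
elim: s => [|s IHs]; first by rewrite (scheme_n0 S).
rewrite (scheme_nS S) (leq_ltn_trans IHs) // ltn_Pmulr ?scheme_n_gt0 //.
exact: scheme_P_gt1 S s.
Qed.

Lemma fill_level_exists z : exists s, ~~ A s z.
Proof. by exists `|z|%N; rewrite (scheme_fill S) // leq_addl. Qed.

Definition fill_level z : nat := ex_minn (fill_level_exists z).

Lemma fill_levelP z : ~~ A (fill_level z) z /\ forall s, (s < fill_level z)%N -> A s z.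
Proof.
rewrite /fill_level; case: ex_minnP => s As smin; split=> // t ts.
by rewrite -[A t z]negbK; apply: contraTN ts => At; rewrite -leqNgt; exact: smin.
Qed.

Definition toeplitz_word : word := fun z => odd (fill_level z).
Local Notation x := toeplitz_word.

Lemma scheme_A_mod s t z z' : (s < t)%N -> ((n t)%:Z %| z - z')%Z -> A s z = A s z'.
Proof.
move=> st zz'; apply: (scheme_A S); apply: dvdz_trans zz'.
by rewrite dvdzE /= scheme_P_dvd.
Qed.

(** A_0, ..., A_s are all periodic modulo n_{s+1}, so for z outside A_s the residue modulo n_{s+1}
    determines the level. *)
Lemma fill_level_mod s z z' : ~~ A s z -> ((n s.+1)%:Z %| z - z')%Z ->
  fill_level z = fill_level z'.
Proof.
move=> As zz'; have [Az Amin] := fill_levelP z; have [Az' Amin'] := fill_levelP z'.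
have z_s : (fill_level z <= s)%N.
  by rewrite leqNgt; apply: contraNN As => /Amin.
have As' : ~~ A s z' by rewrite -(scheme_A_mod (ltnSn s) zz').
have z'_s : (fill_level z' <= s)%N.
  by rewrite leqNgt; apply: contraNN As' => /Amin'.
apply/eqP; rewrite eqn_leq; apply/andP; split; rewrite leqNgt; apply/negP.
  move/Amin; rewrite (scheme_A_mod _ zz') ?ltnS //; exact/negP.
move/Amin'; rewrite -(scheme_A_mod _ zz') ?ltnS //; exact/negP.
Qed.

Lemma word_mod s z z' : ~~ A s z -> ((n s.+1)%:Z %| z - z')%Z -> x z = x z'.
Proof. by move=> As zz'; rewrite /x (fill_level_mod As zz'). Qed.

Lemma filled_Per s z : ~~ A s z -> Per (n s.+1) x z.
Proof.
move=> As j; apply: (word_mod As).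
by rewrite opprD addrA subrr sub0r rpredN dvdz_mull.
Qed.

Lemma toeplitz_word_toeplitz : toeplitz x.
Proof.
move=> a; exists (n (fill_level a).+1); first exact: scheme_n_gt0.
by apply: filled_Per; exact: (fill_levelP a).1.
Qed.

Lemma Per_dvd m m' (y : word) : (m %| m')%N -> Per m y `<=` Per m' y.
Proof.
by move=> /dvdnP[q ->] a Pa j; rewrite PoszM mulrA; exact: Pa.
Qed.

Lemma bigcup_Per M : \bigcup_(t in `I_M.+1) Per (n t) x = Per (n M) x.
Proof.
apply/seteqP; split=> [a [t tM Pa]|a Pa]; last by exists M => //=.
by apply: (Per_dvd _ Pa); apply: scheme_n_dvd.
Qed.

(** [scheme_l] is averaged over all shifts a in a period: for each m the number m^l + a then runs
    through all residues. *)
Lemma density_A s : \sum_(0 <= m < P s) (A s m%:Z)%:R <= (2 ^- s : R) * (P s)%:R.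
Proof.
have PR : 0 < (P s)%:R :> R by rewrite ltr0n.
rewrite -(ler_pM2r PR).
have -> : (\sum_(0 <= m < P s) (A s m%:Z)%:R) * (P s)%:R =
   \sum_(0 <= a < P s) \sum_(0 <= m < P s) (A s ((m ^ l)%N%:Z + a%:Z))%:R :> R.
  rewrite exchange_big_nat /=.
  have inner m : \sum_(0 <= a < P s) (A s ((m ^ l)%N%:Z + a%:Z))%:R =
      \sum_(0 <= a < P s) (A s a%:Z)%:R :> R.
    under eq_bigr do rewrite addrC.
    apply: (sum_int_shift (g := fun z => (A s z)%:R)) => z z' zz'.
    by rewrite (scheme_A S zz').
  rewrite [RHS](eq_bigr _ (fun m _ => inner m)).
  by rewrite sumr_const_nat subn0 mulr_natr.
rewrite [leRHS]mulr_natr -[X in _ *+ X]subn0 -sumr_const_nat.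
by apply: ler_sum => a _; exact: (scheme_l S).
Qed.

Lemma periodic_has_density (B : set int) N : (0 < N)%N ->
  int_periodic N (fun z => \1_B z : R) ->
  has_density B (N%:R^-1 * \sum_(0 <= m < N) \1_B m%:Z : R).
Proof.
move=> N_gt0 B_per; have NR : 0 < N%:R :> R by rewrite ltr0n.
set c := _ * _; apply/cvgrPdist_le => e e_gt0.
near=> M; have MR : 0 < M.*2.+1%:R :> R by rewrite ltr0n.
rewrite -(ler_pM2r MR) -{2}(gtr0_norm MR) -normrM mulrBl divfK ?gt_eqF //.
rewrite distrC /c.
have := @periodic_sum_approx R (fun i => \1_B (i%:Z - M%:Z)) N 1 M.*2.+1 N_gt0.
rewrite (sum_int_shift (- M%:Z) B_per).
have -> : M.*2.+1%:R / N%:R * (\sum_(0 <= m < N) \1_B m%:Z) =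
   N%:R^-1 * (\sum_(0 <= m < N) \1_B m%:Z) * M.*2.+1%:R :> R by ring.
move=> /(_ _ _)/le_trans; apply.
- move=> m; apply: B_per.
  have -> : (m + N)%N%:Z - M%:Z - (m%:Z - M%:Z) = N%:Z by rewrite PoszD; ring.
  by [].
- by move=> m; rewrite indicE; case: (_ \in _); rewrite ?normr1 ?normr0.
rewrite mulr1 -ler_pdivrMl //; near: M.
exists (Num.truncn (e^-1 * (2 * N%:R))).+1 => // M /= NM.
have pos : 0 <= e^-1 * (2 * N%:R) by rewrite !mulr_ge0 ?invr_ge0 ?ltW.
have /andP[_ /ltW /le_trans] := truncn_itv pos; apply; rewrite ler_nat.
by rewrite (leq_trans NM) // -addnn; lia.
Unshelve. all: by end_near. Qed.

(** Integers outside A_s belong to Per(n_{s+1}), whose density is thus at least 1 - 2^-s; by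
    divisibility, the unions in the definition are the single sets Per(n_M). *)
Lemma toeplitz_word_regular : toeplitz_regular R x.
Proof.
exists n; split.
- exact: scheme_n_gt0.
- by move=> t; apply: scheme_n_dvd.
- apply/seteqP; split=> // a _; exists (fill_level a).+1 => //.
  by apply: filled_Per; exact: (fill_levelP a).1.
have Per_per M : int_periodic (n M) (fun z => \1_(Per (n M) x) z : R).
  have inc z z' : ((n M)%:Z %| z - z')%Z -> Per (n M) x z -> Per (n M) x z'.
    move=> /dvdzP[q zz'] Pz j.
    have -> : z' = z + (- q) * (n M)%:Z by rewrite mulNr -zz'; ring.
    rewrite -(Pz (- q)) -addrA -mulrDl; exact: Pz.
  move=> z z' zz'; rewrite !indicE; congr (nat_of_bool _)%:R.
  apply/idP/idP => /set_mem Pz; apply/mem_set; first exact: inc zz' Pz.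
  by apply: inc Pz; rewrite -opprB rpredN.
pose d M : R := (n M)%:R^-1 * \sum_(0 <= m < n M) \1_(Per (n M) x) m%:Z.
exists d; split=> [M|].
  by rewrite bigcup_Per; apply: periodic_has_density; [exact: scheme_n_gt0|exact: Per_per].
rewrite -cvg_shiftS /=.
have low s : 1 - 2 ^- s <= d s.+1 <= 1.
  have nR : 0 < (n s.+1)%:R :> R by rewrite ltr0n scheme_n_gt0.
  apply/andP; split; rewrite /d; last first.
    rewrite ler_pdivrMl // mulr1 -[leRHS]/((n s.+1)%:R *+ 1) -[in leRHS](subn0 (n s.+1)).
    rewrite -[leRHS]sumr_const_nat; apply: ler_sum => m _.
    by rewrite indicE lern1 leq_b1.
  rewrite ler_pdivlMl // mulrBr mulr1 lerBlDl -lerBlDr.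
  apply: (@le_trans _ _ (\sum_(0 <= m < n s.+1) (A s m%:Z)%:R)).
    rewrite -[n s.+1 in X in X - _](subn0 (n s.+1)) -sumr_const_nat -sumrB.
    apply: ler_sum => m _; rewrite indicE; have [Am|Am] := boolP (A s m%:Z).
      by rewrite lerBlDr lerDl.
    by rewrite mem_set ?subrr //; exact: filled_Per.
  have PR : 0 < (P s)%:R :> R by rewrite ltr0n.
  rewrite -(ler_pM2l PR) (@sum_period_dvd R (fun m => (A s m%:Z)%:R) (P s)) //.
  - by rewrite mulrCA ler_wpM2l ?ler0n // mulrC density_A.
  - exact: scheme_P_dvd.
  by move=> m; rewrite (int_periodic_nat m (@scheme_A _ _ _ _ _ _ S s)).
apply: (@squeeze_cvgr _ _ _ _ (fun s => 1 - 2 ^- s) (fun=> 1)).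
- by apply: nearW => s; exact: low.
- rewrite -[X in _ --> X]subr0; apply: cvgB; first exact: cvg_cst.
  have -> : (fun s => 2 ^- s) = (fun s => (2^-1 : R) ^+ s) by apply/funext => s; rewrite exprVn.
  by apply: cvg_expr; rewrite ger0_norm // invf_lt1 // ltr1n.
exact: cvg_cst.
Qed.

End Scheme.

(** * Averages along the word *)

Section Averages.
Variables (R : realType) (k l : nat) (P : nat -> nat) (A : nat -> int -> bool).
Variable n : nat -> nat.
Hypothesis S : scheme R k l P A n.
Local Notation x := (toeplitz_word S).
Local Notation X := (orbit_closure x).

Lemma cvg_of_approx (u : nat -> R) :
  (forall e, 0 < e -> exists c, exists N0, forall N, (N0 <= N)%N -> `|u N - c| <= e) ->
  cvg (u @ \oo).
Proof.
move=> approx; apply: cauchy_cvg; apply: cauchy_exP => e e_gt0.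
have [|c [N0 hN]] := approx (e / 2); first by rewrite divr_gt0.
exists c; exists N0 => // N /= NN; rewrite /ball /= distrC.
by apply: le_lt_trans (hN N NN) _; rewrite ltr_pdivrMr // ltr_pMr // ltr1n.
Qed.

(** Off A_s, the translate of x by b depends only on b modulo n_{s+1}. If each of these finitely
    many residues failed at some position, a translate of x agreeing with y on a window containing
    all these positions would give a contradiction. *)
Lemma skeleton y s : X y ->
  exists b : int, forall i, ~~ A s (i + b) -> y i = x (i + b).
Proof.
move=> /orbit_closureP Xy; apply: contrapT => no_b.
have /choice[i_ iP] (b : nat) : exists i : int, ~~ A s (i + b%:Z) /\ y i <> x (i + b%:Z).
  apply: contrapT => no_i; apply: no_b; exists b%:Z => i Ai.
  by apply: contrapT => yi; apply: no_i; exists i.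
pose N := n s.+1; have N_gt0 : (0 < N)%N by exact: scheme_n_gt0 S _.
pose W := (\max_(b < N) `|i_ b|)%N.
have [m ym] := Xy W; pose b := `|(m %% N)%Z|%N.
have bm : (N%:Z %| m - b%:Z)%Z.
  rewrite /b gez0_abs ?modz_ge0 ?eqz_nat -?lt0n //.
  by rewrite -eqz_mod_dvd modz_mod.
have bN : (b < N)%N.
  by rewrite -ltz_nat /b gez0_abs ?modz_ge0 ?ltz_pmod ?eqz_nat -?lt0n.
have [Ai yi] := iP b; apply: yi; rewrite ym; last first.
  by rewrite /W (bigD1 (Ordinal bN)) //= leq_maxl.
rewrite /shiftz; apply/esym; apply: (word_mod S Ai).
have -> : i_ b + b%:Z - (i_ b + m) = - (m - b%:Z) by ring.
by rewrite rpredN.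
Qed.

(** What m^l and m itself have in common, so that averages along both can be compared: compatibility
    with all moduli, and rare visits to the translates of each A_s. *)
Definition admissible (a : nat -> int) : Prop :=
  (forall N m, (N%:Z %| a (m + N)%N - a m)%Z) /\
  (forall s (c : int), \sum_(0 <= m < P s) (A s (a m + c))%:R <= (2 ^- s : R) * (P s)%:R).

Lemma admissible_period a T N (g : int -> T) c : admissible a -> int_periodic N g ->
  forall m, g (a (m + N)%N + c) = g (a m + c).
Proof.
by move=> [aP _] gP m; apply: gP; rewrite opprD addrACA subrr addr0.
Qed.

Lemma sum_shift1 (g : nat -> R) N : (forall m, g (m + N)%N = g m) ->
  \sum_(0 <= m < N) g m.+1 = \sum_(0 <= m < N) g m.
Proof.
case: N => [|N] gN; first by rewrite !big_geq.
by rewrite big_nat_recr //= [RHS]big_nat_recl //= -(gN 0%N) add0n addrC.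
Qed.

Definition real_average (f : word -> R) (a : nat -> int) (y : word) (N : nat) : R :=
  N%:R^-1 * \sum_(1 <= m < N.+1) f (shiftz (a m) y).

(** s and Psi depend only on f and e; y enters through the phase b, which is chosen before a. This
    uniformity gives convergence and, for equidistributing a, a limit independent of y and a. The
    value of f at the shift of y by a_m is close to Psi(a_m + b) unless A_s meets the window of
    radius W about a_m + b. *)
Lemma average_approx (f : word -> R) (e : R) : {within X, continuous f} -> 0 < e ->
  exists s (Psi : int -> R), int_periodic (n s) Psi /\
    forall y, X y -> exists b : int, forall a, admissible a ->
      exists N0, forall M, (N0 <= M)%N ->
        `|real_average f a y M - (n s)%:R^-1 * \sum_(0 <= m < n s) Psi (a m + b)| <= e.
Proof.
move=> cf e_gt0; have cX := @orbit_closure_compact x.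
have [C C_ge0 fC] := within_continuous_bounded cX cf.
have [|W hW] := within_continuous_uniform (e := e / 4) cX cf; first by rewrite divr_gt0.
(* K 2^-s bounds the average cost of the bad m: each costs at most 2 C, and each of the 2 W + 1
   window positions lies in A_s with frequency at most 2^-s. *)
pose K := 2 * C * W.*2.+1%:R; have K_ge0 : 0 <= K by rewrite !mulr_ge0.
have e4 : 0 < e / 4 by rewrite divr_gt0.
have [s hs] : exists s : nat, K * 2 ^- s <= e / 4.
  have Ke_ge0 : 0 <= K / (e / 4) by rewrite divr_ge0 // ltW.
  have /andP[_] := truncn_itv Ke_ge0; set s := (Num.truncn _).+1 => lt_s; exists s; move: lt_s.
  rewrite ltr_pdivrMr ?divr_gt0 // => lt_K; rewrite ler_pdivrMr ?exprn_gt0 //.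
  apply: le_trans (ltW lt_K) _; rewrite mulrC ler_wpM2l ?divr_ge0 ?ltW //.
  by rewrite -natrX ltr_nat ltn_expl.
set N := n s.+1; have N_gt0 : (0 < N)%N by exact: scheme_n_gt0 S _.
have NR : 0 < N%:R :> R by rewrite ltr0n.
have P_gt0 : (0 < P s)%N by exact: ltnW (scheme_P_gt1 S s).
(* Psi samples f on the orbit of x itself, at residues modulo N, so it is periodic and inherits the
   bound C. *)
pose Psi (z : int) := f (shiftz (z %% N)%Z x).
have Psi_per : int_periodic N Psi.
  by move=> z z'; rewrite -eqz_mod_dvd /Psi => /eqP ->.
have PsiC z : `|Psi z| <= C by apply: fC; exact: orbit_closure_shift.
pose bad z : R := \sum_(0 <= j < W.*2.+1) (A s (z + (j%:Z - W%:Z)))%:R.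
have bad_ge0 z : 0 <= bad z by exact: sumr_ge0.
exists s.+1, Psi; split=> // y Xy; have [b yb] := skeleton s Xy; exists b => a aP.
have pointwise m : `|f (shiftz (a m) y) - Psi (a m + b)| <= e / 4 + 2 * C * bad (a m + b).
  have Xam : X (shiftz (a m) y) by exact: shiftz_orbit_closure.
  have [good|/existsNP[i /not_implyP[iW /negP]]] :=
      pselect (forall i : int, (`|i| <= W)%N -> ~~ A s (i + (a m + b))).
    apply: (@le_trans _ _ (e / 4)); last by rewrite lerDl !mulr_ge0.
    apply: ltW; apply: hW => //; first exact: orbit_closure_shift.
    move=> i iW; rewrite /shiftz yb -?addrA ?good //.
    apply: (word_mod S (good i iW)); rewrite -/N -eqz_mod_dvd.
    by rewrite modzDmr.
  rewrite negbK => Ai.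
  have bad_ge1 : 1 <= bad (a m + b).
    pose j := absz (i + W%:Z); have jW : j%:Z - W%:Z = i by rewrite /j; lia.
    have jP : (j < W.*2.+1)%N by rewrite /j -addnn; lia.
    rewrite /bad (bigD1_seq j) ?mem_index_iota ?iota_uniq //=.
    rewrite jW (addrC _ i).
    by rewrite Ai lerDl sumr_ge0.
  apply: (@le_trans _ _ (2 * C)).
    apply: le_trans (ler_normB _ _) _; have := fC _ Xam; have := PsiC (a m + b); lra.
  rewrite -[leLHS]add0r; apply: lerD; first by rewrite divr_ge0 // ltW.
  by rewrite ler_peMr // mulr_ge0.
have sum_bad M : \sum_(1 <= m < M.+1) bad (a m + b) <=
    W.*2.+1%:R * (M%:R * 2 ^- s + 2 * (P s)%:R).
  rewrite /bad exchange_big_nat /= mulr_natl -[X in _ *+ X]subn0 -sumr_const_nat.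
  apply: ler_sum => j _; rewrite big_add1 /=.
  pose g m : R := (A s (a m + b + (j%:Z - W%:Z)))%:R.
  have g_per m : g (m + P s)%N = g m.
    rewrite /g -!addrA; congr (nat_of_bool _)%:R.
    exact: admissible_period aP (@scheme_A _ _ _ _ _ _ S s) m.
  have := @periodic_sum_approx R (fun m => g m.+1) (P s) 1 M P_gt0.
  rewrite (sum_shift1 g_per) => /(_ _ _)/ler_normlP[].
  - by move=> m; rewrite -addSn g_per.
  - by move=> m; rewrite /g; case: (A _ _); rewrite ?normr1 ?normr0.
  move=> _; rewrite mulr1 lerBlDr => /le_trans; apply; rewrite addrC lerD2r.
  rewrite -mulrA ler_wpM2l // ler_pdivrMl ?ltr0n // mulrC.
  have := aP.2 s (b + (j%:Z - W%:Z)); rewrite /g.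
  by under eq_bigr do rewrite addrA.
have sum_Psi M : `|\sum_(1 <= m < M.+1) Psi (a m + b) -
     M%:R / N%:R * \sum_(0 <= m < N) Psi (a m + b)| <= 2 * N%:R * C.
  have g_per m : Psi (a (m + N)%N + b) = Psi (a m + b) by exact: admissible_period.
  rewrite big_add1 /= -(@sum_shift1 (fun m => Psi (a m + b))) //.
  by apply: periodic_sum_approx => // m; rewrite -addSn g_per.
pose K2 := K * (2 * (P s)%:R) + 2 * N%:R * C.
have K2_ge0 : 0 <= K2 by rewrite addr_ge0 ?mulr_ge0.
exists (Num.truncn (K2 / (e / 4))).+1 => M hM.
have M_gt0 : (0 < M)%N by apply: leq_ltn_trans hM.
have MR : 0 < M%:R :> R by rewrite ltr0n.
have K2M : K2 <= M%:R * (e / 4).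
  rewrite -ler_pdivrMr ?divr_gt0 //.
  have Ke_ge0 : 0 <= K2 / (e / 4) by rewrite divr_ge0 // ltW.
  by have /andP[_ /ltW /le_trans] := truncn_itv Ke_ge0; apply; rewrite ler_nat.
rewrite -(ler_pM2l MR) -{1}(gtr0_norm MR) -normrM mulrBr /real_average mulVKf ?gt_eqF //.
set T := \sum_(0 <= m < N) Psi (a m + b).
have -> : \sum_(1 <= m < M.+1) f (shiftz (a m) y) - M%:R * (N%:R^-1 * T) =
   \sum_(1 <= m < M.+1) (f (shiftz (a m) y) - Psi (a m + b)) +
   (\sum_(1 <= m < M.+1) Psi (a m + b) - M%:R / N%:R * T).
  by rewrite sumrB; ring.
apply: le_trans (ler_normD _ _) _.
have step1 : `|\sum_(1 <= m < M.+1) (f (shiftz (a m) y) - Psi (a m + b))| <=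
    M%:R * (e / 4) + 2 * C * (W.*2.+1%:R * (M%:R * 2 ^- s + 2 * (P s)%:R)).
  apply: le_trans (ler_norm_sum _ _ _) _.
  apply: (@le_trans _ _ (\sum_(1 <= m < M.+1) (e / 4 + 2 * C * bad (a m + b)))).
    by apply: ler_sum => m _.
  rewrite big_split /= sumr_const_nat subSS subn0 -[_ *+ M]mulr_natl lerD2l.
  by rewrite -big_distrr /= ler_wpM2l ?mulr_ge0.
have step2 := sum_Psi M.
have step3 : M%:R * (K * 2 ^- s) <= M%:R * (e / 4) by rewrite ler_wpM2l.
have Me : 0 <= M%:R * e by rewrite mulr_ge0 // ltW.
move: step1 step2 step3 K2M Me; rewrite /K2 /K -/T; lra.
Qed.

Lemma real_average_cvg (f : word -> R) a y : {within X, continuous f} -> X y ->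
  admissible a -> cvg (real_average f a y @ \oo).
Proof.
move=> cf Xy aP; apply: cvg_of_approx => e e_gt0.
have [s [Psi [_ H]]] := average_approx cf e_gt0.
have [b /(_ a aP)[N0 hN]] := H y Xy.
by exists ((n s)%:R^-1 * \sum_(0 <= m < n s) Psi (a m + b)), N0.
Qed.

(** Injectivity on residues; by finiteness, a_m runs once through every class modulo each n_s. *)
Definition equidistributing (a : nat -> int) : Prop :=
  forall s m m', (m < n s)%N -> (m' < n s)%N -> ((n s)%:Z %| a m - a m')%Z -> m = m'.

Lemma sum_equidistributing (g : int -> R) a b s : int_periodic (n s) g ->
  equidistributing a -> \sum_(0 <= m < n s) g (a m + b) = \sum_(0 <= m < n s) g m%:Z.
Proof.
move=> gP aE; have N_gt0 := scheme_n_gt0 S s; set N := n s in gP N_gt0 *.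
pose r (z : int) := `|(z %% N)%Z|%N.
have rP z : (r z)%:Z = (z %% N)%Z.
  by rewrite /r gez0_abs ?modz_ge0 ?eqz_nat -?lt0n.
have g_r z : g z = g (r z)%:Z.
  by apply: gP; rewrite rP -eqz_mod_dvd modz_mod.
under eq_bigr do rewrite g_r.
apply: (@sum_injective_mod _ N (fun m => r (a m + b)) (fun m => g m%:Z)).
  by move=> m; apply: gP; rewrite -eqz_mod_dvd !modz_nat modn_mod.
move=> m m' mN m'N /eqP; rewrite -eqz_nat -!modz_nat !rP !modz_mod eqz_mod_dvd.
have -> : a m + b - (a m' + b) = a m - a m' by ring.
exact: aE.
Qed.

(** For an equidistributing sequence the mean of Psi over a period depends neither on the phase nor
    on the sequence. A reference pair (a0, y0) fixes L, and all other averages share its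
    approximations. *)
Lemma real_average_limit (f : word -> R) : {within X, continuous f} ->
  exists L, forall a y, X y -> admissible a -> equidistributing a ->
    real_average f a y @ \oo --> (L : R).
Proof.
move=> cf; have [[a0 [y0 [Xy0 a0P a0E]]]|no_a] := pselect (exists a y, [/\ X y, admissible a &
    equidistributing a]); last first.
  (* Without any such sequence the claim is vacuous, and 0 is an arbitrary value. *)
  by exists 0 => a y Xy aP aE; case: no_a; exists a, y.
have /cvg_ex[/= L uL] := real_average_cvg cf Xy0 a0P; exists L => a y Xy aP aE.
apply/cvgrPdist_le => e e_gt0; have e4 : 0 < e / 4 by rewrite divr_gt0.
have [s [Psi [Psi_per H]]] := average_approx cf e4.
have [b /(_ a aP)[N1 h1]] := H y Xy; have [b0 /(_ a0 a0P)[N0 h0]] := H y0 Xy0.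
move/cvgrPdist_le: uL => /(_ _ e4)[N2 _ h2].
exists (maxn N2 (maxn N0 N1)) => // M /=; rewrite !geq_max => /and3P[hM2 hM0 hM1].
have := h1 M hM1; have := h0 M hM0; have := h2 M hM2.
rewrite (sum_equidistributing b Psi_per aE) (sum_equidistributing b0 Psi_per a0E).
set c := (n s)%:R^-1 * _; set u := real_average f a y M; set u0 := real_average f a0 y0 M.
move=> b2 b1 b0'; have -> : L - u = (L - u0) + ((u0 - c) - (u - c)) by ring.
apply: le_trans (ler_normD _ _) _.
have := ler_normB (u0 - c) (u - c); move: b2 b1 b0'; rewrite /=; lra.
Qed.

Lemma fill_level_pow s m : (m <= n s)%N -> (forall j, (j < s)%N -> A j (m ^ k)%N%:Z) ->
  fill_level S (m ^ k)%N%:Z = s.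
Proof.
move=> mn Aj; have [Af Amin] := fill_levelP S (m ^ k)%N%:Z.
apply/eqP; rewrite eqn_leq; apply/andP; split; rewrite leqNgt; apply/negP.
  move/Amin; rewrite (scheme_fill S) //= (leq_trans _ (leq_addr _ _)) //.
  by case: (k) => // k'; rewrite leq_exp2r.
by move=> /Aj; exact/negP.
Qed.

(** At level s the sign is exactly (-1)^s; a failure at some j < s costs at most 2 and has frequency
    at most 2^-(j+3). As P_j divides n_s, the first n_s terms form whole periods without boundary
    error, and the costs sum to less than 1/2. *)
Lemma sign_average s :
  `|(n s)%:R^-1 * (\sum_(1 <= m < (n s).+1) (-1) ^+ x (m ^ k)%N%:Z) - (-1) ^+ odd s| <=
    2^-1 :> R.
Proof.
set N := n s; have N_gt0 : (0 < N)%N by exact: scheme_n_gt0 S _.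
have NR : 0 < N%:R :> R by rewrite ltr0n.
rewrite -(ler_pM2l NR) -{1}(gtr0_norm NR) -normrM mulrBr mulVKf ?gt_eqF //.
have -> : N%:R * (-1) ^+ odd s = \sum_(1 <= m < N.+1) (-1) ^+ odd s :> R.
  by rewrite sumr_const_nat subSS subn0 mulr_natl.
rewrite -sumrB; apply: le_trans (ler_norm_sum _ _ _) _.
apply: (@le_trans _ _ (\sum_(1 <= m < N.+1) \sum_(0 <= j < s)
    2 * (~~ A j (m ^ k)%N%:Z)%:R)).
  apply: ler_sum_nat => m /andP[_ mN].
  have [Aj|/existsNP[j /not_implyP[js /negP Aj]]] :=
      pselect (forall j, (j < s)%N -> A j (m ^ k)%N%:Z).
    rewrite /toeplitz_word (fill_level_pow (s := s)) // subrr normr0.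
    by apply: sumr_ge0 => j _; rewrite mulr_ge0.
  apply: (@le_trans _ _ 2).
    by apply: le_trans (ler_normB _ _) _; rewrite !normrX normrN1 !expr1n.
  rewrite (bigD1_seq j) ?mem_index_iota ?iota_uniq //= Aj mulr1 lerDl.
  by apply: sumr_ge0 => i _; rewrite mulr_ge0.
rewrite exchange_big_nat /=.
apply: (@le_trans _ _ (\sum_(0 <= j < s) N%:R * (2 * 2 ^- j.+3))).
  apply: ler_sum_nat => j /andP[_ js]; rewrite -big_distrr /= mulrCA ler_wpM2l //.
  rewrite big_add1 /=; pose g m : R := (~~ A j (m ^ k)%N%:Z)%:R.
  have g_per N' : (P j %| N')%N -> forall m, g (m + N')%N = g m.
    move=> PN m; have Aj := int_periodic_dvd PN (@scheme_A _ _ _ _ _ _ S j).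
    by rewrite /g (Aj _ _ (pow_int_periodic N' k m)).
  have PjN : (P j %| N)%N by exact: scheme_P_dvd S _ _ js.
  have Pj : 0 < (P j)%:R :> R by rewrite ltr0n ltnW // (scheme_P_gt1 S).
  rewrite -[leLHS]/(\sum_(0 <= m < N) g m.+1) (sum_shift1 (g_per N PjN)).
  rewrite -(ler_pM2l Pj) (sum_period_dvd _ PjN (g_per _ (dvdnn _))); last first.
    by rewrite ltnW // (scheme_P_gt1 S).
  by rewrite mulrCA ler_wpM2l // mulrC (scheme_k S).
rewrite -big_distrr /= ler_wpM2l //.
suff : \sum_(0 <= j < s) 2 * 2 ^- j.+3 <= 2^-1 - 2 * 2 ^- s.+2 :> R.
  move=> /le_trans; apply; rewrite lerBlDr lerDl mulr_ge0 // invr_ge0 exprn_ge0 //.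
elim: (s) => [|t IHt]; first by rewrite big_geq // expr2; lra.
rewrite big_nat_recr //= (exprS 2 t.+2); move: IHt.
have -> : (2 * 2 ^+ t.+2)^-1 = 2^-1 * 2 ^- t.+2 :> R by rewrite invfM.
lra.
Qed.

End Averages.

Section ComplexLimits.
Variable R : realType.
Local Open Scope complex_scope.

Lemma cvg_Re_Im (T : Type) (G : set_system T) {FG : Filter G} (F : T -> R[i]^o) (c : R[i]^o) :
  F @ G --> c <->
  ((@complex.Re R) \o F) @ G --> complex.Re c /\ ((@complex.Im R) \o F) @ G --> complex.Im c.
Proof.
split=> [/cvgrPdist_lt Fc|[/cvgrPdist_lt rec /cvgrPdist_lt imc]].
  have norm_lt e t : `|c - F t| < e%:C -> ComplexField.Normc.normc (c - F t) < e.
    by rewrite normc_def ltcR; case: (c - F t).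
  split; apply/cvgrPdist_lt => e e_gt0.
    have /Fc : 0 < e%:C :> R[i] by rewrite ltcR.
    apply: filterS => t /norm_lt; apply: le_lt_trans.
    by rewrite -raddfB normr_Re_le.
  have /Fc : 0 < e%:C :> R[i] by rewrite ltcR.
  apply: filterS => t /norm_lt; apply: le_lt_trans.
  by rewrite -raddfB normr_Im_le.
apply/cvgrPdist_lt => -[e e'] /=; rewrite ltcE /= => /andP[/eqP-> e_gt0].
have e2 : 0 < e / 2 by rewrite divr_gt0.
apply: filterS2 (rec _ e2) (imc _ e2) => t; rewrite /= -!raddfB => ret imt.
have normcE (z : R[i]) : `|z| = (ComplexField.Normc.normc z)%:C.
  by rewrite normc_def; case: z.
rewrite normcE -[e +i* 0]/(e%:C) ltcR; apply: le_lt_trans (normc_le_ReIm _) _.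
by rewrite [e]splitr ltrD.
Qed.

Lemma Re_Im_average (F : word -> R[i]^o) a y N :
  complex.Re (average F a y N) = real_average ((@complex.Re R) \o F) a y N /\
  complex.Im (average F a y N) = real_average ((@complex.Im R) \o F) a y N.
Proof.
rewrite /average /real_average -(Re_sum _ _ (fun m => F (shiftz (a m) y))).
rewrite -(Im_sum _ _ (fun m => F (shiftz (a m) y))).
have -> : N%:R^-1 = (N%:R^-1)%:C :> R[i] by rewrite fmorphV /= rmorph_nat.
by case: (\sum_(_ <= _ < _) _) => u v /=; rewrite !mul0r subr0 addr0.
Qed.

Lemma average_cvgP (F : word -> R[i]^o) a y (c : R[i]^o) :
  average F a y @ \oo --> c <->
  real_average ((@complex.Re R) \o F) a y @ \oo --> complex.Re c /\
  real_average ((@complex.Im R) \o F) a y @ \oo --> complex.Im c.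
Proof.
rewrite cvg_Re_Im; have -> : (@complex.Re R) \o average F a y = real_average ((@complex.Re R) \o F) a y.
  by apply/funext => N; rewrite /= (Re_Im_average F a y N).1.
have -> // : (@complex.Im R) \o average F a y = real_average ((@complex.Im R) \o F) a y.
by apply/funext => N; rewrite /= (Re_Im_average F a y N).2.
Qed.

Lemma within_continuous_Re_Im (X : set word) (F : word -> R[i]^o) :
  {within X, continuous F} ->
  {within X, continuous ((@complex.Re R) \o F)} /\ {within X, continuous ((@complex.Im R) \o F)}.
Proof.
move=> /subspace_continuousP cF.
by split; apply/subspace_continuousP => y Xy; have /cvg_Re_Im[] := cF y Xy.
Qed.

End ComplexLimits.

Section SchemeAverages.
Variables (R : realType) (k l : nat) (P : nat -> nat) (A : nat -> int -> bool).
Variable n : nat -> nat.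
Hypothesis S : scheme R k l P A n.
Local Notation x := (toeplitz_word S).
Local Notation X := (orbit_closure x).

Lemma pow_admissible : admissible R P A (fun m => (m ^ l)%N%:Z).
Proof.
by split=> [N m|s c]; [exact: pow_int_periodic|exact: scheme_l S s c].
Qed.

Lemma Posz_admissible : admissible R P A Posz.
Proof.
split=> [N m|s c]; first by rewrite PoszD addrAC subrr add0r.
rewrite (sum_int_shift (g := fun z => (A s z)%:R : R)); first exact: density_A S s.
by move=> z z' zz'; rewrite (scheme_A S zz').
Qed.

Lemma Posz_equidistributing : equidistributing n Posz.
Proof.
move=> s m m' mn m'n; rewrite -eqz_mod_dvd !modz_nat eqz_nat.
by rewrite !modn_small // => /eqP.
Qed.

Lemma average_pow_cvg (F : word -> R[i]^o) y : {within X, continuous F} -> X y ->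
  cvg (average F (fun m => (m ^ l)%N%:Z) y @ \oo).
Proof.
move=> /within_continuous_Re_Im[cre cim] Xy.
have /cvg_ex[u hu] := real_average_cvg cre Xy pow_admissible.
have /cvg_ex[v hv] := real_average_cvg cim Xy pow_admissible.
by apply/cvg_ex; exists (Complex u v); apply/average_cvgP.
Qed.

(** The real part of a limit would lie within 1/4 + 1/2 < 1 of both 1 and -1. *)
Lemma sign_average_not_cvg :
  ~ cvg (average (@sign0 R) (fun m => (m ^ k)%N%:Z) x @ \oo).
Proof.
move=> /cvg_ex[c /average_cvgP[+ _]]; set c' := complex.Re c.
have e4 : 0 < 4^-1 :> R by rewrite invr_gt0.
move=> /cvgrPdist_lt /(_ _ e4)[N _ hN].
have near_c s : (N <= s)%N -> `|c' - (-1) ^+ odd s| < 4^-1 + 2^-1.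
  move=> Ns; have Nns : (N <= n s)%N by rewrite (leq_trans Ns) // ltnW // (scheme_n_ltn S).
  have := hN _ Nns; have := sign_average S s; rewrite /real_average.
  have -> : \sum_(1 <= m < (n s).+1) ((@complex.Re R) \o @sign0 R)
      (shiftz (m ^ k)%N%:Z x) = \sum_(1 <= m < (n s).+1) (-1) ^+ x (m ^ k)%N%:Z.
    apply: eq_bigr => m _; rewrite /sign0 /shiftz /= add0r.
    by case: (x _); rewrite ?expr1 ?expr0.
  set u := _ * _ => h1 h2.
  have -> : c' - (-1) ^+ odd s = (c' - u) + (u - (-1) ^+ odd s) by ring.
  apply: le_lt_trans (ler_normD _ _) _; lra.
have := near_c N (leqnn _); have := near_c N.+1 (leqnSn _).
rewrite /=; case: (odd N) => /=; rewrite expr0 expr1 !ltr_norml; lra.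
Qed.

End SchemeAverages.

(** * Construction of schemes *)

Definition power_injective (l N : nat) : Prop := forall m m' : nat,
  (N%:Z %| (m ^ l)%N%:Z - (m' ^ l)%N%:Z)%Z -> (N%:Z %| m%:Z - m'%:Z)%Z.

Lemma power_injective1 l : power_injective l 1.
Proof. by move=> m m' _; rewrite dvd1z. Qed.

Lemma power_injectiveM l N P : coprime N P -> power_injective l N -> power_injective l P ->
  power_injective l (N * P).
Proof.
move=> NP injN injP m m'; rewrite PoszM !Gauss_dvdz //.
by case/andP=> /injN -> /injP ->.
Qed.

Lemma power_injective_prime l p : (0 < l)%N -> prime p -> coprime l p.-1 ->
  power_injective l p.
Proof.
move=> l_gt0 p_pr co m m'; rewrite -!eqz_mod_dvd !modz_nat !eqz_nat.
rewrite -!natr_Fp_eq // !natrX => /eqP; rewrite /= => mm'; apply/eqP.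
exact: Fp_inj_pow mm'.
Qed.

Lemma power_injective_prod l (ps : seq nat) : uniq ps ->
  {in ps, forall p, prime p /\ power_injective l p} ->
  power_injective l (\prod_(p <- ps) p).
Proof.
elim: ps => [|p ps IHps] /=; first by rewrite big_nil => _ _; exact: power_injective1.
move=> /andP[p_ps ps_uniq] psP; rewrite big_cons; have [p_pr p_inj] := psP p (mem_head _ _).
apply: power_injectiveM => //; last first.
  by apply: IHps => // q qps; apply: psP; rewrite inE qps orbT.
rewrite big_seq; apply: (big_ind (fun N => coprime p N)); first exact: coprimen1.
  by move=> a b pa pb; rewrite coprimeMr pa.
move=> q qps; have [q_pr _] : prime q /\ power_injective l q.
  by apply: psP; rewrite inE qps orbT.
rewrite prime_coprime // dvdn_prime2 //; apply: contraNneq p_ps => -> //.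
Qed.

Lemma abs_le_shift (z : int) M : (`|z| <= M)%N ->
  exists2 j, (j < M.*2.+1)%N & j%:Z - M%:Z = z.
Proof. by move=> zM; exists (absz (z + M%:Z)); rewrite -?addnn; lia. Qed.

Section PowerRoots.
Variable R : realType.

(** At most k residues modulo p have a given k-th power, so a fraction of at most k / p of the m has
    m^k in a given class modulo P. A large prime factor p of P makes a fixed number of classes
    negligible. *)
Lemma sum_power_root k p P (a : int) : (0 < k)%N -> prime p -> (p %| P)%N ->
  p%:R * (\sum_(0 <= m < P) (P%:Z %| (m ^ k)%N%:Z - a)%Z%:R) <= (k * P)%N%:R :> R.
Proof.
move=> k_gt0 p_pr pP; have p_gt0 := prime_gt0 p_pr.
pose g m : R := (p%:Z %| (m ^ k)%N%:Z - a)%Z%:R.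
have g_per m : g (m + p)%N = g m.
  rewrite /g -!eqz_mod_dvd; congr ((_ == _) : bool)%:R.
  by apply/eqP; rewrite eqz_mod_dvd; exact: pow_int_periodic.
apply: (@le_trans _ _ (p%:R * \sum_(0 <= m < P) g m)).
  rewrite ler_wpM2l //; apply: ler_sum => m _; rewrite ler_nat.
  have [Pd|//] := boolP (P%:Z %| _)%Z; rewrite lt0b.
  by apply: dvdz_trans Pd; rewrite dvdzE.
rewrite sum_period_dvd // natrM mulrC ler_wpM2r //.
apply: le_trans (@card_roots_Xn R 'F_p k a%:~R k_gt0).
rewrite -(sum_Fp (fun x => (x ^+ k == a%:~R)%:R : R) p_pr).
apply: ler_sum => m _; rewrite ler_nat /g; have [pd|//] := boolP (p%:Z %| _)%Z.
have /eqP : (((m ^ k)%N%:Z - a)%:~R == 0 :> 'F_p).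
  by move/dvdzP: pd => [q ->]; rewrite rmorphM /= -pmulrn pchar_Fp_0 // mulr0.
by rewrite rmorphB /= -pmulrn natrX => /eqP; rewrite subr_eq0 => ->.
Qed.

End PowerRoots.

Section SchemeConstruction.
Variables (R : realType) (k l : nat) (alpha beta : R) (Q : nat -> Prop).
Hypothesis k_gt0 : (0 < k)%N.
Hypothesis lt_alpha_beta : alpha < beta.
Hypothesis tests :
  forall B, exists p w, (B < p)%N /\ Q p /\ prime_test k l alpha beta p w.

Let scheme_step (s N P : nat) (A : int -> bool) : Prop :=
  [/\ (1 < P)%N, int_periodic P A,
      forall z : int, (`|z| <= N ^ k + s)%N -> A z = false,
      \sum_(0 <= m < P) (~~ A (m ^ k)%N%:Z)%:R <= (2 ^- s.+3 : R) * P%:R &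
      forall a : int, \sum_(0 <= m < P) (A ((m ^ l)%N%:Z + a))%:R <= (2 ^- s : R) * P%:R] /\
  (coprime N P /\
   ((forall p, prime p -> Q p -> power_injective l p) -> power_injective l P)).

(** From a block set all classes modulo P of the integers of absolute value at most M are removed,
    which keeps it periodic and can only improve the bound for l-th powers. *)
Lemma scheme_step_exists s N : (0 < N)%N -> exists P A, scheme_step s N P A.
Proof.
(* Half of the allowance 2^-(s+3) pays for the block, half for the removed classes. Primes beyond
   (2M+1) k 2^(s+4) make the latter cheap enough, and primes beyond N are coprime to N. *)
move=> N_gt0; pose e : R := 2 ^- s.+4; have e_gt0 : 0 < e by rewrite invr_gt0 exprn_gt0.
pose M := (N ^ k + s)%N; pose B := (N + M.*2.+1 * k * 2 ^ s.+4)%N.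
have [P [A [[ps [P_def ps_uniq ps_nil psP]] A_per A_k A_l]]] :=
  @blocks_exist R k l alpha beta Q lt_alpha_beta tests e B e_gt0.
pose fill (z : int) := has (fun j => P%:Z %| z - (j%:Z - M%:Z))%Z (iota 0 M.*2.+1).
have fill_per : int_periodic P fill.
  move=> z z' zz'; apply: eq_has => j.
  by rewrite -!eqz_mod_dvd; congr (_ == _); apply/eqP; rewrite eqz_mod_dvd.
have [p pps] : exists p, p \in ps by case: (ps) ps_nil => // p ? _; exists p; exact: mem_head.
have [p_pr Bp _] := psP p pps.
have pP : (p %| P)%N by rewrite P_def (big_rem p pps) /= dvdn_mulr.
have P_gt0 : (0 < P)%N.
  rewrite P_def big_seq prodn_cond_gt0 // => q /psP[q_pr _ _]; exact: prime_gt0.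
have P_gt1 : (1 < P)%N by apply: leq_trans (dvdn_leq P_gt0 pP); exact: prime_gt1.
exists P, (fun z => A z && ~~ fill z); split; last split.
- split=> //.
  + by move=> z z' zz'; rewrite (A_per z z') // (fill_per z z').
  + move=> z zM; apply/negP => /andP[_ /hasPn].
    have [j jM jz] := abs_le_shift zM => /(_ j).
    by rewrite mem_iota add0n jM jz subrr dvdz0 => /(_ isT).
  + apply: (@le_trans _ _ (\sum_(0 <= m < P) ((~~ A (m ^ k)%N%:Z)%:R +
        \sum_(0 <= j < M.*2.+1) (P%:Z %| (m ^ k)%N%:Z - (j%:Z - M%:Z))%Z%:R))).
      apply: ler_sum => m _; rewrite negb_and negbK.
      have [_|_] /= := boolP (A _); last by rewrite lerDl sumr_ge0.
      rewrite add0r /fill; have [/hasP[j jM Pj]|_] /= := boolP (has _ _); last first.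
        by rewrite sumr_ge0.
      rewrite mem_iota add0n in jM; rewrite (bigD1_seq j) ?mem_index_iota ?iota_uniq //.
      by rewrite /= Pj lerDl sumr_ge0.
    rewrite big_split /= exchange_big_nat /=.
    have -> : 2 ^- s.+3 = e + e :> R.
      rewrite /e; have -> : 2 ^- s.+4 = 2^-1 * 2 ^- s.+3 :> R by rewrite (exprS 2 s.+3) invfM.
      lra.
    rewrite mulrDl lerD //; have pR : 0 < p%:R :> R by rewrite ltr0n prime_gt0.
    rewrite -(ler_pM2l pR) big_distrr /=.
    apply: (@le_trans _ _ (\sum_(0 <= j < M.*2.+1) (k * P)%N%:R)).
      by apply: ler_sum => j _; exact: sum_power_root.
    rewrite sumr_const_nat subn0 natrM -mulrnAl mulrA ler_wpM2r //.
    rewrite /e ler_pdivlMr ?exprn_gt0 // -mulrnA -natrX -natrM ler_nat.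
    by rewrite ltnW // (leq_ltn_trans _ Bp) // (mulnC k) leq_addl.
  + move=> a; apply: (@le_trans _ _ (\sum_(0 <= m < P) (A ((m ^ l)%N%:Z + a))%:R)).
      by apply: ler_sum => m _; rewrite ler_nat; case: (A _) => //; case: (fill _).
    apply: le_trans (A_l a) _; rewrite ler_wpM2r // lef_pV2 ?posrE ?exprn_gt0 //.
    by rewrite ler_eXn2l ?ltr1n // -addn4 leq_addr.
- rewrite P_def big_seq; apply: (big_ind (fun D => coprime N D)).
  + exact: coprimen1.
  + by move=> a b Na Nb; rewrite coprimeMr Na.
  move=> q /psP[q_pr Bq _]; rewrite coprime_sym prime_coprime //.
  by apply/negP => /(dvdn_leq N_gt0); rewrite leqNgt (leq_ltn_trans _ Bq) // leq_addr.
- move=> injQ; rewrite P_def; apply: power_injective_prod => // q /psP[q_pr _ Qq].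
  by split=> //; exact: injQ.
Qed.

(** P_s and A_s depend on n_s, so the choice is made for all pairs (s, N) at once and n is then
    defined by recursion; pairs with N = 0, which never arise, get a dummy value. *)
Lemma scheme_exists : exists P A n, scheme R k l P A n /\
  ((forall p, prime p -> Q p -> power_injective l p) -> forall s, power_injective l (n s)).
Proof.
have /choice[c cP] (sN : nat * nat) : exists PA : nat * (int -> bool),
    (0 < sN.2)%N -> scheme_step sN.1 sN.2 PA.1 PA.2.
  have [N0|/(scheme_step_exists sN.1)[P [A H]]] := posnP sN.2; last by exists (P, A).
  by exists (0%N, fun=> false); rewrite N0.
pose n := fix n s := if s is t.+1 then (n t * (c (t, n t)).1)%N else 1%N.
pose P s := (c (s, n s)).1; pose A s := (c (s, n s)).2.
have n_gt0 s : (0 < n s)%N.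
  elim: s => // s IHs; have [[P_gt1 _ _ _ _] _] := cP (s, n s) IHs.
  by rewrite /= muln_gt0 IHs ltnW.
have stepP s : scheme_step s (n s) (P s) (A s) by have := cP (s, n s) (n_gt0 s).
exists P, A, n; split=> [|injQ].
  by split=> // s; have [[]] := stepP s.
elim=> [|s IHs]; first exact: power_injective1.
by have [_ [co inj]] := stepP s; apply: power_injectiveM => //; exact: inj.
Qed.

End SchemeConstruction.

Lemma power_equidistributing n l : (forall s, power_injective l (n s)) ->
  equidistributing n (fun m => (m ^ l)%N%:Z).
Proof.
by move=> injn s m m' mn m'n /injn; exact: (@Posz_equidistributing n s).
Qed.

Lemma scheme_not_dvdn (R : realType) k l : (1 < k)%N -> (1 < l)%N -> k <> l ->
  exists P A n, scheme R k l P A n.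
Proof.
move=> k_gt1 l_gt1 neq_kl; have [alpha [beta [ab tests]]] := tests_exist R k_gt1 l_gt1 neq_kl.
have [|P [A [n [S _]]]] := @scheme_exists R k l alpha beta (fun=> True) (ltnW k_gt1) ab.
  by move=> B; have [p [w [Bp pw]]] := tests B; exists p, w.
by exists P, A, n.
Qed.

Lemma scheme_bijective (R : realType) k l q : (1 < k)%N -> (1 < l)%N -> odd l ->
  prime q -> (q %| k)%N -> ~~ (q %| l)%N ->
  exists P A n, scheme R k l P A n /\ equidistributing n (fun m => (m ^ l)%N%:Z).
Proof.
move=> k_gt1 l_gt1 l_odd q_pr qk ql.
have [||P [A [n [S injn]]]] := @scheme_exists R k l (3%:R / 4%:R) (9%:R / 10%:R)
  (fun p => coprime l p.-1) (ltnW k_gt1).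
- by lra.
- by move=> B; exact: tests_bijective (ltnW l_gt1) q_pr qk ql.
exists P, A, n; split=> //; apply: power_equidistributing; apply: injn.
by move=> p p_pr; apply: power_injective_prime => //; exact: ltnW.
Qed.

(** * Extension of contents on cylinders *)

Definition cylinder (C : set word) : Prop :=
  exists W, forall y z, agree W y z -> C y -> C z.

Lemma cylinder0 : cylinder set0. Proof. by exists 0%N. Qed.

Lemma cylinderT : cylinder [set: word]. Proof. by exists 0%N. Qed.

Lemma cylinderU C D : cylinder C -> cylinder D -> cylinder (C `|` D).
Proof.
move=> [V CV] [W DW]; exists (maxn V W) => y z yz [/CV Cz|/DW Dz]; [left|right].
  by apply: Cz; apply: agreeW yz; exact: leq_maxl.
by apply: Dz; apply: agreeW yz; exact: leq_maxr.
Qed.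

Lemma cylinderC C : cylinder C -> cylinder (~` C).
Proof. by move=> [W CW]; exists W => y z yz nCy Cz; apply/nCy/(CW z) => //; exact: agree_sym. Qed.

Lemma cylinderI C D : cylinder C -> cylinder D -> cylinder (C `&` D).
Proof.
move=> cC cD; rewrite -[C]setCK -[D]setCK -setCU.
by apply: cylinderC; apply: cylinderU; exact: cylinderC.
Qed.

Lemma cylinder_shift C : cylinder C -> cylinder (shiftz 1 @^-1` C).
Proof.
move=> [W CW]; exists W.+1 => y z yz; apply: CW => i iW; rewrite /shiftz yz //.
lia.
Qed.

Lemma cylinder_open C : cylinder C -> open C.
Proof.
move=> [W CW]; rewrite openE => y Cy; apply/nbhs_wordP; exists W => z yz; exact: CW Cy.
Qed.

(** The largest subset of U determined by the window of radius W; open sets are exhausted by these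
    cylinders. *)
Definition core (U : set word) (W : nat) : set word :=
  [set y | forall z, agree W y z -> U z].

Lemma cylinder_core U W : cylinder (core U W).
Proof.
by exists W => y y' yy' Uy z y'z; apply: Uy; exact: agree_trans y'z.
Qed.

Lemma bigcup_core U : open U -> \bigcup_W core U W = U.
Proof.
move=> oU; apply/seteqP; split=> [y [W _ Uy]|y Uy]; first exact: Uy.
have /nbhs_wordP[W yW] : nbhs y U by exact: open_nbhs_nbhs.
by exists W.
Qed.

Definition cylinder_word : Type := word.
HB.instance Definition _ := Pointed.on cylinder_word.
HB.instance Definition _ := @isAlgebraOfSets.Build default_measure_display cylinder_word
  cylinder cylinder0 cylinderU cylinderC.

Lemma open_cylinder_algebra (U : set word) : open U -> <<s cylinder >> U.
Proof.
move=> oU; rewrite -(bigcup_core oU).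
have := @bigcupT_measurable _ (g_sigma_algebraType cylinder) (core U); apply => W.
by apply: sub_gen_smallest; exact: cylinder_core.
Qed.

Lemma borel_wordE : <<s @open word >> = <<s cylinder >> :> set (set word).
Proof.
apply/seteqP; split; apply: smallest_sub; try exact: smallest_sigma_algebra.
  exact: open_cylinder_algebra.
by move=> C /cylinder_open oC; exact: sub_gen_smallest.
Qed.

Section ContentExtension.
Variables (R : realType) (L : set word -> R).
Hypothesis L_ge0 : forall C, 0 <= L C.
Hypothesis L0 : L set0 = 0.
Hypothesis LT : L setT = 1.
Hypothesis LU : forall C D, cylinder C -> cylinder D -> C `&` D = set0 ->
  L (C `|` D) = L C + L D.

Let content (C : set cylinder_word) : \bar R := (L C)%:E.

(* Compactness of the full shift makes countable additivity on cylinders finite. *)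
Lemma disjoint_cylinders_finite (F : nat -> set word) : (forall i, cylinder (F i)) ->
  trivIset setT F -> cylinder (\bigcup_i F i) -> exists N, forall i, (N <= i)%N -> F i = set0.
Proof.
move=> cF tF cU.
have cW := (compact_near_coveringP _).1 word_compact.
have [|N _ HN] := cW nat \oo (fun N y => forall j, (N <= j)%N -> ~ F j y) _.
  move=> y _; have [[i _ Fiy]|nUy] := pselect ((\bigcup_i F i) y).
    exists (F i, [set N | (i < N)%N]) => /=.
      split; last by exists i.+1.
      by apply: open_nbhs_nbhs; split=> //; apply: cylinder_open.
    move=> [y' N] /= [Fiy' iN] j Nj Fjy'.
    have : i = j by apply: tF => //; exists y'.
    by move=> ij; move: iN; rewrite ltnNge ij Nj.
  exists (~` (\bigcup_i F i), setT) => /=.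
    split; last exact: filterT.
    by apply: open_nbhs_nbhs; split=> //; apply: cylinder_open; exact: cylinderC.
  by move=> [y' N] /= [nUy' _] j _ Fjy'; apply: nUy'; exists j.
exists N => i Ni; rewrite -subset0 => y Fiy.
exact: (HN N (leqnn N) y I i Ni).
Qed.

Let content_semi_sigma_additive : semi_sigma_additive content.
Proof.
move=> F mF tF mU; have [N FN] := disjoint_cylinders_finite mF tF mU.
have sumE n : \sum_(0 <= i < n) content (F i) = content (\big[setU/set0]_(i < n) F i) /\
    cylinder (\big[setU/set0]_(i < n) F i).
  elim: n => [|n [IHn cn]]; first by rewrite big_geq // big_ord0 /content L0; split=> //; exact: cylinder0.
  rewrite big_nat_recr //= IHn big_ord_recr /=; split; last by apply: cylinderU => //; exact: mF.
  have FnI : \big[setU/set0]_(i < n) F i `&` F n = set0.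
    rewrite -subset0 => y []; rewrite -bigcup_mkord => -[i /= ni Fi] Fn.
    have /eqP : i = n by [apply: tF => //; exists y].
    by rewrite ltn_eqF.
  by rewrite /content (LU cn (mF n) FnI) EFinD.
apply: cvg_near_cst; exists N => // n /= Nn; rewrite (sumE n).1; congr content.
rewrite -bigcup_mkord; apply/seteqP; split=> y [i Pi Fiy]; exists i => //=.
by rewrite ltnNge; apply/negP => ni; move: Fiy; rewrite FN // (leq_trans Nn).
Qed.

(** Caratheodory's extension lives on the sigma-algebra generated by the cylinders; [borel_wordE]
    identifies it with the Borel one, and the measure is repackaged there. *)
Lemma content_extension : exists mu : probability borel_word R,
  forall C, cylinder C -> mu C = (L C)%:E.
Proof.
have content0 : content set0 = 0%E by rewrite /content L0.
have content_ge0 C : (0 <= content C)%E by rewrite /content lee_fin.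
pose pre : {measure set cylinder_word -> \bar R} := HB.pack content
  (@isMeasure.Build _ cylinder_word R content content0 content_ge0
    content_semi_sigma_additive).
pose ext := measure_extension pre.
have extE C : cylinder C -> ext C = (L C)%:E.
  by move=> cC; rewrite /ext /measure_extension measurable_mu_extE.
pose nu : set borel_word -> \bar R := ext.
have nu0 : nu set0 = 0%E by rewrite /nu extE ?L0 //; exact: cylinder0.
have nu_ge0 C : (0 <= nu C)%E by exact: (measure_ge0 ext).
have nu_add : semi_sigma_additive nu.
  move=> F mF tF mU; have mE (C : set word) : measurable (C : set borel_word) ->
      measurable (C : set (g_sigma_algebraType (@measurable _ cylinder_word))).
    by rewrite /measurable /= borel_wordE.
  by apply: (@measure_semi_sigma_additive _ _ _ ext) => // [i|]; exact: mE.
have nuT : nu setT = 1%E by rewrite /nu extE ?LT //; exact: cylinderT.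
pose nuM : {measure set borel_word -> \bar R} := HB.pack nu
  (@isMeasure.Build _ borel_word R nu nu0 nu_ge0 nu_add).
pose mu : probability borel_word R := HB.pack (Measure.sort nuM)
  (@Measure_isProbability.Build _ borel_word R nuM nuT).
by exists mu.
Qed.

End ContentExtension.

(** Cylinders form a pi-system generating the Borel sets. *)
Lemma probability_cylinder_unique (R : realType) (mu : probability borel_word R)
    (nu : {measure set borel_word -> \bar R}) :
  (forall C, cylinder C -> mu C = nu C) ->
  forall A : set borel_word, measurable A -> mu A = nu A.
Proof.
move=> munu; apply: (@measure_unique _ R borel_word cylinder (fun=> setT)).
- exact: borel_wordE.
- by move=> C D; exact: cylinderI.
- by move=> _; exact: cylinderT.
- by apply/seteqP; split=> // y _; exists 0%N.
- exact: munu.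
move=> _; rewrite -ge0_fin_numE ?measure_ge0 //; exact: fin_num_measure.
Qed.

(** * Invariant measures *)

Lemma shift_invariant_orbit_closure x n y :
  orbit_closure x (shiftz n y) <-> orbit_closure x y.
Proof.
split; last exact: shiftz_orbit_closure.
by move=> /(@shiftz_orbit_closure x (- n)); rewrite -shiftzD addNr shiftz0.
Qed.

Lemma measurable_open (U : set borel_word) : open (U : set word) -> measurable U.
Proof. by move=> oU; exact: sub_gen_smallest. Qed.

Lemma measurable_orbit_closure x : measurable (orbit_closure x : set borel_word).
Proof.
rewrite -[X in measurable X]setCK; apply: measurableC; apply: measurable_open.
by rewrite openC; exact: orbit_closure_closed.
Qed.

Lemma open_shiftz n (U : set word) : open U -> open (shiftz n @^-1` U).
Proof.
move=> oU; rewrite openE => y Uy; apply/nbhs_wordP.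
have [W yW] := (nbhs_wordP _ _).1 (open_nbhs_nbhs (conj oU Uy)).
exists (W + `|n|)%N => z yz; apply: yW => i iW; rewrite /shiftz yz //; lia.
Qed.

Lemma measurable_shiftz n : measurable_fun [set: borel_word] (shiftz n : borel_word -> borel_word).
Proof.
apply: (@measurability _ _ borel_word borel_word _ _ (@open word)) => // _ [U oU <-]; rewrite setTI.
by apply: (@measurable_open (shiftz n @^-1` (U : set word))); exact: open_shiftz.
Qed.

Lemma within_continuous_measurable (R : realType) (X : set word) (f : word -> R) :
  measurable (X : set borel_word) -> {within X, continuous f} ->
  measurable_fun (X : set borel_word) (f : borel_word -> R).
Proof.
move=> mX /continuousP cf; apply: (measurability _ (RGenOpens.measurableE R)).
move=> _ [_ [a [b ->] <-]].
have /cf/open_subspaceP[V oV VX] : open `]a, b[%classic by exact: interval_open.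
by rewrite setIC -VX; apply: measurableI => //; exact: measurable_open.
Qed.

Section InvariantIntegrals.
Variables (R : realType) (nu : probability borel_word R).
Hypothesis nu_shift : forall A : set borel_word, measurable A -> nu (shiftz 1 @^-1` A) = nu A.

Lemma invariant_shiftz (m : nat) (A : set borel_word) : measurable A ->
  nu (shiftz m%:Z @^-1` A) = nu A.
Proof.
move=> mA; elim: m => [|m IHm].
  by congr (nu _); apply/seteqP; split=> y; rewrite /preimage /= shiftz0.
rewrite -IHm -[RHS]nu_shift; last first.
  by rewrite -[X in measurable X]setTI; exact: measurable_shiftz.
by congr (nu _); apply/seteqP; split=> y; rewrite /preimage /= -shiftzD -PoszD addn1.
Qed.

Definition bounded_measurable (g : word -> R) : Prop :=
  measurable_fun [set: borel_word] (g : borel_word -> R) /\ exists C, forall y, `|g y| <= C.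

Lemma bounded_measurable_integrable g : bounded_measurable g ->
  nu.-integrable [set: borel_word] (EFin \o g).
Proof.
move=> [mg [C gC]]; apply: measurable_bounded_integrable => //.
  by rewrite -ge0_fin_numE ?measure_ge0 //; exact: fin_num_measure.
by exists C; split; rewrite ?num_real // => M CM y _; exact: le_trans (gC y) (ltW CM).
Qed.

Lemma bounded_measurable_shiftz g n : bounded_measurable g ->
  bounded_measurable (fun y => g (shiftz n y)).
Proof.
move=> [mg [C gC]]; split; last by exists C.
exact: measurableT_comp mg (measurable_shiftz n).
Qed.

Lemma Rintegral_shiftz g (m : nat) : bounded_measurable g ->
  Rintegral nu [set: borel_word] (fun y => g (shiftz m%:Z y)) =
  Rintegral nu [set: borel_word] g.
Proof.
move=> bg; rewrite /Rintegral; congr fine.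
transitivity (\int[pushforward nu (shiftz m%:Z : borel_word -> borel_word)]_y (g y)%:E)%E.
  rewrite (integral_pushforward (measurable_shiftz m)) //.
    by apply/measurable_EFinP; exact: bg.1.
  exact: bounded_measurable_integrable (bounded_measurable_shiftz m bg).
apply: eq_measure_integral => [|mf A mA _]; first exact: measurable_shiftz.
exact: (invariant_shiftz m mA).
Qed.

Lemma bounded_measurable_average g a N : bounded_measurable g ->
  bounded_measurable (fun y => real_average g a y N).
Proof.
move=> bg; split.
  apply: measurable_funM; first exact: measurable_cst.
  by apply: measurable_sum => m; exact: (bounded_measurable_shiftz _ bg).1.
have [_ [C gC]] := bg; exists (`|N%:R^-1| * (N%:R * C)) => y.
rewrite /real_average normrM ler_wpM2l //; apply: le_trans (ler_norm_sum _ _ _) _.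
rewrite mulr_natl -[N in leRHS]subn0 -subSS -sumr_const_nat.
by apply: ler_sum => m _; exact: gC.
Qed.

Lemma Rintegral_average g N : bounded_measurable g -> (0 < N)%N ->
  Rintegral nu [set: borel_word] (fun y => real_average g Posz y N) =
  Rintegral nu [set: borel_word] g.
Proof.
move=> bg N_gt0; rewrite /real_average.
have bsum M : bounded_measurable (fun y => \sum_(1 <= m < M.+1) g (shiftz m%:Z y)).
  split; first by apply: measurable_sum => m; exact: (bounded_measurable_shiftz _ bg).1.
  have [_ [C gC]] := bg; exists (M%:R * C) => y; apply: le_trans (ler_norm_sum _ _ _) _.
  rewrite mulr_natl -[M in leRHS]subn0 -subSS -sumr_const_nat.
  by apply: ler_sum => m _; exact: gC.
rewrite RintegralZl //; last exact: bounded_measurable_integrable (bsum N).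
have -> : Rintegral nu [set: borel_word] (fun y => \sum_(1 <= m < N.+1) g (shiftz m%:Z y)) =
    N%:R * Rintegral nu [set: borel_word] g.
  elim: N {N_gt0} => [|N IHN].
    rewrite mul0r; under eq_Rintegral do rewrite big_geq //.
    by rewrite Rintegral_cst // mul0r.
  under eq_Rintegral do rewrite big_nat_recr //=.
  rewrite RintegralD //.
  - by rewrite IHN Rintegral_shiftz // -natr1 mulrDl mul1r.
  - exact: bounded_measurable_integrable (bsum N).
  exact: bounded_measurable_integrable (bounded_measurable_shiftz _ bg).
by rewrite mulrA mulVf ?mul1r // pnatr_eq0 -lt0n.
Qed.

(* [f] is replaced by its extension by zero outside the orbit closure: the
   averages of the extension are bounded everywhere. *)
Lemma Rintegral_limit (x : word) (f : word -> R) (L : R) :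
  nu (orbit_closure x) = 1%E -> {within orbit_closure x, continuous f} ->
  (forall y, orbit_closure x y -> real_average f Posz y @ \oo --> L) ->
  Rintegral nu (orbit_closure x) f = L.
Proof.
set X := orbit_closure x => nuX cf fL.
have mX : measurable (X : set borel_word) by exact: measurable_orbit_closure.
have [C C_ge0 fC] := within_continuous_bounded (@orbit_closure_compact x) cf.
pose h := f \_ X.
have hC y : `|h y| <= C.
  by rewrite /h patchE; case: ifPn => [/set_mem/fC//|_]; rewrite normr0.
have bh : bounded_measurable h.
  split; last by exists C.
  by apply/(measurable_restrictT (f : borel_word -> R) mX); exact: within_continuous_measurable.
rewrite Rintegral_mkcond -/h.
have avg_h y N : real_average h Posz y N = if y \in X then real_average f Posz y N else 0.
  case: ifPn => [/set_mem Xy|Xy]; rewrite /real_average.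
    congr (_ * _); apply: eq_bigr => m _; rewrite /h patchE mem_set //.
    exact: shiftz_orbit_closure.
  rewrite big1 ?mulr0 // => m _; rewrite /h patchE memNset // => /shift_invariant_orbit_closure.
  by move/mem_set; apply/negP.
have avgC y N : `|real_average h Posz y N| <= C.
  have [->|N_gt0] := posnP N; first by rewrite /real_average invr0 mul0r normr0.
  rewrite /real_average normrM ger0_norm ?invr_ge0 // ler_pdivrMl ?ltr0n //.
  apply: le_trans (ler_norm_sum _ _ _) _.
  rewrite mulr_natl -[N in leRHS]subn0 -subSS -sumr_const_nat.
  by apply: ler_sum => m _.
have lim_h : (\int[nu]_y (real_average h Posz y N)%:E @[N --> \oo] -->
     \int[nu]_y ((cst L : borel_word -> R) \_ X y)%:E)%E.
  apply: (@dominated_cvg _ borel_word R nu setT measurableT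
    (fun N y => (real_average h Posz y N)%:E) _ (cst C%:E)) => //.
  - by move=> N; apply/measurable_EFinP; exact: (bounded_measurable_average _ _ bh).1.
  - move=> y _; apply: cvg_EFin; first by apply: nearW.
    rewrite patchE; under eq_fun do rewrite avg_h.
    by case: ifPn => [/set_mem/fL//|_]; exact: cvg_cst.
  - exact: finite_measure_integrable_cst.
  - by move=> N y _; rewrite /= lee_fin avgC.
have intL : (\int[nu]_y ((cst L : borel_word -> R) \_ X y)%:E)%E = L%:E.
  have -> : (fun y => ((cst L : borel_word -> R) \_ X y)%:E) = (cst L%:E) \_ X.
    by apply/funext => y; rewrite !patchE; case: ifP.
  rewrite -integral_mkcond; transitivity (L%:E * nu X)%E; last by rewrite nuX mule1.
  exact: integral_cst.
rewrite intL in lim_h.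
(* By invariance these integrals are the same for all N >= 1, while dominated convergence gives them
   the limit L. *)
have : (fun N => \int[nu]_y (real_average h Posz y N)%:E)%E @ \oo -->
    (Rintegral nu [set: borel_word] h)%:E.
  apply: cvg_near_cst; exists 1%N => // N /= N_gt0.
  rewrite -(Rintegral_average bh N_gt0) /Rintegral fineK //.
  apply: integrable_fin_num => //.
  exact: bounded_measurable_integrable (bounded_measurable_average _ _ bh).
by move=> lim_h'; apply: EFin_inj; exact: (cvg_unique (@ereal_hausdorff R) lim_h' lim_h).
Qed.

End InvariantIntegrals.

(** * Unique ergodicity and equidistribution *)

Section UniqueErgodicity.
Variables (R : realType) (k l : nat) (P : nat -> nat) (A : nat -> int -> bool).
Variable n : nat -> nat.
Hypothesis S : scheme R k l P A n.
Local Notation x := (toeplitz_word S).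
Local Notation X := (orbit_closure x).

Let Xx : X x.
Proof. by rewrite -{2}(shiftz0 x); exact: orbit_closure_shift. Qed.

Lemma cylinder_within_continuous (Y : set word) C : cylinder C ->
  {within Y, continuous (\1_C : word -> R)}.
Proof.
move=> [W CW]; apply/subspace_continuousP => y _; apply: cvg_near_cst.
apply: filterS (nbhs_agree y W) => z yz _; change (\1_C z = \1_C y :> R).
rewrite !indicE; congr (nat_of_bool _)%:R.
apply/idP/idP => /set_mem Cz; apply/mem_set; first exact: CW (agree_sym yz) Cz.
exact: CW yz Cz.
Qed.

(** The candidate for the integral of f; by [mean_cvg], for continuous f any point of X and any
    admissible equidistributing sequence give the same value. *)
Definition mean (f : word -> R) : R := lim (real_average f Posz x @ \oo).

Lemma mean_cvg f a y : {within X, continuous f} -> X y -> admissible R P A a ->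
  equidistributing n a -> real_average f a y @ \oo --> mean f.
Proof.
move=> cf Xy aP aE; have [L fL] := real_average_limit cf.
have -> // : mean f = L; last exact: fL.
apply: cvg_lim => //; apply: fL => //; [exact: Posz_admissible S|exact: Posz_equidistributing].
Qed.

Lemma mean_Posz f y : {within X, continuous f} -> X y ->
  real_average f Posz y @ \oo --> mean f.
Proof.
move=> cf Xy; apply: mean_cvg => //; [exact: Posz_admissible S|exact: Posz_equidistributing].
Qed.

Lemma mean_eventually f c : {within X, continuous f} ->
  (forall N, (0 < N)%N -> real_average f Posz x N = c) -> mean f = c.
Proof.
move=> cf fc; apply: (cvg_unique _ (mean_Posz cf Xx)) => //.
by apply: cvg_near_cst; exists 1%N.
Qed.

Lemma mean_indic_ge0 C : cylinder C -> 0 <= mean \1_C.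
Proof.
move=> cC; have mC := mean_Posz (cylinder_within_continuous cC) Xx.
rewrite -(cvg_lim _ mC) //; apply: limr_ge; first by apply/cvg_ex; exists (mean \1_C).
apply: nearW => N; rewrite /real_average mulr_ge0 ?invr_ge0 //.
by apply: sumr_ge0 => m _; rewrite indicE.
Qed.

Lemma mean_indicU C D : cylinder C -> cylinder D -> C `&` D = set0 ->
  mean \1_(C `|` D) = mean \1_C + mean \1_D.
Proof.
move=> cC cD CD0; have cCD := cylinderU cC cD.
have mC := mean_Posz (cylinder_within_continuous cC) Xx.
have mD := mean_Posz (cylinder_within_continuous cD) Xx.
apply: (cvg_unique _ (mean_Posz (cylinder_within_continuous cCD) Xx)) => //.
rewrite /= (_ : real_average (\1_(C `|` D)) Posz x = fun N =>
    real_average (\1_C) Posz x N + real_average (\1_D) Posz x N); first exact: cvgD.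
apply/funext => N; rewrite /real_average /= -mulrDr -big_split /=; congr (_ * _).
apply: eq_bigr => m _; rewrite !indicE in_setU.
have [Cm|] := boolP (_ \in C); have [Dm|] := boolP (_ \in D) => //=; rewrite ?addr0 ?add0r //.
have : (C `&` D) (shiftz m%:Z x) by split; apply/set_mem.
by rewrite CD0.
Qed.

Lemma mean_indic0 : mean \1_set0 = 0.
Proof.
apply: mean_eventually; first exact: cylinder_within_continuous cylinder0.
by move=> N _; rewrite /real_average big1 ?mulr0 // => m _; rewrite indicE in_set0.
Qed.

Lemma mean_indicT : mean \1_setT = 1.
Proof.
apply: mean_eventually; first exact: cylinder_within_continuous cylinderT.
move=> N N_gt0; rewrite /real_average (eq_bigr (fun=> 1)).
  by rewrite sumr_const_nat subSS subn0 mulVf // pnatr_eq0 -lt0n.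
by move=> m _; rewrite indicE in_setT.
Qed.

Lemma mean_measure_exists : exists mu : probability borel_word R,
  forall C, cylinder C -> mu C = (mean \1_C)%:E.
Proof.
(* A content has to be nonnegative on all sets, and off the cylinders the limit may be a default
   value; on cylinders the absolute value changes nothing. *)
have [||||mu muE] := @content_extension R (fun C => `|mean \1_C|).
- by move=> C.
- by rewrite mean_indic0 normr0.
- by rewrite mean_indicT normr1.
- move=> C D cC cD CD0; rewrite !ger0_norm ?mean_indic_ge0 ?mean_indicU //.
  exact: cylinderU.
by exists mu => C cC; rewrite muE // ger0_norm // mean_indic_ge0.
Qed.

(** The complement of X is a countable union of cylinders missed by the orbit of x, so their means
    vanish. Shifting a cylinder amounts to starting the average at the next point of the orbit, and
    the mean does not depend on the starting point. *)
Lemma mean_measure_invariant (mu : probability borel_word R) :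
  (forall C, cylinder C -> mu C = (mean \1_C)%:E) -> invariant_on X mu.
Proof.
move=> muE; split.
  have oXC : open (~` X) by rewrite openC; exact: orbit_closure_closed.
  have mXC : measurable (~` X : set borel_word) by exact: measurable_open.
  have muXC : mu (~` X) = 0%E.
    apply/eqP; rewrite eq_le measure_ge0 andbT.
    have mcore W : measurable (core (~` X) W : set borel_word).
      by apply: measurable_open; apply: cylinder_open; exact: cylinder_core.
    apply: (@le_trans _ _ (\sum_(W <oo) mu (core (~` X) W))%E).
      by apply: measure_sigma_subadditive => //; rewrite (bigcup_core oXC).
    rewrite eseries0 // => W _ _; rewrite muE; last exact: cylinder_core.
    congr _%:E; apply: mean_eventually.
      by apply: cylinder_within_continuous; exact: cylinder_core.
    move=> N _; rewrite /real_average big1 ?mulr0 // => m _.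
    rewrite indicE memNset // => /(_ _ (fun _ _ => erefl)); apply.
    exact: orbit_closure_shift.
  have := probability_setC mu mXC; rewrite setCK => ->.
  by rewrite muXC sube0.
move=> B mB; apply/esym.
apply: (@probability_cylinder_unique R mu (pushforward mu (shiftz 1 : borel_word -> borel_word))) mB.
  exact: measurable_shiftz.
move=> mf C cC; transitivity (mean \1_(shiftz 1 @^-1` C))%:E; last first.
  by apply/esym; exact: muE (cylinder_shift cC).
rewrite muE //; congr _%:E; apply/esym.
apply: (cvg_unique _ (mean_Posz (cylinder_within_continuous (cylinder_shift cC)) Xx)) => //.
have := mean_Posz (cylinder_within_continuous cC) (@orbit_closure_shift x 1).
rewrite /= (_ : real_average _ _ (shiftz 1 _) = real_average (\1_(shiftz 1 @^-1` C)) Posz x) //.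
apply/funext => N; rewrite /real_average; congr (_ * _); apply: eq_bigr => m _.
by rewrite !indicE -shiftzD addrC shiftzD; congr (nat_of_bool _)%:R.
Qed.

Lemma invariant_Rintegral (nu : probability borel_word R) f : invariant_on X nu ->
  {within X, continuous f} -> Rintegral nu X f = mean f.
Proof.
move=> [nuX nu_inv] cf; apply: Rintegral_limit => // y Xy; exact: mean_Posz.
Qed.

Lemma invariant_cylinder (nu : probability borel_word R) C : invariant_on X nu ->
  cylinder C -> nu C = (mean \1_C)%:E.
Proof.
move=> nu_inv cC; rewrite -(invariant_Rintegral nu_inv (cylinder_within_continuous cC)).
have mX := measurable_orbit_closure x.
have mC : measurable (C : set borel_word) by apply: measurable_open; exact: cylinder_open.
have nuXC : nu (~` X) = 0%E by rewrite probability_setC // nu_inv.1 subee.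
rewrite /Rintegral integral_indic // fineK; last exact: fin_num_measure (measurableI _ _ mC mX).
rewrite (measureDI nu mC mX) [X in (X + _)%E](_ : _ = 0%E) ?add0e //.
apply/eqP; rewrite eq_le measure_ge0 andbT -nuXC; apply: le_measure.
- by apply/mem_set; exact: measurableD.
- by apply/mem_set; exact: measurableC.
by move=> y [].
Qed.

(** Every invariant probability measure on X integrates a continuous f to [mean f]; for indicators
    of cylinders this determines the measure. *)
Lemma scheme_unique_invariant : exists2 mu : probability borel_word R,
  unique_invariant_on X mu &
  forall a, admissible R P A a -> equidistributing n a ->
    forall y, X y -> equidistributed X mu a y.
Proof.
have [mu muE] := mean_measure_exists; have mu_inv := mean_measure_invariant muE.
exists mu.
  split=> // nu nu_inv; apply: probability_cylinder_unique => C cC.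
  by transitivity (mean \1_C)%:E; [exact: invariant_cylinder|apply/esym/muE].
move=> a aP aE y Xy F /within_continuous_Re_Im[cre cim]; apply/average_cvgP.
by rewrite /= !(invariant_Rintegral mu_inv) //; split; apply: mean_cvg.
Qed.

End UniqueErgodicity.

Theorem theorem1p1 (R : realType) (k l : nat)
    (k_gt1 : (1 < k)%N) (l_gt1 : (1 < l)%N) (neq_kl : k <> l) :
  (exists x : word,
    [/\ toeplitz x,
        toeplitz_regular R x,
        (forall F : word -> R[i]^o, {within orbit_closure x, continuous F} ->
          forall y : word, orbit_closure x y ->
            cvg (average F (fun m => (m ^ l)%N%:Z) y @ \oo)) &
        ~ cvg (average (@sign0 R) (fun m => (m ^ k)%N%:Z) x @ \oo)])
  /\
  (odd l -> (exists q : nat, [/\ prime q, (q %| k)%N & ~~ (q %| l)%N]) ->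
   exists x : word,
    [/\ toeplitz x,
        toeplitz_regular R x,
        (forall F : word -> R[i]^o, {within orbit_closure x, continuous F} ->
          forall y : word, orbit_closure x y ->
            cvg (average F (fun m => (m ^ l)%N%:Z) y @ \oo)),
        ~ cvg (average (@sign0 R) (fun m => (m ^ k)%N%:Z) x @ \oo) &
        exists2 mu : probability borel_word R,
          unique_invariant_on (orbit_closure x) mu &
          forall y : word, orbit_closure x y ->
            equidistributed (orbit_closure x) mu (fun m => (m ^ l)%N%:Z) y]).
Proof.
split.
  have [P [A [n S]]] := scheme_not_dvdn R k_gt1 l_gt1 neq_kl.
  exists (toeplitz_word S); split.
  - exact: toeplitz_word_toeplitz.
  - exact: toeplitz_word_regular.
  - by move=> F cF y; exact: average_pow_cvg.
  - exact: sign_average_not_cvg.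
move=> l_odd [q [q_pr qk ql]].
have [P [A [n [S nE]]]] := scheme_bijective R k_gt1 l_gt1 l_odd q_pr qk ql.
exists (toeplitz_word S); split.
- exact: toeplitz_word_toeplitz.
- exact: toeplitz_word_regular.
- by move=> F cF y; exact: average_pow_cvg.
- exact: sign_average_not_cvg.
have [mu mu_unique mu_eq] := scheme_unique_invariant S.
by exists mu => // y; apply: mu_eq => //; exact: pow_admissible S.
Qed.
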